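(* Suppose the channel from Alice to Bob is a stationary memoryless classical channel with output distributions $P_x$, $x\in\mathcal{X}=\{0,1,\dots,N\}$, such that $\operatorname{supp}(P_x)\subseteq\operatorname{supp}(P_0)$ for all $x\in\mathcal{X}$, and the channel from Alice to Willie is a stationary memoryless classical-quantum channel $x\mapsto\rho_x$ with $\operatorname{supp}(\rho_x)\subseteq\operatorname{supp}(\rho_0)$ for all $x\in\mathcal{X}$, such that $\rho_0$ is not a mixture of $\{\rho_x\}_{x\in\mathcal{X}\setminus\{0\}}$. Let $\tilde p$ be a probability distribution on $\mathcal{X}\setminus\{0\}$ and $\tilde\rho=\sum_{x\ne0}\tilde p(x)\rho_x$. Then there exists a sequence of coding schemes such that $\lim_{n\to\infty}D(\bar\rho^n\|\rho_0^{\otimes n})=0$, $\lim_{n\to\infty}\mathbb{P}_{\rm e}^B=0$, $$\lim_{n\to\infty}\frac{\log M}{\sqrt{nD(\bar\rho^n\|\rho_0^{\otimes n})}}=\frac{\sum_{x\ne0}\tilde p(x)D(P_x\|P_0)}{\sqrt{\tfrac12\chi^2(\tilde\rho\|\rho_0)}},$$ and $$\lim_{n\to\infty}\frac{\log K}{\sqrt{nD(\bar\rho^n\|\rho_0^{\otimes n})}}=\frac{\big[\sum_{x\ne0}\tilde p(x)\big(D(\rho_x\|\rho_0)-D(P_x\|P_0)\big)\big]^+}{\sqrt{\tfrac12\chi^2(\tilde\rho\|\rho_0)}}.$$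
   Context: Alice inputs symbols from a finite alphabet $\mathcal{X}$, with $0$ the innocent symbol. Bob's channel is classical (e.g. induced by a fixed single-symbol POVM $\{\Pi_y\}$ applied to each output, $P_x(y)=\operatorname{Tr}\{\sigma_x\Pi_y\}$): input sequence $\mathbf{x}$ yields i.i.d.-per-symbol outputs $y_i\sim P_{x_i}$, and Bob decodes from $y^n$ and the key. Willie receives $\rho^n(\mathbf{x})=\rho_{x_1}\otimes\cdots\otimes\rho_{x_n}$ (finite-dimensional density operators) and is unrestricted. A coding scheme: codewords $\mathbf{x}(m,k)\in\mathcal{X}^n$, $m\in\{1,\dots,M\}$ (uniform message), $k\in\{1,\dots,K\}$ (uniform pre-shared secret known to Bob); $\mathbb{P}_{\rm e}^B$ is Bob's average decoding error probability; $\bar\rho^n=\frac{1}{MK}\sum_{m,k}\rho^n(\mathbf{x}(m,k))$. ''$\rho_0$ is not a mixture of $\{\rho_x\}_{x\ne0}$'' means no probability distribution $\pi$ on $\mathcal{X}\setminus\{0\}$ gives $\rho_0=\sum_{x\ne0}\pi(x)\rho_x$. $D(P_x\|P_0)$ is the classical relative entropy; $D(\rho\|\sigma)=\operatorname{Tr}\{\rho(\log\rho-\log\sigma)\}$; $\chi^2(\rho\|\sigma)=\operatorname{Tr}\{(\rho-\sigma)^2\sigma^{-1}\}$; $[c]^+=\max\{c,0\}$. *)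

(* Defs.v *)
From HB Require Import structures.
From mathcomp Require Import all_boot all_order all_algebra.
From mathcomp Require Import sesquilinear spectral.
From mathcomp Require Import complex mxtens.
From mathcomp Require Import all_classical all_reals.
From mathcomp Require Import topology normedtype sequences exp.

Set Implicit Arguments.
Unset Strict Implicit.
Unset Printing Implicit Defensive.

Import Order.TTheory GRing.Theory Num.Theory.
Local Open Scope ring_scope.

(* d^n, written so that dpow d n.+1 is convertible to d * dpow d n *)
Fixpoint dpow (d n : nat) : nat := if n is n'.+1 then (d * dpow d n')%N else 1%N.

Section Quantum.
Variable R : realType.
Local Notation C := (R[i]).

(* Matrix functional calculus of a normal (here: Hermitian) matrix through its
   spectral decomposition A = P^-1 diag(lambda) P (P unitary):
   f(A) = P^-1 diag(f(Re lambda)) P. *)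
Definition mxfun n (f : R -> R) (A : 'M[C]_n) : 'M[C]_n :=
  invmx (spectralmx A) *m
  diag_mx (map_mx (fun z : C => ((f (complex.Re z))%:C)%C) (spectral_diag A)) *m
  spectralmx A.

(* log on the support (ln 0 = 0 in mathcomp-analysis) *)
Definition logmx n (A : 'M[C]_n) := mxfun (@ln R) A.
(* inverse on the support (0^-1 = 0) *)
Definition suppinvmx n (A : 'M[C]_n) := mxfun (fun t => t^-1) A.

Definition qrelent n (rho sigma : 'M[C]_n) : R :=
  complex.Re (\tr (rho *m (logmx rho - logmx sigma))).

Definition chi2 n (rho sigma : 'M[C]_n) : R :=
  complex.Re (\tr ((rho - sigma) *m (rho - sigma) *m suppinvmx sigma)).

Definition is_state n (rho : 'M[C]_n) : Prop :=
  [/\ rho \is hermsymmx,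
      forall v : 'rV[C]_n, 0 <= (v *m rho *m (map_mx Num.conj v)^T) 0 0
    & \tr rho = 1].

(* supp(rho) = column space (range) of rho *)
Definition supp_sub n (rho sigma : 'M[C]_n) : Prop := (rho^T <= sigma^T)%MS.

Fixpoint tensI d n : ('I_n -> 'M[C]_d) -> 'M[C]_(dpow d n) :=
  if n is n'.+1 return ('I_n -> 'M[C]_d) -> 'M[C]_(dpow d n)
  then fun f => f ord0 *t tensI (fun i : 'I_n' => f (lift ord0 i))
  else fun _ => 1%:M.

End Quantum.

Section Classical.
Variable R : realType.

Definition is_distr (T : finType) (p : T -> R) : Prop :=
  (forall t, 0 <= p t) /\ \sum_t p t = 1.

Definition crelent (Y : finType) (p q : Y -> R) : R :=
  \sum_y p y * ln (p y / q y).
End Classical.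

(* A coding scheme of block length n: M messages, K keys,
   codewords x(m,k) in X^n with X = 'I_N.+1 (0 = ord0 innocent symbol),
   and Bob's decoder from (y^n, k) to a message. *)
Record scheme (N : nat) (Y : finType) (n : nat) := Scheme {
  sM : nat;
  sK : nat;
  sM_gt0 : (0 < sM)%N;
  sK_gt0 : (0 < sK)%N;
  code : 'I_sM -> 'I_sK -> {ffun 'I_n -> 'I_N.+1};
  dec : {ffun 'I_n -> Y} -> 'I_sK -> 'I_sM }.

Arguments sM {N Y n} s.
Arguments sK {N Y n} s.
Arguments code {N Y n} s _ _.
Arguments dec {N Y n} s _ _.

Section SchemeQuantities.
Variables (R : realType) (N d : nat) (Y : finType).
Variables (P : 'I_N.+1 -> Y -> R) (rho : 'I_N.+1 -> 'M[R[i]]_d).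

Definition errB n (S : scheme N Y n) : R :=
  ((sM S * sK S)%:R)^-1 *
  \sum_(m < sM S) \sum_(k < sK S) \sum_(y : {ffun 'I_n -> Y})
     (\prod_(i < n) P (code S m k i) (y i)) * (dec S y k != m)%:R.

Definition rhobar n (S : scheme N Y n) : 'M[R[i]]_(dpow d n) :=
  ((sM S * sK S)%:R)^-1 *:
  \sum_(m < sM S) \sum_(k < sK S) tensI (fun i => rho (code S m k i)).

Definition rho0n n : 'M[R[i]]_(dpow d n) := tensI (fun _ : 'I_n => rho ord0).

End SchemeQuantities.

(* Main.v *)
(* A codeword carries non-innocent symbols at about A positions, drawn i.i.d.
   with a small weight s from a prefix of n' positions; on the rest Alice is
   silent. Bob's threshold decoder distinguishes exp(A * sum pt D(P_x||P_0))
   messages (Chernoff bound), and exp(A * sum pt D(rho_x||rho_0)) codewords in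
   all are enough to simulate the i.i.d. mixture at Willie. For the latter the
   average state is compared, in the product eigenbases, with its truncation to
   the pairs of eigenvectors (a_i, b_j) with a_i <= exp(..) * b_j
   (the Nussbaum-Szkola pairs); Young's inequality bounds the trace distance,
   and a continuity bound turns it into a bound on relative entropies.

   When rho_0 and rt do not commute, D((1-s) rho_0 + s rt || rho_0) is of order
   s^2 but its constant is smaller than chi^2 / 2. Spreading the weight over all
   n positions would therefore give a rate larger than the one to be achieved.
   The fraction n'/n is chosen so that n * D(rhobar||rho_0^n) is A^2 * chi^2 / 2
   nevertheless; the fraction is at most 1 because D <= s^2 chi^2 / (2 (1 - s)),
   and bounded away from 0 because rho_0 differs from rt. *)

Require Import Defs.
From HB Require Import structures.
From mathcomp Require Import all_boot all_order all_algebra.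
From mathcomp Require Import sesquilinear spectral.
From mathcomp Require Import complex mxtens.
From mathcomp Require Import all_classical all_reals.
From mathcomp Require Import topology normedtype sequences realfun derive exp.
From mathcomp Require Import ring lra zify.

Set Implicit Arguments.
Unset Strict Implicit.
Unset Printing Implicit Defensive.

Import Order.TTheory GRing.Theory Num.Theory.
Import numFieldNormedType.Exports.
Local Open Scope ring_scope.

(** * Inequalities on logarithms *)

(** Bob and Willie share one tail bound. With the overlaps W_ij of two eigenbases, D(rho_x||rho_0)
    is the classical relative entropy of the weights a_i W_ij and b_j W_ij. For product states its
    log-likelihood ratio is a sum of independent terms that vanish at innocent positions, so all
    exponents scale with A and not with n. The sharp constant in D <= s^2 chi^2 / (2 (1 - s)) is
    obtained without differentiating a matrix logarithm: Klein's inequality bounds each increment of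
    D along the segment by the slope at its right end, and the slope by the mean of chi^2 in both
    directions. Young's inequality is used with a free parameter t, so that the trace bound is
    linear in a random defect and can be averaged over codebooks. All scales are powers of e =
    n^(-1/12): s = e^8, A of order e^(-4), margins e in the exponents, t = e^20. The tails exp(- c A
    e^2) fall below every power of e, while passing from trace distance to relative entropy costs a
    factor of order n = e^(-12). *)

Section LogInequalities.
Variable R : realType.
Implicit Types a b e s x y z : R.

Lemma ln_le_subr1 x : 0 < x -> ln x <= x - 1.
Proof. by move=> x0; have := @le_ln1Dx R (x - 1); rewrite subrKC; apply; lra. Qed.

(** This is ln(b/a) <= b/a - 1 multiplied by a. At a = 0 the right side is 0, and the support
    condition excludes b = 0 < a, where ln 0 = 0 would be misleading. *)
Lemma mul_ln_ge a b : 0 <= a -> 0 <= b -> (b = 0 -> a = 0) ->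
  a - b <= a * (ln a - ln b).
Proof.
move=> a0 b0 h; have [->|an0] := eqVneq a 0; first lra.
have ap : 0 < a by lra.
have bp : 0 < b by rewrite lt_neqAle b0 andbT eq_sym; apply: contra_neqN an0 => /eqP/h.
have := @ln_le_subr1 (b / a) (divr_gt0 bp ap); rewrite ln_div ?posrE // => hl.
have : a * (ln b - ln a) <= a * (b / a - 1) by rewrite ler_pM2l.
by have -> : a * (b / a - 1) = b - a; [field|lra].
Qed.

(** With a = p^2 and b = q^2, [mul_ln_ge] at p and q, multiplied by 2p, bounds the right side below
    by (p - q)^2; then (p + q)^2 / 4 <= 1 gives (a - b)^2 / 4. *)
Lemma mul_ln_ge_sqr a b : 0 <= a <= 1 -> 0 <= b <= 1 -> (b = 0 -> a = 0) ->
  (a - b) ^+ 2 / 4 <= a * (ln a - ln b) - (a - b).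
Proof.
move=> /andP[a0 a1] /andP[b0 b1] h; have [->|an0] := eqVneq a 0; first nra.
have ap : 0 < a by lra.
have bp : 0 < b by rewrite lt_neqAle b0 andbT eq_sym; apply: contra_neqN an0 => /eqP/h.
pose p := Num.sqrt a; pose q := Num.sqrt b.
have pp : 0 < p by rewrite sqrtr_gt0.
have qp : 0 < q by rewrite sqrtr_gt0.
have ap2 : a = p * p by rewrite -expr2 sqr_sqrtr.
have bq2 : b = q * q by rewrite -expr2 sqr_sqrtr.
have hpq : p - q <= p * (ln p - ln q) by apply: mul_ln_ge; lra.
rewrite ap2 bq2 !lnM ?posrE //.
have hp1 : p <= 1 by rewrite -sqrtr1 ler_sqrt.
have hq1 : q <= 1 by rewrite -sqrtr1 ler_sqrt.
have : p * (p - q) <= p * (p * (ln p - ln q)) by rewrite ler_pM2l.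
have h4 : (p + q) ^+ 2 / 4 <= 1 by nra.
have : (p * p - q * q) ^+ 2 / 4 <= (p - q) ^+ 2.
  have -> : (p * p - q * q) ^+ 2 / 4 = (p - q) ^+ 2 * ((p + q) ^+ 2 / 4) by field.
  by rewrite ler_piMr // sqr_ge0.
move=> h1 h2; apply: (le_trans h1); nra.
Qed.

Lemma expR_sinh y : 0 <= y -> 2 * y <= expR y - expR (- y).
Proof.
move=> y0; pose F (t : R) := expR t - expR (- t) - 2 * t.
suff : F 0 <= F y by rewrite /F oppr0 subrr mulr0 subr0; lra.
have dF (t : R) : is_derive t 1 F (expR t + expR (- t) - 2).
  by rewrite /F; apply: is_derive_eq; rewrite !scaler1 ?scaleN1r /GRing.scale /=; lra.
have [|c _] := @MVT_segment R F (fun t => expR t + expR (- t) - 2) 0 y y0 (fun x _ => dF x).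
  by apply: derivable_within_continuous => x _; apply: ex_derive.
move=> FE; rewrite -subr_ge0 FE mulr_ge0 ?subr0 //.
have h : expR c * expR (- c) = 1 by rewrite -expRD subrr expR0.
rewrite -(pmulr_rge0 _ (expR_gt0 c)) mulrBr mulrDr h.
by have -> : expR c * expR c + 1 - expR c * 2 = (expR c - 1) ^+ 2; [ring|exact: sqr_ge0].
Qed.

(** The logarithmic mean is at least the harmonic mean; with y = ln(a/b) this is 2y <= e^y - e^(-y).
    Averaging the two chi-square terms instead of adding them preserves the leading constant. *)
Lemma ln_log_mean a b : 0 < a -> 0 < b ->
  (a - b) * (ln a - ln b) <= ((a - b) ^+ 2 / b + (a - b) ^+ 2 / a) / 2.
Proof.
wlog ab : a b / b <= a => [h a0 b0|a0 b0].
  case/orP: (le_total b a) => [ba|ab]; first exact: h.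
  have := h b a ab b0 a0; rewrite [X in _ <= X / 2]addrC -sqrrN opprB.
  by congr (_ <= _); ring.
have y0 : 0 <= ln a - ln b by rewrite subr_ge0 ler_ln ?posrE.
have := expR_sinh y0; rewrite opprB !expRB !lnK ?posrE // => h.
have -> : ((a - b) ^+ 2 / b + (a - b) ^+ 2 / a) / 2 = (a - b) * ((a / b - b / a) / 2).
  by field; rewrite !gt_eqF.
by apply: ler_wpM2l; lra.
Qed.

(** Tangent at a of the convex function x ln(x + e). The shift keeps the slope bounded near 0, where
    that of x ln x diverges. *)
Lemma ln_shift_tangent a b e : 0 <= a -> 0 <= b -> 0 < e ->
  (b - a) * (ln (a + e) + a / (a + e)) <= b * ln (b + e) - a * ln (a + e).
Proof.
move=> a0 b0 e0; have ae : 0 < a + e by lra. have be : 0 < b + e by lra.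
have := @ln_le_subr1 ((a + e) / (b + e)) (divr_gt0 ae be).
rewrite ln_div ?posrE // => h.
have h1 : (b - a) / (b + e) <= ln (b + e) - ln (a + e).
  have -> : (b - a) / (b + e) = 1 - (a + e) / (b + e) by field; lra.
  lra.
have h2 := ler_wpM2l b0 h1.
have : (b - a) * (a / (a + e)) <= b * ((b - a) / (b + e)).
  rewrite -subr_ge0.
  have -> : b * ((b - a) / (b + e)) - (b - a) * (a / (a + e))
    = (b - a) ^+ 2 * e / ((b + e) * (a + e)) by field; lra.
  by apply: divr_ge0; apply: mulr_ge0; rewrite ?sqr_ge0 //; lra.
nra.
Qed.

Lemma mul_ln_shift a e : 0 <= a -> 0 < e ->
  a * ln a <= a * ln (a + e) <= a * ln a + e.
Proof.
move=> a0 e0; have [->|an0] := eqVneq a 0; first by rewrite !mul0r; lra.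
have ap : 0 < a by lra.
apply/andP; split; first by rewrite ler_pM2l // ler_ln ?posrE; lra.
have := @ln_le_subr1 ((a + e) / a); rewrite ln_div ?posrE; try lra.
move=> /(_ (divr_gt0 _ _)) h.
have {}h : ln (a + e) - ln a <= (a + e) / a - 1 by apply: h; lra.
have := ler_wpM2l a0 h; have -> : a * ((a + e) / a - 1) = e by field.
lra.
Qed.

Lemma expR_le_quad s z : `|s| <= 1 -> expR (s * z) <= 1 + s * z + s ^+ 2 * (z ^+ 2 * expR `|z|).
Proof.
move=> s1; set u := s * z.
have hu : expR u <= 1 + u + u ^+ 2 * expR `|u|.
  have h1 := expR_ge1Dx u; have h2 := expR_ge1Dx (- u).
  have h3 : expR u * expR (- u) = 1 by rewrite -expRD subrr expR0.
  have h0 := expR_gt0 u.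
  have h4 : expR u - 1 <= u * expR u by nra.
  case: (lerP 0 u) => u0; first by rewrite ger0_norm //; nra.
  have h5 : 1 <= expR `|u| by apply: le_trans (expR_ge1Dx _); rewrite lerDl.
  nra.
apply: (le_trans hu); rewrite lerD2l /u exprMn -mulrA.
rewrite ler_wpM2l ?sqr_ge0 // ler_wpM2l ?sqr_ge0 // ler_expR normrM.
by rewrite ler_piMl.
Qed.

End LogInequalities.

(** * Finite product laws *)

Section ProductLaw.
Variable R : realType.

Section Marginals.
Variables (I T : finType) (c : I -> T -> R).
Hypothesis c1 : forall i, \sum_t c i t = 1.
Implicit Types t : {ffun I -> T}.

Lemma sum_prod_ffun (F : I -> T -> R) :
  \sum_(t : {ffun I -> T}) \prod_i F i (t i) = \prod_i \sum_x F i x.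
Proof. by rewrite bigA_distr_bigA. Qed.

Lemma expect_coord i (f : T -> R) :
  \sum_(t : {ffun I -> T}) (\prod_j c j (t j)) * f (t i) = \sum_x c i x * f x.
Proof.
pose F j x := if j == i then c j x * f x else c j x.
have E t : (\prod_j c j (t j)) * f (t i) = \prod_j F j (t j).
  rewrite (bigD1 i) //= [RHS](bigD1 i) //= /F eqxx mulrAC; congr (_ * _).
  by apply: eq_bigr => j /negPf ->.
under eq_bigr do rewrite E.
rewrite sum_prod_ffun (bigD1 i) //= /F eqxx [X in _ * X]big1 ?mulr1 // => j /negPf ->.
exact: c1.
Qed.

Lemma expect_coord2 i k (f g : T -> R) : i != k ->
  \sum_(t : {ffun I -> T}) (\prod_j c j (t j)) * (f (t i) * g (t k)) =
  (\sum_x c i x * f x) * (\sum_x c k x * g x).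
Proof.
move=> ik.
pose F j x := if j == i then c j x * f x else if j == k then c j x * g x else c j x.
have ki : k != i by rewrite eq_sym.
have E t : (\prod_j c j (t j)) * (f (t i) * g (t k)) = \prod_j F j (t j).
  rewrite (bigD1 i) //= (bigD1 k) //= [RHS](bigD1 i) //= [in RHS](bigD1 k) //=.
  rewrite /F !eqxx (negPf ki); set r := \prod_(_ | _) _; set r' := (X in _ = _ * (_ * X)).
  have -> : r = r' by apply: eq_bigr => j /andP[/negPf -> /negPf ->].
  by ring.
under eq_bigr do rewrite E.
rewrite sum_prod_ffun (bigD1 i) //= [in LHS](bigD1 k) //= /F !eqxx (negPf ki).
rewrite mulrA [X in _ * X]big1 ?mulr1 // => j /andP[/negPf -> /negPf ->]; exact: c1.
Qed.

Lemma expect_one : \sum_(t : {ffun I -> T}) \prod_j c j (t j) = 1.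
Proof. by rewrite sum_prod_ffun big1. Qed.

Lemma expect_sum (h : I -> T -> R) :
  \sum_(t : {ffun I -> T}) (\prod_j c j (t j)) * (\sum_i h i (t i)) =
  \sum_i \sum_x c i x * h i x.
Proof.
under eq_bigr do rewrite mulr_sumr.
by rewrite exchange_big; apply: eq_bigr => i _; exact: expect_coord.
Qed.

End Marginals.

(** * Sample means of independent draws *)

Section EmpiricalMean.
Variables (J T : finType) (w : T -> R).
Hypotheses (w0 : forall x, 0 <= w x) (w1 : \sum_x w x = 1) (J0 : (0 < #|J|)%N).

(** Independence removes the cross terms and leaves the variance over [#|J|]; the variance is at
    most the second moment. *)
Lemma empirical_mean_variance (f : T -> R) :
  \sum_(c : {ffun J -> T}) (\prod_j w (c j)) *
     (#|J|%:R^-1 * (\sum_j f (c j)) - \sum_x w x * f x) ^+ 2 <=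
  #|J|%:R^-1 * \sum_x w x * f x ^+ 2.
Proof.
set m := \sum_x w x * f x; pose g x := f x - m.
have gm : \sum_x w x * g x = 0.
  under eq_bigr do rewrite /g mulrBr.
  by rewrite sumrB -mulr_suml w1 mul1r subrr.
have L0 : #|J|%:R != 0 :> R by rewrite pnatr_eq0 -lt0n.
have E (c : {ffun J -> T}) : #|J|%:R^-1 * (\sum_j f (c j)) - m = #|J|%:R^-1 * \sum_j g (c j).
  rewrite sumrB sumr_const -[m *+ _]mulr_natl mulrBr mulrA mulVf ?mul1r //.
have -> : \sum_(c : {ffun J -> T}) (\prod_j w (c j)) *
     (#|J|%:R^-1 * (\sum_j f (c j)) - m) ^+ 2 =
   #|J|%:R^-1 ^+ 2 * \sum_j \sum_(c : {ffun J -> T}) (\prod_j w (c j)) * (g (c j) * \sum_k g (c k)).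
  rewrite exchange_big mulr_sumr; apply: eq_bigr => c _ /=.
  by rewrite E -mulr_sumr -mulr_suml; ring.
have e2 j : \sum_(c : {ffun J -> T}) (\prod_j w (c j)) * (g (c j) * \sum_k g (c k)) =
    \sum_x w x * g x ^+ 2.
  under eq_bigr do rewrite mulr_sumr mulr_sumr.
  rewrite exchange_big /= (bigD1 j) //= [X in _ + X]big1 ?addr0 => [|k kj]; last first.
    by rewrite (@expect_coord2 _ _ (fun=> w)) ?gm ?mul0r // eq_sym.
  rewrite -(@expect_coord _ _ (fun=> w) _ j (fun x => g x ^+ 2)) //.
under eq_bigr do rewrite e2.
rewrite sumr_const -[(\sum_x w x * g x ^+ 2) *+ _]mulr_natl.
rewrite mulrA expr2 -(mulrA _^-1) mulVf // mulr1 ler_wpM2l ?invr_ge0 //.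
have -> : \sum_x w x * g x ^+ 2 = \sum_x w x * f x ^+ 2 - m ^+ 2.
  transitivity (\sum_x (w x * f x ^+ 2 - 2 * m * (w x * f x) + w x * m ^+ 2)).
    by apply: eq_bigr => x _; rewrite /g; ring.
  by rewrite big_split sumrB /= -mulr_sumr -mulr_suml w1 -/m; ring.
by rewrite gerBl sqr_ge0.
Qed.

Lemma expect_exists (F : {ffun J -> T} -> R) (B : R) :
  \sum_(c : {ffun J -> T}) (\prod_j w (c j)) * F c <= B -> exists c, F c <= B.
Proof.
move=> h; apply: contrapT => nex.
have {nex} FB c : B < F c by rewrite ltNge; apply/negP => ?; apply: nex; exists c.
have W0 (c : {ffun J -> T}) : 0 <= \prod_j w (c j) by rewrite prodr_ge0.
have W1 : \sum_(c : {ffun J -> T}) \prod_j w (c j) = 1 by rewrite (@expect_one J T (fun=> w)).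
have : \sum_(c : {ffun J -> T}) (\prod_j w (c j)) * (F c - B) <= 0.
  under eq_bigr do rewrite mulrBr.
  by rewrite sumrB -mulr_suml W1 mul1r subr_le0.
rewrite le_eqVlt => /orP[|]; last first.
  rewrite ltNge sumr_ge0 // => c _; rewrite mulr_ge0 ?subr_ge0 //; exact: ltW.
rewrite psumr_eq0 => [/allP z|c _]; last by rewrite mulr_ge0 ?subr_ge0 // ltW.
have : \sum_(c : {ffun J -> T}) \prod_j w (c j) = 0.
  rewrite big1 // => c _; have := z c; rewrite mem_index_enum => /(_ isT).
  by rewrite mulf_eq0 [F c - B == 0]gt_eqF ?subr_gt0 // orbF => /eqP.
by rewrite W1 => /eqP; rewrite oner_eq0.
Qed.

End EmpiricalMean.

(** * Chernoff bound for sparse mixtures *)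

Section Chernoff.
Variables (I T : finType) (al : I -> R) (c0 c1 z : T -> R).
Hypotheses (c00 : forall t, 0 <= c0 t) (c10 : forall t, 0 <= c1 t).
Hypotheses (c01 : \sum_t c0 t = 1) (c11 : \sum_t c1 t = 1).
Hypothesis al01 : forall i, 0 <= al i <= 1.
Hypothesis z0 : forall t, c0 t != 0 -> z t = 0.
Local Notation c i t := ((1 - al i) * c0 t + al i * c1 t).
Local Notation mean := (\sum_t c1 t * z t).
Local Notation A := (\sum_i al i).

Definition tail_const := \sum_t c1 t * (z t ^+ 2 * expR `|z t|).

Lemma tail_const_ge0 : 0 <= tail_const.
Proof. by rewrite sumr_ge0 // => t _; rewrite mulr_ge0 // mulr_ge0 ?sqr_ge0 ?expR_ge0. Qed.

Lemma expect_expR_le s i : 0 <= s <= 1 ->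
  \sum_t c i t * expR (s * z t) <= expR (al i * (s * mean + s ^+ 2 * tail_const)).
Proof.
move=> /andP[s0 s1]; have /andP[a0 a1] := al01 i.
apply: le_trans (expR_ge1Dx _).
under eq_bigr do rewrite mulrDl -!mulrA.
rewrite big_split -!mulr_sumr /=.
have -> : \sum_t c0 t * expR (s * z t) = 1.
  rewrite -c01; apply: eq_bigr => t _; have [->|/z0 ->] := eqVneq (c0 t) 0; first by rewrite mul0r.
  by rewrite mulr0 expR0 mulr1.
have : \sum_t c1 t * expR (s * z t) <= 1 + (s * mean + s ^+ 2 * tail_const).
  rewrite /tail_const !mulr_sumr -big_split -{1}c11 -big_split; apply: ler_sum => t _ /=.
  have h : expR (s * z t) <= _ := @expR_le_quad _ s (z t) _.
  apply: (le_trans (ler_wpM2l (c10 t) (h _))); first by rewrite ger0_norm.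
  by rewrite le_eqVlt; apply/orP; left; apply/eqP; ring.
move=> h; have := ler_wpM2l a0 h; lra.
Qed.

(** Exponential Markov inequality. Since z vanishes on the support of c0, that component contributes
    nothing to the exponent, which therefore grows with A rather than with the number of
    coordinates. *)
Lemma chernoff_tail d : 0 <= d <= 1 ->
  \sum_(t : {ffun I -> T}) (\prod_i c i (t i)) * (A * (mean + d) <= \sum_i z (t i))%R%:R <=
  expR (- (A * d ^+ 2 / (4 * (tail_const + 1)))).
Proof.
move=> /andP[d0 d1]; set g := A * (mean + d).
have K0 := tail_const_ge0; set K := tail_const in K0 *.
(* Nearly the minimiser of - s d + s^2 K; K + 1 replaces K to keep the denominator positive and s <=
   1. *)
pose s := d / (2 * (K + 1)).
have s0 : 0 <= s by rewrite divr_ge0 //; lra.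
have s1 : s <= 1 by rewrite ler_pdivrMr; lra.
have A0 : 0 <= A by rewrite sumr_ge0 // => i _; case/andP: (al01 i).
have c_ge0 i t : 0 <= c i t.
  have /andP[a0 a1] := al01 i; rewrite addr_ge0 ?mulr_ge0 //; lra.
have -> : expR (- (A * d ^+ 2 / (4 * (K + 1)))) =
   expR (- (s * g)) * expR (A * (s * mean + d ^+ 2 / (4 * (K + 1)))).
  rewrite -expRD /g /s; congr expR; field; lra.
apply: (@le_trans _ _ (expR (- (s * g)) * \prod_i \sum_t c i t * expR (s * z t))).
  rewrite -sum_prod_ffun mulr_sumr; apply: ler_sum => t _.
  rewrite big_split /= mulrCA; apply: ler_wpM2l; first by rewrite prodr_ge0.
  rewrite -expR_sum -expRD -mulr_sumr; case: (lerP g (\sum_i z (t i))) => h /=; last exact: expR_ge0.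
  by rewrite -(@expR0 R) ler_expR; have := ler_wpM2l s0 h; lra.
rewrite ler_wpM2l ?expR_ge0 //.
apply: (@le_trans _ _ (\prod_i expR (al i * (s * mean + s ^+ 2 * K)))).
  apply: ler_prod => i _; rewrite expect_expR_le ?s0 // andbT sumr_ge0 // => t _.
  by rewrite mulr_ge0 ?expR_ge0.
rewrite -expR_sum -mulr_suml ler_expR ler_wpM2l // lerD2l.
have -> : s ^+ 2 * K = d ^+ 2 / (4 * (K + 1)) * (K / (K + 1)) by rewrite /s; field; lra.
rewrite ler_piMr //; first by rewrite divr_ge0 ?sqr_ge0 //; lra.
by rewrite ler_pdivrMr; lra.
Qed.

End Chernoff.
End ProductLaw.

Local Open Scope sesquilinear_scope.

(** * Functional calculus of Hermitian matrices *)

Section MatrixIdentities.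
Variables (K : comNzRingType) (n : nat).
Implicit Types V U Vs Us D E A B S : 'M[K]_n.

Lemma conjmx_mul V Vs D E : V *m Vs = 1%:M ->
  (Vs *m D *m V) *m (Vs *m E *m V) = Vs *m (D *m E) *m V.
Proof. by move=> h; rewrite !mulmxA -(mulmxA _ V Vs) h mulmx1. Qed.

Lemma conjmxB V Vs D E : Vs *m D *m V - Vs *m E *m V = Vs *m (D - E) *m V.
Proof. by rewrite mulmxBr mulmxBl. Qed.

Lemma mxtrace_conj V Vs D : V *m Vs = 1%:M -> \tr (Vs *m D *m V) = \tr D.
Proof. by move=> h; rewrite mxtrace_mulC mulmxA h mul1mx. Qed.

Lemma mxtrace_conj2 V Vs U Us D E :
  \tr ((Vs *m D *m V) *m (Us *m E *m U)) = \tr (D *m (V *m Us) *m E *m (U *m Vs)).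
Proof. by rewrite -!mulmxA mxtrace_mulC !mulmxA. Qed.

Lemma conjmx_eq V Vs U Us D E :
  V *m Vs = 1%:M -> Vs *m V = 1%:M -> U *m Us = 1%:M -> Us *m U = 1%:M ->
  Vs *m D *m V = Us *m E *m U <-> D *m (V *m Us) = (V *m Us) *m E.
Proof.
move=> hV hV' hU hU'; split=> h.
  have := congr1 (fun A => V *m A *m Us) h.
  by rewrite !mulmxA hV mul1mx -!mulmxA hU mulmx1.
have := congr1 (fun A => Vs *m A *m U) h.
by rewrite !mulmxA hV' mul1mx -!mulmxA hU' mulmx1.
Qed.

Lemma mxtrace_sqB A B S : \tr ((A - B) *m (A - B) *m S) =
  \tr (A *m A *m S) - \tr (A *m (B *m S)) - \tr (A *m (S *m B)) + \tr (B *m (B *m S)).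
Proof.
have -> : (A - B) *m (A - B) *m S = A *m A *m S - A *m (B *m S) - B *m (A *m S) + B *m (B *m S).
  by rewrite !mulmxBl !mulmxBr !mulmxBl -!mulmxA opprB addrA addrAC.
rewrite raddfD !raddfB /=; congr (_ - _ + _).
by rewrite mxtrace_mulC mulmxA.
Qed.

End MatrixIdentities.

Section Adjoint.
Variable C : numClosedFieldType.

Definition adj m n (A : 'M[C]_(m, n)) : 'M[C]_(n, m) := A^t*.

Lemma adjE m n (A : 'M[C]_(m, n)) i j : adj A i j = Num.conj (A j i).
Proof. by rewrite !mxE. Qed.

Lemma adjM m n p (A : 'M[C]_(m, n)) (B : 'M[C]_(n, p)) : adj (A *m B) = adj B *m adj A.
Proof. by rewrite /adj trmx_mul map_mxM. Qed.

Lemma adjK m n (A : 'M[C]_(m, n)) : adj (adj A) = A.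
Proof. exact: trmxCK. Qed.

Lemma adj_diag n (a : 'I_n -> C) : (forall i, Num.conj (a i) = a i) ->
  adj (diag_mx (\row_i a i)) = diag_mx (\row_i a i).
Proof.
move=> h; apply/matrixP => i j; rewrite adjE !mxE eq_sym.
by case: eqP => [->|_]; rewrite ?mulr1n ?mulr0n ?conjC0 ?h.
Qed.

Lemma unitary_adj n (V : 'M[C]_n) : V \is unitarymx -> V *m adj V = 1%:M.
Proof. by move/unitarymxP. Qed.
Lemma adj_unitary n (V : 'M[C]_n) : V \is unitarymx -> adj V *m V = 1%:M.
Proof. by move/unitarymxP/mulmx1C. Qed.
Lemma unitary_mul_adj n (V U : 'M[C]_n) :
  V \is unitarymx -> U \is unitarymx -> V *m adj U \is unitarymx.
Proof. by move=> uV uU; rewrite mul_unitarymx ?trmxC_unitary. Qed.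

Lemma hermsymmxP n (A : 'M[C]_n) : reflect (adj A = A) (A \is hermsymmx).
Proof. by apply: (iffP (is_hermitianmxP _ _ _)); rewrite expr0 scale1r => /esym. Qed.

Lemma herm_diagonalizable n (A : 'M[C]_n) : A \is hermsymmx ->
  A = adj (spectralmx A) *m diag_mx (spectral_diag A) *m spectralmx A.
Proof.
move=> hA; rewrite /adj -invmx_unitary ?spectral_unitarymx //.
by have /orthomx_spectralP := hermitian_normalmx hA.
Qed.

Lemma diag_form n (V A : 'M[C]_n) (v : 'rV[C]_n) :
  (v *m (adj V *m A *m V) *m adj v) = (v *m adj V) *m A *m adj (v *m adj V).
Proof. by rewrite adjM adjK !mulmxA. Qed.

End Adjoint.

(* R[i] seen as an abstract numClosedFieldType over R: on the concrete type,
   unification keeps comparing two unfoldings of its ring structure. *)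
Record complexModel (R : realType) := ComplexModel {
  csort :> numClosedFieldType;
  emb : {rmorphism R -> csort};
  re : csort -> R;
  im : csort -> R;
  reD : forall z w, re (z + w) = re z + re w;
  imD : forall z w, im (z + w) = im z + im w;
  reM : forall z w, re (z * w) = re z * re w - im z * im w;
  imM : forall z w, im (z * w) = re z * im w + im z * re w;
  re_emb : forall a, re (emb a) = a;
  im_emb : forall a, im (emb a) = 0;
  conj_emb : forall a, Num.conj (emb a) = emb a;
  mul_conj : forall z, z * Num.conj z = emb (re z ^+ 2 + im z ^+ 2);
  emb_re : forall z, z \is Num.real -> emb (re z) = z;
  emb_ge0 : forall a, (0 <= emb a) = (0 <= a) }.

(** * Spectral decompositions and overlaps of eigenbases *)

Section Spectral.
Variables (R : realType) (C : complexModel R).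
Implicit Types (f g : R -> R) (z w : C).
Local Notation emb := (@emb R C).
Local Notation re := (@re R C).
Local Notation im := (@im R C).

Definition normsq z : R := re z ^+ 2 + im z ^+ 2.

Lemma normsq_ge0 z : 0 <= normsq z.
Proof. by rewrite addr_ge0 ?sqr_ge0. Qed.

Lemma emb_inj : injective emb.
Proof. by move=> x y /(congr1 re); rewrite !re_emb. Qed.

Lemma normsqJ z : normsq (Num.conj z) = normsq z.
Proof. by apply: emb_inj; rewrite -!mul_conj conjCK mulrC. Qed.

Lemma normsqM z w : normsq (z * w) = normsq z * normsq w.
Proof. by rewrite /normsq reM imM; ring. Qed.

Lemma normsq_emb a : normsq (emb a) = a ^+ 2.
Proof. by rewrite /normsq re_emb im_emb expr0n addr0. Qed.

Lemma normsq0 : normsq 0 = 0.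
Proof. by rewrite -(rmorph0 emb) normsq_emb expr0n. Qed.

Lemma re0 : re 0 = 0. Proof. by rewrite -(rmorph0 emb) re_emb. Qed.
Lemma im0 : im 0 = 0. Proof. by rewrite -(rmorph0 emb) im_emb. Qed.
Lemma reN z : re (- z) = - re z.
Proof. by apply/eqP; rewrite -addr_eq0 -reD addNr re0. Qed.
Lemma imN z : im (- z) = - im z.
Proof. by apply/eqP; rewrite -addr_eq0 -imD addNr im0. Qed.
Lemma reB z w : re (z - w) = re z - re w.
Proof. by rewrite reD reN. Qed.
Lemma imB z w : im (z - w) = im z - im w.
Proof. by rewrite imD imN. Qed.
Lemma re_sum (I : Type) (r : seq I) (P : pred I) (F : I -> C) :
  re (\sum_(i <- r | P i) F i) = \sum_(i <- r | P i) re (F i).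
Proof. exact: (big_morph _ (@reD R C) re0). Qed.
Lemma im_sum (I : Type) (r : seq I) (P : pred I) (F : I -> C) :
  im (\sum_(i <- r | P i) F i) = \sum_(i <- r | P i) im (F i).
Proof. exact: (big_morph _ (@imD R C) im0). Qed.
Lemma reZ a z : re (emb a * z) = a * re z.
Proof. by rewrite reM re_emb im_emb mul0r subr0. Qed.
Lemma imZ a z : im (emb a * z) = a * im z.
Proof. by rewrite imM re_emb im_emb mul0r addr0. Qed.
Lemma normsq_eq0 z : (normsq z == 0) = (z == 0).
Proof.
apply/eqP/eqP => [h|->]; last exact: normsq0.
have : z * Num.conj z = 0 by rewrite mul_conj -/(normsq z) h rmorph0.
by move/eqP; rewrite mulf_eq0 conjC_eq0 orbb => /eqP.
Qed.

Section Dim.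
Variable n : nat.
Implicit Types (U V A B : 'M[C]_n) (a b : 'I_n -> R).

Definition rdiag a : 'M[C]_n := diag_mx (\row_i emb (a i)).
Definition fmx V a : 'M[C]_n := adj V *m rdiag a *m V.

(* |<v_i, u_j>|^2, for the rows v_i of V and u_j of U *)
Definition overlap V U i j : R := normsq ((V *m adj U) i j).

Lemma overlap_ge0 V U i j : 0 <= overlap V U i j.
Proof. exact: normsq_ge0. Qed.

Lemma rdiagM a b : rdiag a *m rdiag b = rdiag (fun i => a i * b i).
Proof. by rewrite /rdiag mulmx_diag; congr diag_mx; apply/rowP => i; rewrite !mxE rmorphM. Qed.

Lemma rdiagB a b : rdiag a - rdiag b = rdiag (fun i => a i - b i).
Proof.
apply/matrixP => i j; rewrite !mxE.
by case: eqP => _; rewrite ?mulr1n ?mulr0n ?subr0 // rmorphB.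
Qed.

Lemma eq_rdiag a b : a =1 b -> rdiag a = rdiag b.
Proof. by move=> e; congr diag_mx; apply/rowP => i; rewrite !mxE e. Qed.

Lemma adj_rdiag a : adj (rdiag a) = rdiag a.
Proof. by apply: adj_diag => i; rewrite conj_emb. Qed.

Lemma fmx_herm V a : adj (fmx V a) = fmx V a.
Proof. by rewrite /fmx !adjM adjK adj_rdiag mulmxA. Qed.

Lemma fmx_hermsymmx V a : fmx V a \is hermsymmx.
Proof. exact/hermsymmxP/fmx_herm. Qed.

Lemma eq_fmx V a b : a =1 b -> fmx V a = fmx V b.
Proof. by move=> e; rewrite /fmx (eq_rdiag e). Qed.

Lemma fmxM V a b : V \is unitarymx -> fmx V a *m fmx V b = fmx V (fun i => a i * b i).
Proof. by move=> uV; rewrite /fmx conjmx_mul ?unitary_adj // rdiagM. Qed.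

Lemma fmxB V a b : fmx V a - fmx V b = fmx V (fun i => a i - b i).
Proof. by rewrite /fmx conjmxB rdiagB. Qed.

Lemma fmxE V a i j : fmx V a i j = \sum_k emb (a k) * Num.conj (V k i) * V k j.
Proof.
rewrite /fmx mul_mx_diag mxE; apply: eq_bigr => k _.
by rewrite mxE adjE mxE [_ * emb (a k)]mulrC.
Qed.

Lemma mxtrace_diag_conj (X : 'M[C]_n) a b :
  \tr (rdiag a *m X *m rdiag b *m adj X) = emb (\sum_i \sum_j a i * b j * normsq (X i j)).
Proof.
rewrite mul_diag_mx mul_mx_diag /mxtrace rmorph_sum /=; apply: eq_bigr => i _.
rewrite mxE rmorph_sum /=; apply: eq_bigr => j _.
by rewrite adjE !mxE !rmorphM /= -mul_conj; ring.
Qed.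

Lemma tr_fmx2 V U a b :
  \tr (fmx V a *m fmx U b) = emb (\sum_i \sum_j a i * b j * overlap V U i j).
Proof.
rewrite /fmx mxtrace_conj2.
have -> : U *m adj V = adj (V *m adj U) by rewrite adjM adjK.
exact: mxtrace_diag_conj.
Qed.

Lemma unitary_row_normsq V i : V \is unitarymx -> \sum_j normsq (V i j) = 1.
Proof.
move=> uV; apply: emb_inj; rewrite rmorph_sum /=.
have /matrixP/(_ i i) := unitary_adj uV; rewrite mxE [RHS]mxE eqxx rmorph1 => h.
by rewrite -[RHS]h; apply: eq_bigr => j _; rewrite adjE mul_conj.
Qed.

Lemma overlap_sum_row V U i : V \is unitarymx -> U \is unitarymx ->
  \sum_j overlap V U i j = 1.
Proof. by move=> uV uU; rewrite unitary_row_normsq // unitary_mul_adj. Qed.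

Lemma overlapC V U i j : overlap V U i j = overlap U V j i.
Proof.
rewrite /overlap -normsqJ; congr normsq.
have -> : U *m adj V = adj (V *m adj U) by rewrite adjM adjK.
by rewrite adjE.
Qed.

Lemma overlap_sum_col V U j : V \is unitarymx -> U \is unitarymx ->
  \sum_i overlap V U i j = 1.
Proof.
by move=> uV uU; rewrite -[RHS](overlap_sum_row j uU uV); apply: eq_bigr => i _; rewrite overlapC.
Qed.

Lemma overlap_id V i j : V \is unitarymx -> overlap V V i j = (i == j)%:R.
Proof.
move=> uV; rewrite /overlap unitary_adj // mxE -(rmorph_nat emb) normsq_emb.
by rewrite -natrX; case: eqP.
Qed.

Lemma tr_rdiag a : \tr (rdiag a) = emb (\sum_i a i).
Proof. by rewrite mxtrace_diag rmorph_sum /=; apply: eq_bigr => i _; rewrite mxE. Qed.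

Lemma tr_fmx V a : V \is unitarymx -> \tr (fmx V a) = emb (\sum_i a i).
Proof. by move=> uV; rewrite /fmx mxtrace_conj ?unitary_adj // tr_rdiag. Qed.

Lemma rdiag_comm (X : 'M[C]_n) a b : rdiag a *m X = X *m rdiag b <->
  forall i j, X i j != 0 -> a i = b j.
Proof.
split=> [/matrixP h i j X0|h].
  have := h i j; rewrite mul_diag_mx mul_mx_diag !mxE mulrC.
  by move/(mulfI X0)/emb_inj.
apply/matrixP => i j; rewrite mul_diag_mx mul_mx_diag !mxE mulrC.
by have [->|/h ->//] := eqVneq (X i j) 0; rewrite !mul0r.
Qed.

(** Equality means that [V *m adj U] intertwines the two diagonal matrices; entrywise, eigenvalues
    agree wherever eigenvectors overlap. *)
Lemma fmx_eqP V U a b : V \is unitarymx -> U \is unitarymx ->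
  fmx V a = fmx U b <-> forall i j, (V *m adj U) i j != 0 -> a i = b j.
Proof.
move=> uV uU; rewrite -rdiag_comm.
by apply: conjmx_eq; rewrite ?unitary_adj ?adj_unitary.
Qed.

(** The matching of eigenvalues survives f, so the functional calculus does not depend on the
    diagonalisation, in particular not on the choice made by [spectralmx]. *)
Lemma fmx_functional V U a b f : V \is unitarymx -> U \is unitarymx ->
  fmx V a = fmx U b -> fmx V (f \o a) = fmx U (f \o b).
Proof. by move=> uV uU /(fmx_eqP a b uV uU) h; apply/fmx_eqP => // i j /h /= ->. Qed.

Definition eigval A i : R := re (spectral_diag A 0 i).

Lemma herm_fmx A : A \is hermsymmx -> A = fmx (spectralmx A) (eigval A).
Proof.
move=> hA; rewrite {1}(herm_diagonalizable hA) /fmx; congr (_ *m _ *m _).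
congr diag_mx; apply/rowP => i; rewrite mxE.
by rewrite emb_re //; have /mxOverP := hermitian_spectral_diag_real hA; apply.
Qed.

(** This and the next three definitions repeat [mxfun], [qrelent], [chi2] and [is_state] over the
    model, so that on the concrete complex numbers they agree by conversion. *)
Definition cmxfun f A : 'M[C]_n := invmx (spectralmx A) *m
  diag_mx (map_mx (fun z => emb (f (re z))) (spectral_diag A)) *m spectralmx A.

Definition cqrelent A B : R := re (\tr (A *m (cmxfun (@ln R) A - cmxfun (@ln R) B))).

Definition cchi2 A B : R :=
  re (\tr ((A - B) *m (A - B) *m cmxfun (fun t => t^-1) B)).

Definition cstate A : Prop :=
  [/\ A \is hermsymmx,
      forall v : 'rV[C]_n, 0 <= (v *m A *m (map_mx Num.conj v)^T) 0 0
    & \tr A = 1].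

Lemma mxfun_def A f : cmxfun f A = fmx (spectralmx A) (f \o eigval A).
Proof.
rewrite /cmxfun invmx_unitary ?spectral_unitarymx // /fmx; congr (_ *m _ *m _).
by congr diag_mx; apply/rowP => i; rewrite !mxE.
Qed.

Lemma mxfun_fmx V a f : V \is unitarymx -> cmxfun f (fmx V a) = fmx V (f \o a).
Proof.
move=> uV; rewrite mxfun_def; apply/esym/fmx_functional; rewrite ?spectral_unitarymx //.
exact/herm_fmx/fmx_hermsymmx.
Qed.

(** Since the overlaps W_ij have row sums 1, both traces become sums over pairs. The result is the
    classical relative entropy of a_i W_ij and b_j W_ij, with W_ij cancelled inside the
    logarithms. *)
Lemma qrelent_fmx V U a b : V \is unitarymx -> U \is unitarymx ->
  cqrelent (fmx V a) (fmx U b) = \sum_i \sum_j a i * (ln (a i) - ln (b j)) * overlap V U i j.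
Proof.
move=> uV uU; rewrite /cqrelent !mxfun_fmx // mulmxBr raddfB /= reB.
rewrite fmxM // tr_fmx // tr_fmx2 !re_emb -sumrB; apply: eq_bigr => i _.
rewrite -[X in X - _]mulr1 -(overlap_sum_row i uV uU) mulr_sumr -sumrB.
by apply: eq_bigr => j _; rewrite /=; ring.
Qed.

(** Likewise the classical chi-square divergence of a_i W_ij and b_j W_ij; column sums absorb the
    term in B alone. *)
Lemma chi2_fmx V U a b : V \is unitarymx -> U \is unitarymx ->
  cchi2 (fmx V a) (fmx U b) = \sum_i \sum_j (a i - b j) ^+ 2 / b j * overlap V U i j.
Proof.
move=> uV uU; rewrite /cchi2 mxfun_fmx // mxtrace_sqB.
rewrite !fmxM // !tr_fmx2 // tr_fmx // reD !reB !re_emb -!sumrB.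
have -> : \sum_i b i * (b i / b i) = \sum_i \sum_j b j * (b j / b j) * overlap V U i j.
  rewrite exchange_big; apply: eq_bigr => j _ /=.
  by rewrite -mulr_sumr overlap_sum_col // mulr1.
rewrite -big_split /=; apply: eq_bigr => i _; rewrite -!sumrB -big_split /=.
by apply: eq_bigr => j _ /=; ring.
Qed.

Lemma rdiag_form (w : 'rV[C]_n) a :
  (w *m rdiag a *m adj w) 0 0 = emb (\sum_i a i * normsq (w 0 i)).
Proof.
rewrite mul_mx_diag mxE rmorph_sum /=; apply: eq_bigr => k _; rewrite adjE !mxE.
by rewrite mulrAC mul_conj -rmorphM mulrC.
Qed.

Lemma fmx_form (v : 'rV[C]_n) V a :
  (v *m fmx V a *m adj v) 0 0 = emb (\sum_i a i * normsq ((v *m adj V) 0 i)).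
Proof. by rewrite diag_form rdiag_form. Qed.

Lemma cstateP A : cstate A <->
  exists V a, [/\ V \is unitarymx, A = fmx V a, (forall i, 0 <= a i) & \sum_i a i = 1].
Proof.
split=> [[hA pA tA]|[V [a [uV -> a0 a1]]]].
  have uV := spectral_unitarymx A; have AE := herm_fmx hA.
  exists (spectralmx A), (eigval A); split=> //.
    (* Positivity tested on the i-th eigenvector isolates the i-th eigenvalue. *)
    move=> i; have := pA (row i (spectralmx A)).
    rewrite map_trmx -/(adj _) [X in _ *m X *m _]AE fmx_form emb_ge0 -row_mul unitary_adj //.
    rewrite (bigD1 i) //= big1 ?addr0 => [|j ji]; last first.
      by rewrite !mxE eq_sym (negPf ji) normsq0 mulr0.
    by rewrite !mxE eqxx -(rmorph1 emb) normsq_emb expr1n mulr1.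
  by apply: emb_inj; rewrite -(tr_fmx _ uV) -AE tA rmorph1.
split; first exact: fmx_hermsymmx.
  move=> v; rewrite map_trmx -/(adj _) fmx_form emb_ge0 sumr_ge0 // => k _.
  by rewrite mulr_ge0 ?normsq_ge0.
by rewrite tr_fmx // a1 rmorph1.
Qed.

End Dim.
End Spectral.

Lemma mulmx_young (K : comNzRingType) n (t : K) (E P Q B : 'M[K]_n) :
  E *m Q *m B = E -> B *m (Q *m E) = E ->
  (t *: (E *m Q) - E *m P) *m B *m (t *: (Q *m E) - P *m E) =
  (t * t) *: (E *m Q *m E) - t *: (E *m P *m E) - t *: (E *m P *m E)
  + E *m P *m B *m (P *m E).
Proof.
move=> h1 h2; rewrite mulmxBl -scalemxAl h1 mulmxBr !mulmxBl -!scalemxAr -!scalemxAl.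
rewrite -(mulmxA (E *m P) B (Q *m E)) h2 scalerA !mulmxA.
by rewrite opprB addrA addrAC.
Qed.

(** * Relative entropy of mixtures *)

Section States.
Variables (R : realType) (C : complexModel R) (n : nat).
Implicit Types (A B D Y V U : 'M[C]_n) (a b : 'I_n -> R).
Local Notation emb := (@emb R C).
Local Notation re := (@re R C).

Lemma rdiag_diag_form (X : 'M[C]_n) b i :
  (X *m rdiag C b *m adj X) i i = emb (\sum_j b j * normsq (X i j)).
Proof.
rewrite mul_mx_diag mxE rmorph_sum; apply: eq_bigr => k _; rewrite adjE !mxE /=.
by rewrite mulrAC mul_conj -rmorphM mulrC.
Qed.

Definition dform V A i : R := re ((V *m A *m adj V) i i).

Lemma dform_fmx V U b i : dform V (fmx U b) i = \sum_j b j * overlap V U i j.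
Proof.
rewrite /dform.
have -> : V *m fmx U b *m adj V = (V *m adj U) *m rdiag C b *m adj (V *m adj U).
  by rewrite adjM adjK /fmx !mulmxA.
by rewrite rdiag_diag_form re_emb.
Qed.

Lemma dformD V A B i : dform V (A + B) i = dform V A i + dform V B i.
Proof. by rewrite /dform mulmxDr mulmxDl mxE reD. Qed.

Lemma dformZ V A (s : R) i : dform V (emb s *: A) i = s * dform V A i.
Proof. by rewrite /dform -scalemxAr -scalemxAl mxE reZ. Qed.

Lemma dform_diag V a i : V \is unitarymx -> dform V (fmx V a) i = a i.
Proof.
move=> uV; rewrite dform_fmx (bigD1 i) //= overlap_id // eqxx mulr1 big1 ?addr0 // => j ji.
by rewrite overlap_id // eq_sym (negPf ji) mulr0.
Qed.

Lemma dform_state_ge0 V A i : cstate A -> 0 <= dform V A i.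
Proof.
move=> /cstateP[U [b [uU -> b0 _]]]; rewrite dform_fmx sumr_ge0 // => j _.
by rewrite mulr_ge0 ?overlap_ge0.
Qed.

Lemma tr_congr_ge0 Y A : cstate A -> 0 <= re (\tr (Y *m A *m adj Y)).
Proof.
by move=> sA; rewrite /mxtrace re_sum sumr_ge0 // => i _; apply: dform_state_ge0.
Qed.

(** If b_j = 0, row j of U times the dominated matrix vanishes, and its entries are a_i times those
    of [U *m adj V]. This is the form of the support condition that makes ln 0 = 0 harmless. *)
Lemma dominated_overlap V U a b D i j : V \is unitarymx -> U \is unitarymx ->
  fmx V a = fmx U b *m D -> b j = 0 -> a i * overlap V U i j = 0.
Proof.
move=> uV uU e bj; rewrite overlapC /overlap.
have : (U *m fmx V a *m adj V) j i = 0.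
  rewrite e /fmx !mulmxA unitary_adj // mul1mx -2!mulmxA mul_diag_mx !mxE.
  by rewrite bj rmorph0 mul0r.
have -> : U *m fmx V a *m adj V = (U *m adj V) *m rdiag C a.
  by rewrite /fmx !mulmxA -mulmxA unitary_adj // mulmx1.
rewrite mul_mx_diag !mxE => /eqP; rewrite mulf_eq0 => /orP[/eqP->|/eqP h].
  by rewrite normsq0 mulr0.
by rewrite (emb_inj (etrans h (esym (rmorph0 _)))) mul0r.
Qed.

Definition ent a : R := \sum_i a i * ln (a i).

Lemma qrelent_ent V U a b : V \is unitarymx -> U \is unitarymx ->
  cqrelent (fmx V a) (fmx U b) = ent a - re (\tr (fmx V a *m cmxfun (@ln R) (fmx U b))).
Proof.
move=> uV uU; rewrite /cqrelent mulmxBr raddfB /= reB !mxfun_fmx // fmxM // tr_fmx //.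
by rewrite re_emb.
Qed.

(** Klein's inequality: [mul_ln_ge] summed over pairs of eigenvectors, the linear terms reducing to
    traces by the row and column sums of the overlaps. *)
Lemma klein V U a b : V \is unitarymx -> U \is unitarymx ->
  (forall i, 0 <= a i) -> (forall j, 0 <= b j) ->
  (forall i j, b j = 0 -> a i * overlap V U i j = 0) ->
  \sum_i a i - \sum_j b j <= cqrelent (fmx V a) (fmx U b).
Proof.
move=> uV uU a0 b0 h; rewrite qrelent_fmx //.
have -> : \sum_i a i - \sum_j b j = \sum_i \sum_j (a i - b j) * overlap V U i j.
  under [RHS]eq_bigr do under eq_bigr do rewrite mulrBl.
  under [RHS]eq_bigr do rewrite sumrB -mulr_sumr overlap_sum_row // mulr1.
  rewrite sumrB exchange_big /=; congr (_ - _); apply: eq_bigr => j _.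
  by rewrite -mulr_sumr overlap_sum_col // mulr1.
apply: ler_sum => i _; apply: ler_sum => j _.
have [->|W0] := eqVneq (overlap V U i j) 0; first by rewrite !mulr0.
apply: ler_wpM2r; first exact: overlap_ge0.
by apply: mul_ln_ge => // /(h i) /eqP; rewrite mulf_eq0 (negPf W0) orbF => /eqP.
Qed.

Lemma cstate_le1 a : (forall i, 0 <= a i) -> \sum_i a i = 1 -> forall i, a i <= 1.
Proof.
move=> a0 a1 i; rewrite -a1 (bigD1 i) //= lerDl sumr_ge0 // => j _; exact: a0.
Qed.

(** A Pinsker-type bound in the Hilbert-Schmidt norm: the linear terms of [mul_ln_ge_sqr] cancel
    because both traces are 1. *)
Lemma qrelent_ge_sqr A B D : cstate A -> cstate B -> A = B *m D ->
  re (\tr ((A - B) *m (A - B))) / 4 <= cqrelent A B.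
Proof.
move=> /cstateP[V [a [uV -> a0 a1]]] /cstateP[U [b [uU -> b0 b1]]] e.
have -> : re (\tr ((fmx V a - fmx U b) *m (fmx V a - fmx U b))) =
    \sum_i \sum_j (a i - b j) ^+ 2 * overlap V U i j.
  rewrite mulmxBl !mulmxBr !raddfB /= [\tr (fmx U b *m fmx V a)]mxtrace_mulC.
  rewrite opprK !fmxM // !tr_fmx // !tr_fmx2 !(reD, reN) !re_emb.
  have -> : \sum_i a i * a i = \sum_i \sum_j a i * a i * overlap V U i j.
    by apply: eq_bigr => i _; rewrite -mulr_sumr overlap_sum_row // mulr1.
  have -> : \sum_i b i * b i = \sum_i \sum_j b j * b j * overlap V U i j.
    rewrite exchange_big; apply: eq_bigr => i _.
    by rewrite -mulr_sumr overlap_sum_col // mulr1.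
  rewrite -!sumrN -!big_split; apply: eq_bigr => i _ /=.
  by rewrite -!sumrN -!big_split; apply: eq_bigr => j _ /=; ring.
have -> : cqrelent (fmx V a) (fmx U b) =
    \sum_i \sum_j (a i * (ln (a i) - ln (b j)) - (a i - b j)) * overlap V U i j.
  have e0 : \sum_i \sum_j (a i - b j) * overlap V U i j = 0.
    under eq_bigr do under eq_bigr do rewrite mulrBl.
    under eq_bigr do rewrite sumrB -mulr_sumr overlap_sum_row // mulr1.
    rewrite sumrB exchange_big /= a1; apply/eqP; rewrite subr_eq0 -b1; apply/eqP.
    by apply: eq_bigr => j _; rewrite -mulr_sumr overlap_sum_col // mulr1.
  rewrite qrelent_fmx // -[LHS]subr0 -[X in _ - X]e0 -sumrB; apply: eq_bigr => i _.
  by rewrite -sumrB; apply: eq_bigr => j _; ring.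
rewrite mulr_suml; apply: ler_sum => i _; rewrite mulr_suml; apply: ler_sum => j _.
have [->|W0] := eqVneq (overlap V U i j) 0; first by rewrite !mulr0 mul0r.
rewrite mulrAC; apply: ler_wpM2r; first exact: overlap_ge0.
apply: mul_ln_ge_sqr; rewrite ?a0 ?b0 ?(cstate_le1 a0) ?(cstate_le1 b0) //.
move=> /(dominated_overlap i uV uU e) /eqP.
by rewrite mulf_eq0 (negPf W0) orbF => /eqP.
Qed.

(** The left side is D(A||B) + D(B||A), a sum over pairs of (a_i - b_j) (ln a_i - ln b_j) W_ij, to
    which [ln_log_mean] applies termwise. *)
Lemma qrelent_sym_le V U a b : V \is unitarymx -> U \is unitarymx ->
  (forall i, 0 <= a i) -> (forall j, 0 <= b j) ->
  (forall i j, b j = 0 -> a i * overlap V U i j = 0) ->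
  (forall i j, a i = 0 -> b j * overlap V U i j = 0) ->
  re (\tr ((fmx V a - fmx U b) *m
     (cmxfun (@ln R) (fmx V a) - cmxfun (@ln R) (fmx U b)))) <=
  (cchi2 (fmx V a) (fmx U b) + cchi2 (fmx U b) (fmx V a)) / 2.
Proof.
move=> uV uU a0 b0 h1 h2; rewrite mulmxBl !mulmxBr !raddfB /= !mxfun_fmx //.
rewrite [\tr (fmx U b *m fmx V _)]mxtrace_mulC opprK !fmxM // !tr_fmx // !tr_fmx2 !(reD, reN) !re_emb.
have -> : \sum_i a i * (ln (R:=R) \o a) i = \sum_i \sum_j a i * ln (a i) * overlap V U i j.
  by apply: eq_bigr => i _; rewrite -mulr_sumr overlap_sum_row // mulr1.
have -> : \sum_i b i * (ln (R:=R) \o b) i = \sum_i \sum_j b j * ln (b j) * overlap V U i j.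
  rewrite exchange_big; apply: eq_bigr => i _.
  by rewrite -mulr_sumr overlap_sum_col // mulr1.
rewrite !chi2_fmx // [X in _ <= (_ + X) / 2]exchange_big -big_split mulr_suml -!sumrN -!big_split /=.
apply: ler_sum => i _; rewrite -big_split mulr_suml -!sumrN -!big_split /=; apply: ler_sum => j _ /=.
rewrite [overlap U V j i]overlapC.
have [->|W0] := eqVneq (overlap V U i j) 0; first by rewrite !mulr0; lra.
have {}h1 : b j = 0 -> a i = 0.
  by move=> /(h1 i) /eqP; rewrite mulf_eq0 (negPf W0) orbF => /eqP.
have {}h2 : a i = 0 -> b j = 0.
  by move=> /(h2 i j) /eqP; rewrite mulf_eq0 (negPf W0) orbF => /eqP.
rewrite -[(b j - a i) ^+ 2]sqrrN opprB -mulrDl [X in _ <= X]mulrAC.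
set lhs := (X in X <= _).
have -> : lhs = (a i - b j) * (ln (a i) - ln (b j)) * overlap V U i j by rewrite /lhs; ring.
apply: ler_wpM2r; first exact: overlap_ge0.
have [ai|ai] := eqVneq (a i) 0; first by rewrite ai (h2 ai) !subrr expr0n /= !mul0r addr0 mul0r.
have [bj|bj] := eqVneq (b j) 0; first by rewrite (h1 bj) eqxx in ai.
by apply: ln_log_mean; rewrite lt_neqAle eq_sym ?ai ?bj ?a0 ?b0.
Qed.

Lemma cstate_convex (I : finType) (p : I -> R) (A_ : I -> 'M[C]_n) :
  (forall i, 0 <= p i) -> \sum_i p i = 1 -> (forall i, cstate (A_ i)) ->
  cstate (\sum_i emb (p i) *: A_ i).
Proof.
move=> p0 p1 sA; split.
- apply/hermsymmxP/matrixP => i j; rewrite adjE !summxE rmorph_sum; apply: eq_bigr => k _ /=.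
  have [/hermsymmxP hA _ _] := sA k.
  by rewrite !mxE rmorphM /= conj_emb -[in RHS]hA adjE.
- move=> v; rewrite mulmx_sumr mulmx_suml summxE sumr_ge0 // => i _.
  rewrite -scalemxAr -scalemxAl mxE mulr_ge0 ?emb_ge0 //.
  by have [_ + _] := sA i; apply.
- rewrite raddf_sum -(rmorph1 emb) -p1 rmorph_sum; apply: eq_bigr => i _.
  by have [_ _ tA] := sA i; rewrite /= mxtraceZ tA mulr1.
Qed.

(** * Relative entropy along the segment from [A0] to [A1] *)

Section Path.
Variables (A0 A1 D1 : 'M[C]_n).
Hypotheses (sA0 : cstate A0) (sA1 : cstate A1) (dom : A1 = A0 *m D1).

Definition mixture (s : R) : 'M[C]_n := A0 + emb s *: (A1 - A0).

Lemma mixtureE s : mixture s = emb (1 - s) *: A0 + emb s *: A1.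
Proof.
by rewrite /mixture rmorphB rmorph1 scalerBr scalerBl scale1r addrA addrAC.
Qed.

Lemma mixture0 : mixture 0 = A0.
Proof. by rewrite /mixture rmorph0 scale0r addr0. Qed.

Lemma mixture_state s : 0 <= s <= 1 -> cstate (mixture s).
Proof.
move=> /andP[s0 s1]; rewrite mixtureE.
have := @cstate_convex bool (fun c : bool => if c then s else 1 - s)
  (fun c : bool => if c then A1 else A0).
rewrite !big_bool /= [emb s *: _ + _]addrC; apply; last by case.
  by case; rewrite ?subr_ge0.
by rewrite addrC subrK.
Qed.

Lemma mixture_dominated s : exists D, mixture s = A0 *m D.
Proof.
exists (1%:M + emb s *: (D1 - 1%:M)).
by rewrite /mixture mulmxDr mulmx1 -scalemxAr mulmxBr mulmx1 -dom.
Qed.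

(** For 0 < s < 1, positivity forces both endpoints to have zero quadratic form on a kernel vector
    of [mixture s]; hence so does every mixture. *)
Lemma mixture_kernel V a U b s u i j : V \is unitarymx -> U \is unitarymx ->
  0 < s < 1 -> 0 <= u <= 1 -> mixture s = fmx V a -> mixture u = fmx U b ->
  (forall j, 0 <= b j) -> a i = 0 -> b j * overlap V U i j = 0.
Proof.
move=> uV uU /andP[s0 s1] /andP[u0 u1] sE uE b0 ai.
have q0 : 0 <= dform V A0 i by apply: dform_state_ge0.
have q1 : 0 <= dform V A1 i by apply: dform_state_ge0.
have : dform V (mixture s) i = 0 by rewrite sE dform_diag.
rewrite mixtureE dformD !dformZ => h.
have d0 : dform V A0 i = 0 by nra.
have d1 : dform V A1 i = 0 by nra.
have : dform V (mixture u) i = 0 by rewrite mixtureE dformD !dformZ d0 d1 !mulr0 addr0.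
rewrite uE dform_fmx => /eqP; rewrite psumr_eq0 => [/allP/(_ j)|k _].
  by rewrite mem_index_enum => /(_ isT) /eqP.
by rewrite mulr_ge0 ?overlap_ge0.
Qed.

Local Notation logm := (cmxfun (@ln R)).

(** The right side minus the left is D(mixture s || mixture u), nonnegative by Klein's inequality.
    This is a convexity estimate that never differentiates the logarithm. *)
Lemma qrelent_mixture_step s u : 0 <= s <= 1 -> 0 < u < 1 ->
  cqrelent (mixture u) A0 - cqrelent (mixture s) A0 <=
  (u - s) * re (\tr ((A1 - A0) *m (logm (mixture u) - logm A0))).
Proof.
move=> s01 u01; have u01' : 0 <= u <= 1 by lra.
have /cstateP[U0 [b0 [uU0 A0E _ _]]] := sA0.
have /cstateP[V [a [uV sE a0 a1]]] := mixture_state s01.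
have /cstateP[U [b [uU uE b0' b1]]] := mixture_state u01'.
have := @klein V U a b uV uU a0 b0'; rewrite a1 b1 subrr  => K.
have {K} : 0 <= cqrelent (fmx V a) (fmx U b).
  apply: K => i j bj; rewrite overlapC.
  exact: (mixture_kernel i uU uV u01 s01 uE sE a0 bj).
rewrite !qrelent_ent // => K.
rewrite A0E sE uE !qrelent_ent // -A0E.
have -> : (u - s) * re (\tr ((A1 - A0) *m (logm (fmx U b) - logm A0))) =
   re (\tr ((mixture u - mixture s) *m (logm (fmx U b) - logm A0))).
  have -> : mixture u - mixture s = emb (u - s) *: (A1 - A0).
    by rewrite /mixture opprD addrACA subrr add0r rmorphB scalerBl.
  by rewrite -scalemxAl mxtraceZ reZ.
rewrite sE uE mulmxBl !mulmxBr !raddfB /= !(reD, reN).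
have -> : re (\tr (fmx U b *m logm (fmx U b))) = ent b.
  by rewrite mxfun_fmx // fmxM // tr_fmx // re_emb.
lra.
Qed.

Local Notation invm := (cmxfun (fun t => t^-1)).
Local Notation Delta := (A1 - A0).

Lemma Delta_dominated : exists D, Delta = A0 *m D.
Proof. by exists (D1 - 1%:M); rewrite mulmxBr mulmx1 -dom. Qed.

Lemma state_herm A : cstate A -> adj A = A.
Proof. by case=> /hermsymmxP. Qed.

Lemma adjB A B : adj (A - B) = adj A - adj B.
Proof. by apply/matrixP => i j; rewrite !(adjE, mxE) rmorphB. Qed.

Lemma adjZ (s : R) A : adj (emb s *: A) = emb s *: adj A.
Proof. by apply/matrixP => i j; rewrite !(adjE, mxE) rmorphM /= conj_emb. Qed.

Lemma Delta_herm : adj Delta = Delta.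
Proof. by rewrite adjB !state_herm. Qed.

Lemma invm_herm A : cstate A -> adj (invm A) = invm A.
Proof. by case/cstateP => V [a [uV -> _ _]]; rewrite mxfun_fmx // fmx_herm. Qed.

Lemma mul_invm A : cstate A -> A *m invm A *m A = A.
Proof.
case/cstateP => V [a [uV -> _ _]]; rewrite mxfun_fmx // !fmxM //.
apply: eq_fmx => i /=; have [->|ai] := eqVneq (a i) 0; first by rewrite mulr0.
by rewrite divff ?mul1r.
Qed.

Lemma invm_mul A : cstate A -> invm A *m A *m invm A = invm A.
Proof.
case/cstateP => V [a [uV -> _ _]]; rewrite mxfun_fmx // !fmxM //.
apply: eq_fmx => i /=; have [->|ai] := eqVneq (a i) 0; first by rewrite invr0 mulr0.
by rewrite mulVf ?mul1r.
Qed.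

Lemma Delta_invm : Delta *m invm A0 *m A0 = Delta.
Proof.
have [D DE] := Delta_dominated.
have DE' : Delta = adj D *m A0 by rewrite -Delta_herm DE adjM (state_herm sA0).
by rewrite {1}DE' -(mulmxA (adj D)) -(mulmxA (adj D)) mul_invm // -DE'.
Qed.

Lemma invm_Delta : A0 *m (invm A0 *m Delta) = Delta.
Proof. have := congr1 (@adj _ _ _) Delta_invm.
by rewrite (adjM _ A0) (adjM Delta) Delta_herm invm_herm // state_herm. Qed.

(* Operator antitonicity of the inverse, tested on [Delta]. *)
Lemma tr_invm_mixture_le s : 0 <= s < 1 ->
  re (\tr (Delta *m invm (mixture s) *m Delta)) <=
  re (\tr (Delta *m invm A0 *m Delta)) / (1 - s).
Proof.
move=> /andP[s0 s1]; have sM : cstate (mixture s) by apply: mixture_state; lra.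
pose t := (1 - s)^-1; have t0 : 0 < t by rewrite invr_gt0; lra.
have ts : t * (1 - s) = 1 by rewrite mulVf //; lra.
set P := invm (mixture s); set Q := invm A0.
have hP : adj P = P by exact: invm_herm.
have hQ : adj Q = Q by exact: invm_herm.
set x := re (\tr (Delta *m P *m Delta)); set y := re (\tr (Delta *m Q *m Delta)).
(* The trace of Y A0 Y^* is t^2 y - 2 t x + z >= 0, and z <= t x because A0 <= t [mixture s];
   together x <= t y. *)
pose Y := emb t *: (Delta *m Q) - Delta *m P.
have adjY : adj Y = emb t *: (Q *m Delta) - P *m Delta.
  by rewrite /Y adjB adjZ (adjM _ P) (adjM _ Q) hP hQ Delta_herm.
have h1 := tr_congr_ge0 Y sA0; rewrite adjY in h1.
pose z := re (\tr (Delta *m P *m A0 *m (P *m Delta))).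
have e1 : re (\tr (Y *m A0 *m (emb t *: (Q *m Delta) - P *m Delta))) = t * t * y - t * x - t * x + z.
  have trB (X1 X2 : 'M[C]_n) : \tr (X1 - X2) = \tr X1 - \tr X2 by rewrite raddfB.
  rewrite /Y (mulmx_young _ _ Delta_invm invm_Delta) mxtraceD !trB !mxtraceZ.
  by rewrite -rmorphM !(reD, reN) !reZ.
have h2 : z <= t * x.
  have h := tr_congr_ge0 (Delta *m P) sA1; rewrite adjM hP Delta_herm in h.
  have e2 : emb t *: mixture s = A0 + emb (t * s) *: A1.
    by rewrite mixtureE scalerDr !scalerA -!rmorphM ts rmorph1 scale1r.
  have : re (\tr (Delta *m P *m (emb t *: mixture s) *m (P *m Delta))) = t * x.
    rewrite -scalemxAr -scalemxAl mxtraceZ reZ /x; congr (_ * re (\tr _)).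
    by rewrite mulmxA -(mulmxA Delta P (mixture s)) -(mulmxA Delta _ P) invm_mul.
  rewrite e2 mulmxDr mulmxDl mxtraceD reD -/z -scalemxAr -scalemxAl mxtraceZ reZ => <-.
  by rewrite lerDl mulr_ge0 // mulr_ge0 // ltW.
rewrite e1 in h1; rewrite -/t mulrC.
have : t * x <= t * (t * y) by nra.
by rewrite ler_pM2l.
Qed.

Lemma chi2_mixture s : cchi2 (mixture s) A0 = s ^+ 2 * cchi2 A1 A0.
Proof.
rewrite /cchi2 /mixture addrAC subrr add0r -!scalemxAl -scalemxAr -!scalemxAl !mxtraceZ.
by rewrite !reZ mulrA.
Qed.

Lemma chi2_tr A : re (\tr ((A1 - A0) *m (A1 - A0) *m A)) = re (\tr (Delta *m A *m Delta)).
Proof. by rewrite -mulmxA mxtrace_mulC. Qed.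

Lemma chi2_mixture_rev s : 0 <= s < 1 ->
  cchi2 A0 (mixture s) <= s ^+ 2 * (cchi2 A1 A0 / (1 - s)).
Proof.
move=> s01; rewrite /cchi2 chi2_tr.
have -> : A0 - mixture s = emb (- s) *: Delta.
  by rewrite /mixture opprD addrA subrr add0r rmorphN scaleNr.
rewrite -!scalemxAl -scalemxAr -!scalemxAl !mxtraceZ !reZ chi2_tr mulrA mulrNN -expr2.
by apply: ler_wpM2l; rewrite ?sqr_ge0 // tr_invm_mixture_le.
Qed.

(** [qrelent_sym_le] for [mixture s] and A0, divided by s: their difference is s Delta, and both
    chi-square terms are at most s^2 chi^2 / (1 - s). *)
Lemma qrelent_mixture_slope s : 0 < s < 1 ->
  re (\tr (Delta *m (logm (mixture s) - logm A0))) <= s * (cchi2 A1 A0 / (1 - s)).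
Proof.
move=> /andP[s0 s1]; have s01 : 0 <= s <= 1 by lra.
have /cstateP[U [b [uU A0E b0 _]]] := sA0.
have /cstateP[V [a [uV sE a0 _]]] := mixture_state s01.
have [D DE] := mixture_dominated s.
have E0 : mixture 0 = fmx U b by rewrite mixture0.
have := @qrelent_sym_le V U a b uV uU a0 b0 => /(_ _ _)/=.
rewrite -sE -A0E => h.
have {h} : re (\tr ((mixture s - A0) *m (logm (mixture s) - logm A0))) <=
    (cchi2 (mixture s) A0 + cchi2 A0 (mixture s)) / 2.
  apply: h => i j; last by apply: (mixture_kernel j uV uU _ _ sE E0 b0); lra.
  by apply: (dominated_overlap i uV uU); rewrite -sE -A0E; exact: DE.
have -> : mixture s - A0 = emb s *: Delta by rewrite /mixture addrAC subrr add0r.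
rewrite -scalemxAl mxtraceZ reZ chi2_mixture => h.
have h2 : cchi2 A0 (mixture s) <= s ^+ 2 * (cchi2 A1 A0 / (1 - s)).
  by apply: chi2_mixture_rev; lra.
have X0 : 0 <= cchi2 A1 A0.
  have /cstateP[V1 [a1 [uV1 -> _ _]]] := sA1.
  rewrite A0E chi2_fmx // sumr_ge0 // => i _; rewrite sumr_ge0 // => j _.
  by rewrite mulr_ge0 ?overlap_ge0 // divr_ge0 ?sqr_ge0.
have h3 : cchi2 A1 A0 <= cchi2 A1 A0 / (1 - s).
  by rewrite ler_pdivlMr; nra.
have h4 : s ^+ 2 * cchi2 A1 A0 <= s ^+ 2 * (cchi2 A1 A0 / (1 - s)).
  by apply: ler_wpM2l => //; exact: sqr_ge0.
rewrite -(ler_pM2l s0); apply: (le_trans h); rewrite mulrA -expr2; lra.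
Qed.

Lemma qrelent_self A : cstate A -> cqrelent A A = 0.
Proof.
case/cstateP=> V [a [uV -> _ _]]; rewrite qrelent_fmx // big1 // => i _; rewrite big1 // => j _.
rewrite overlap_id //; case: eqVneq => [->|_]; first by rewrite subrr mulr0 mul0r.
by rewrite mulr0.
Qed.

(* Integrating the slope bound as a Riemann sum with [m] steps keeps the sharp
   constant 1/2. *)
Lemma qrelent_mixture_le s : 0 < s < 1 ->
  cqrelent (mixture s) A0 <= s ^+ 2 * (cchi2 A1 A0 / (1 - s)) / 2.
Proof.
move=> /andP[s0 s1]; set X := cchi2 A1 A0 / (1 - s).
(* On a grid of m + 1 steps of length h, going from k to k + 1 adds at most h (h (k + 1) X); the
   indices up to k sum to k (k + 1) / 2. *)
have main m : cqrelent (mixture s) A0 <= s ^+ 2 * X / 2 * (1 + (m.+1%:R)^-1).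
  pose h := s / m.+1%:R; have h0 : 0 < h by rewrite divr_gt0.
  have hm : h * m.+1%:R = s by rewrite /h divfK ?pnatr_eq0.
  have step k : (k <= m.+1)%N ->
      cqrelent (mixture (h * k%:R)) A0 <= h ^+ 2 * X * (k%:R * (k%:R + 1) / 2).
    elim: k => [|k IH] km; first by rewrite mulr0 mixture0 qrelent_self //; lra.
    have {}IH := IH (ltnW km).
    have kp : 0 < k.+1%:R :> R by rewrite ltr0n.
    have k0 : 0 <= k%:R :> R by rewrite ler0n.
    have kE : k.+1%:R = k%:R + 1 :> R by rewrite -natr1.
    have km' : (k.+1%:R : R) <= m.+1%:R by rewrite ler_nat.
    have us : h * k.+1%:R <= s by rewrite -hm ler_pM2l.
    have hk0 : 0 <= h * k%:R by apply: mulr_ge0 => //; exact: ltW.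
    have hk1 : 0 < h * k.+1%:R by apply: mulr_gt0.
    have hk : h * k.+1%:R = h * k%:R + h by rewrite kE mulrDr mulr1.
    have := @qrelent_mixture_step (h * k%:R) (h * k.+1%:R).
    have -> : h * k.+1%:R - h * k%:R = h by rewrite hk; ring.
    move=> /(_ _ _) st; have {st} : cqrelent (mixture (h * k.+1%:R)) A0 -
      cqrelent (mixture (h * k%:R)) A0 <=
      h * re (\tr (Delta *m (logm (mixture (h * k.+1%:R)) - logm A0))) by apply: st; lra.
    have sl : re (\tr (Delta *m (logm (mixture (h * k.+1%:R)) - logm A0))) <=
        h * k.+1%:R * X.
      apply: le_trans (qrelent_mixture_slope _) _; first lra.
      apply: ler_wpM2l; first exact: ltW.
      apply: ler_wpM2l; last by rewrite lef_pV2 ?posrE; lra.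
      have /cstateP[V1 [a1 [uV1 -> _ _]]] := sA1.
      have /cstateP[U [b [uU -> b0 _]]] := sA0.
      rewrite chi2_fmx // sumr_ge0 // => i _; rewrite sumr_ge0 // => j _.
      by rewrite mulr_ge0 ?overlap_ge0 // divr_ge0 ?sqr_ge0.
    have {}sl := ler_wpM2l (ltW h0) sl.
    move=> st; rewrite kE in sl st IH *.
    have -> : h ^+ 2 * X * ((k%:R + 1) * (k%:R + 1 + 1) / 2) =
      h * (h * (k%:R + 1) * X) + h ^+ 2 * X * (k%:R * (k%:R + 1) / 2) by field.
    lra.
  have := step m.+1 (leqnn _); rewrite hm => st; apply: (le_trans st).
  rewrite le_eqVlt; apply/orP; left; apply/eqP; rewrite -hm.
  have := pnatr_eq0 R m.+1; move: (m.+1%:R) => M /negbT M0.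
  by field.
apply/ler_addgt0Pr => e e0.
pose B := s ^+ 2 * X / 2.
have [m hm] : exists m, B * (m.+1%:R)^-1 <= e.
  exists (Num.bound (B / e)); case: (lerP B 0) => B0.
    by apply: le_trans (ltW e0); rewrite mulr_le0_ge0 ?invr_ge0.
  have := archi_boundP (ltW (divr_gt0 B0 e0)); set k := Num.bound _ => hk.
  rewrite ler_pdivrMr // mulrC -ler_pdivrMr //; apply: (le_trans (ltW hk)).
  by rewrite ler_nat.
by apply: le_trans (main m) _; rewrite mulrDr mulr1 lerD2l.
Qed.

End Path.
End States.

(** * Resolvability *)

Section TraceDistance.
Variables (R : realType) (C : complexModel R) (n : nat).
Implicit Types (A B D Y V U Q T : 'M[C]_n) (a b u : 'I_n -> R).
Local Notation emb := (@emb R C).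
Local Notation re := (@re R C).

(** Trace norm by duality: [fmx Q u] ranges over the Hermitian observables with spectrum in [-1, 1].
    A difference of states can thus be bounded piece by piece, even when the pieces are not
    Hermitian. *)
Definition trnorm_le A (eta : R) : Prop := forall Q u, Q \is unitarymx ->
  (forall i, `|u i| <= 1) -> re (\tr (A *m fmx Q u)) <= eta.

Lemma trnorm_leN A eta : trnorm_le A eta -> trnorm_le (- A) eta.
Proof.
move=> h Q u uQ u1; have := h Q (fun i => - u i) uQ _.
have -> : fmx Q (fun i => - u i) = - fmx Q u.
  rewrite -[RHS]sub0r; have -> : 0 = fmx Q (fun=> 0 : R) :> 'M[C]_n.
    apply/matrixP => i j; rewrite fmxE big1 ?mxE // => k _.
    by rewrite rmorph0 !mul0r.
  by rewrite fmxB; apply: eq_fmx => i; rewrite sub0r.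
by rewrite mulmxN mulNmx; apply => i; rewrite normrN.
Qed.

Lemma trnorm_le_scale A eta Q u (be : R) : 0 < be -> trnorm_le A eta ->
  Q \is unitarymx -> (forall i, `|u i| <= be) -> re (\tr (A *m fmx Q u)) <= be * eta.
Proof.
move=> be0 h uQ ub.
have -> : fmx Q u = emb be *: fmx Q (fun i => u i / be).
  apply/matrixP => i j; rewrite fmxE [RHS]mxE fmxE mulr_sumr; apply: eq_bigr => k _.
  by rewrite !mulrA -rmorphM mulrCA divff ?mulr1 ?gt_eqF.
rewrite -scalemxAr mxtraceZ reZ ler_pM2l //; apply: h => // i.
by rewrite normrM normfV (gtr0_norm be0) ler_pdivrMr // mul1r.
Qed.

(** By convexity of x ln(x + e) the difference is at most the trace of A - B against the tangent
    slope at A, an observable of norm at most 2 - ln e. Removing the shift costs e per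
    eigenvalue. *)
Lemma ent_le V U a b (e eta : R) : V \is unitarymx -> U \is unitarymx ->
  (forall i, 0 <= a i <= 1) -> (forall i, 0 <= b i) -> 0 < e <= 1 ->
  trnorm_le (fmx V a - fmx U b) eta ->
  ent a <= ent b + e * n%:R + (2 - ln e) * eta.
Proof.
move=> uV uU a01 b0 /andP[e0 e1] tn.
pose h i := ln (a i + e) + a i / (a i + e).
have a0 i : 0 <= a i by case/andP: (a01 i).
have lne : ln e <= 0 by apply: ln_le0.
have hb i : `|h i| <= 2 - ln e.
  have /andP[ai0 ai1] := a01 i.
  have q0 : 0 <= a i / (a i + e) by apply: divr_ge0; lra.
  have q1 : a i / (a i + e) <= 1 by rewrite ler_pdivrMr; lra.
  have l0 : ln e <= ln (a i + e) by rewrite ler_ln ?posrE; lra.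
  have l1 : ln (a i + e) <= a i + e - 1 by apply: ln_le_subr1; lra.
  by rewrite ler_norml /h; apply/andP; split; lra.
have T : re (\tr ((fmx V a - fmx U b) *m fmx V h)) <= (2 - ln e) * eta.
  by apply: trnorm_le_scale => //; lra.
have {T} T : \sum_i \sum_j (a i - b j) * h i * overlap V U i j <= (2 - ln e) * eta.
  apply: le_trans T; rewrite mulmxBl raddfB /= reB [\tr (fmx U b *m _)]mxtrace_mulC.
  rewrite fmxM // tr_fmx // tr_fmx2 !re_emb -sumrB; apply: ler_sum => i _.
  rewrite -[X in _ <= X - _]mulr1 -(overlap_sum_row i uV uU) mulr_sumr -sumrB.
  by apply: ler_sum => j _; rewrite le_eqVlt; apply/orP; left; apply/eqP; ring.
have K : \sum_i a i * ln (a i + e) - \sum_j b j * ln (b j + e) <=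
    \sum_i \sum_j (a i - b j) * h i * overlap V U i j.
  have -> : \sum_i a i * ln (a i + e) = \sum_i \sum_j a i * ln (a i + e) * overlap V U i j.
    by apply: eq_bigr => i _; rewrite -mulr_sumr overlap_sum_row // mulr1.
  have -> : \sum_j b j * ln (b j + e) = \sum_i \sum_j b j * ln (b j + e) * overlap V U i j.
    rewrite exchange_big; apply: eq_bigr => j _.
    by rewrite -mulr_sumr overlap_sum_col // mulr1.
  rewrite -sumrB; apply: ler_sum => i _; rewrite -sumrB; apply: ler_sum => j _.
  rewrite -mulrBl; apply: ler_wpM2r; first exact: overlap_ge0.
  by have := ln_shift_tangent (a0 i) (b0 j) e0; rewrite /h; lra.
have E1 : ent a <= \sum_i a i * ln (a i + e).
  by apply: ler_sum => i _; case/andP: (mul_ln_shift (a0 i) e0).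
have E2 : \sum_j b j * ln (b j + e) <= ent b + e * n%:R.
  have -> : e * n%:R = \sum_(j < n) e by rewrite sumr_const card_ord mulr_natr.
  rewrite -big_split; apply: ler_sum => j _.
  by case/andP: (mul_ln_shift (b0 j) e0).
lra.
Qed.

Lemma young_re (z w : C) (t : R) : 0 < t ->
  re (z * w) <= (normsq z / t + t * normsq w) / 2.
Proof.
move=> t0; rewrite reM /normsq.
set x := re z; set y := im z; set x' := re w; set y' := im w.
have -> : ((x ^+ 2 + y ^+ 2) / t + t * (x' ^+ 2 + y' ^+ 2)) / 2 =
  x * x' - y * y' + ((x - t * x') ^+ 2 + (y + t * y') ^+ 2) / (2 * t) by field; lra.
by rewrite lerDl divr_ge0 ?addr_ge0 ?sqr_ge0 //; lra.
Qed.

Lemma tr_young (Z W : 'M[C]_n) (g : 'I_n -> 'I_n -> R) (t : R) : 0 < t ->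
  (forall i j, 0 <= g i j) -> (forall i j, g i j = 0 -> Z i j = 0) ->
  re (\tr (Z *m W)) <=
  ((\sum_i \sum_j normsq (Z i j) / g i j) / t + t * \sum_i \sum_j g i j * normsq (W j i)) / 2.
Proof.
move=> t0 g0 gZ; rewrite /mxtrace re_sum mulr_suml mulr_sumr -big_split mulr_suml /=.
apply: ler_sum => i _; rewrite mxE re_sum mulr_suml mulr_sumr -big_split mulr_suml /=.
apply: ler_sum => j _; have [gij|gij] := eqVneq (g i j) 0.
  by rewrite (gZ _ _ gij) mul0r re0 normsq0 gij !mul0r mulr0 addr0 mul0r.
have gp : 0 < g i j by rewrite lt_neqAle eq_sym gij g0.
apply: le_trans (young_re _ _ (mulr_gt0 t0 gp)) _.
rewrite le_eqVlt; apply/orP; left; apply/eqP; field; apply/andP; split; lra.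
Qed.

Lemma normsq_row_sum (Z : 'M[C]_n) i : \sum_k normsq (Z i k) = re ((Z *m adj Z) i i).
Proof.
by rewrite mxE re_sum; apply: eq_bigr => k _; rewrite adjE mul_conj re_emb.
Qed.

Lemma normsq_col_sum (Z : 'M[C]_n) i : \sum_k normsq (Z k i) = re ((adj Z *m Z) i i).
Proof.
by rewrite mxE re_sum; apply: eq_bigr => k _; rewrite adjE mulrC mul_conj re_emb.
Qed.

(** A product of unitaries and a Hermitian matrix of norm at most 1 is a contraction, so its rows
    have norm at most 1. *)
Lemma contraction_row U Q T u i : U \is unitarymx -> Q \is unitarymx -> T \is unitarymx ->
  (forall i, `|u i| <= 1) -> \sum_k normsq ((U *m fmx Q u *m T) i k) <= 1.
Proof.
move=> uU uQ uT u1; rewrite normsq_row_sum adjM (adjM U) fmx_herm.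
have -> : U *m fmx Q u *m T *m (adj T *m (fmx Q u *m adj U)) =
    U *m fmx Q (fun i => u i * u i) *m adj U.
  rewrite -fmxM // !mulmxA; congr (_ *m _ *m _).
  by rewrite -(mulmxA _ T) unitary_adj // mulmx1.
rewrite -/(dform U _ i) dform_fmx -(overlap_sum_row i uU uQ); apply: ler_sum => j _.
rewrite ler_piMl ?overlap_ge0 //.
by have := u1 j; rewrite ler_norml => /andP[? ?]; nra.
Qed.

Lemma contraction_col U Q T u j : U \is unitarymx -> Q \is unitarymx -> T \is unitarymx ->
  (forall i, `|u i| <= 1) -> \sum_k normsq ((adj U *m fmx Q u *m T) k j) <= 1.
Proof.
move=> uU uQ uT u1.
have uT' : adj T \is unitarymx by rewrite /adj trmxC_unitary.
have := contraction_row j uT' uQ uU u1; rewrite (eq_bigr (fun k => normsq ((adj U *m fmx Q u *m T) k j))) // => k _.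
by rewrite -[in RHS]normsqJ -adjE adjM (adjM _ (fmx Q u)) adjK fmx_herm mulmxA.
Qed.

End TraceDistance.

(** * Simulating a mixture by randomly drawn states *)

Section Resolvability.
Variables (R : realType) (C : complexModel R) (n : nat).
Local Notation emb := (@emb R C).
Local Notation re := (@re R C).
Variables (T : finType) (w : T -> R) (V : T -> 'M[C]_n) (a : T -> 'I_n -> R).
Variables (U : 'M[C]_n) (b : 'I_n -> R) (G : R).
Hypotheses (w0 : forall x, 0 <= w x) (w1 : \sum_x w x = 1).
Hypotheses (uV : forall x, V x \is unitarymx) (uU : U \is unitarymx).
Hypotheses (a0 : forall x i, 0 <= a x i) (a1 : forall x, \sum_i a x i = 1).
Hypotheses (b0 : forall i, 0 <= b i) (b1 : \sum_i b i = 1) (G0 : 0 <= G).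

Local Notation rho x := (fmx (V x) (a x)).
Definition likely x i j := a x i <= G * b j.
Definition unlikely_mass x :=
  \sum_i \sum_j (~~ likely x i j)%:R * (a x i * overlap (V x) U i j).

(* In the bases [V x] (rows) and [U] (columns), [rho x] has entries
   [a x i * (V x *m adj U) i j]; keep those of the likely pairs. *)
Definition likely_mx x : 'M[C]_n :=
  \matrix_(i, j) (emb ((likely x i j)%:R * a x i) * (V x *m adj U) i j).
Definition unlikely_mx x : 'M[C]_n :=
  \matrix_(i, j) (emb ((~~ likely x i j)%:R * a x i) * (V x *m adj U) i j).

Lemma rho_split x : rho x = adj (V x) *m unlikely_mx x *m U + adj (V x) *m likely_mx x *m U.
Proof.
rewrite -mulmxDl -mulmxDr.
have -> : unlikely_mx x + likely_mx x = rdiag C (a x) *m (V x *m adj U).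
  apply/matrixP => i j; rewrite mul_diag_mx !mxE -mulrDl -rmorphD -mulrDl.
  by case: (likely x i j); rewrite /= ?add0r ?addr0 mul1r.
by rewrite /fmx !mulmxA -(mulmxA _ (adj U)) adj_unitary // mulmx1.
Qed.

(** Young's inequality with weights a_i: the squared entries a_i^2 W_ij over a_i sum to the unlikely
    mass, and the observable contributes at most the sum of the a_i. *)
Lemma unlikely_trnorm x t : 0 < t ->
  trnorm_le (adj (V x) *m unlikely_mx x *m U) ((t + unlikely_mass x / t) / 2).
Proof.
move=> t0 Q u uQ u1.
have -> : \tr (adj (V x) *m unlikely_mx x *m U *m fmx Q u) =
    \tr (unlikely_mx x *m (U *m fmx Q u *m adj (V x))).
  by rewrite -!mulmxA mxtrace_mulC !mulmxA.
have uVx : adj (V x) \is unitarymx by rewrite /adj trmxC_unitary.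
have uU' : adj U \is unitarymx by rewrite /adj trmxC_unitary.
have gZ i j : a x i = 0 -> unlikely_mx x i j = 0.
  by move=> ai; rewrite mxE ai mulr0 rmorph0 mul0r.
apply: le_trans (tr_young _ t0 (fun i _ => a0 x i) gZ) _.
rewrite ler_pM2r ?invr_gt0 // addrC; apply: lerD.
  rewrite ler_piMr ?(ltW t0) // -(a1 x); apply: ler_sum => i _.
  rewrite -mulr_sumr ler_piMr //.
  by have := contraction_col i uU' uQ uVx u1; rewrite adjK.
rewrite ler_pM2r ?invr_gt0 //; apply: ler_sum => i _; apply: ler_sum => j _.
rewrite mxE normsqM normsq_emb /overlap; case: (likely x i j).
  by rewrite /= !mul0r expr0n /= !mul0r.
rewrite /= !mul1r; have [->|ai] := eqVneq (a x i) 0; first by rewrite expr0n /= !mul0r.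
by rewrite le_eqVlt; apply/orP; left; apply/eqP; field.
Qed.

(** On likely pairs a_i^2 / b_j is at most G a_i. Multiplying by [adj (V x)] preserves column norms
    and brings the matrices of all x to a common row basis, where they can be averaged. *)
Lemma likely_weight x :
  \sum_k \sum_j normsq ((adj (V x) *m likely_mx x) k j) / b j <= G.
Proof.
rewrite exchange_big /=.
have E j : \sum_k normsq ((adj (V x) *m likely_mx x) k j) / b j =
    \sum_i normsq (likely_mx x i j) / b j.
  rewrite -!mulr_suml; congr (_ / _); rewrite !normsq_col_sum adjM adjK.
  by rewrite -!mulmxA [V x *m _]mulmxA unitary_adj // mul1mx.
under eq_bigr do rewrite E.
rewrite exchange_big /= -[X in _ <= X]mulr1 -(a1 x) mulr_sumr; apply: ler_sum => i _.
rewrite -[X in _ <= G * X]mulr1 -(overlap_sum_row i (uV x) uU) !mulr_sumr.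
apply: ler_sum => j _; rewrite mxE normsqM normsq_emb -/(overlap _ _ _ _).
rewrite mulrAC mulrA; apply: ler_wpM2r; first exact: overlap_ge0.
rewrite /likely; case: (lerP (a x i) (G * b j)) => h /=; last first.
  by rewrite mul0r expr0n /= mul0r mulr_ge0.
rewrite mul1r; have [bj|bj] := eqVneq (b j) 0; first by rewrite bj invr0 mulr0 mulr_ge0.
have bp : 0 < b j by rewrite lt_neqAle eq_sym bj b0.
rewrite ler_pdivrMr //; have := ler_wpM2r (a0 x i) h; lra.
Qed.

Variable J : finType.
Hypothesis J0 : (0 < #|J|)%N.
Implicit Type c : {ffun J -> T}.

Definition likely_dev c : 'M[C]_n :=
  emb #|J|%:R^-1 *: (\sum_l adj (V (c l)) *m likely_mx (c l))
  - \sum_x emb (w x) *: (adj (V x) *m likely_mx x).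

Definition resolv_defect c : R :=
  #|J|%:R^-1 * (\sum_l unlikely_mass (c l)) + \sum_x w x * unlikely_mass x
  + \sum_k \sum_j normsq (likely_dev c k j) / b j.

Lemma unlikely_mass_ge0 x : 0 <= unlikely_mass x.
Proof. by rewrite sumr_ge0 // => i _; rewrite sumr_ge0 // => j _; rewrite !mulr_ge0 ?overlap_ge0. Qed.

Lemma resolv_defect_ge0 c : 0 <= resolv_defect c.
Proof.
rewrite !addr_ge0 ?mulr_ge0 ?invr_ge0 ?sumr_ge0 // => i _; rewrite ?unlikely_mass_ge0 //.
  by rewrite mulr_ge0 ?unlikely_mass_ge0.
by rewrite sumr_ge0 // => j _; rewrite divr_ge0 ?normsq_ge0.
Qed.

Lemma likely_mx0 x i j : b j = 0 -> likely_mx x i j = 0.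
Proof.
move=> bj; rewrite mxE /likely bj mulr0; case: (lerP (a x i) 0) => h /=; last by rewrite mul0r rmorph0 mul0r.
by have -> : a x i = 0; [apply/eqP; rewrite eq_le h a0|rewrite mulr0 rmorph0 mul0r].
Qed.

(** Young's inequality is used three times with the same t: for the unlikely parts of the sample,
    those of the mean, and the deviation of the likely parts. Optimising t here would leave the
    square root of a random quantity. *)
Lemma resolvability c t : 0 < t ->
  trnorm_le (emb #|J|%:R^-1 *: (\sum_l rho (c l)) - \sum_x emb (w x) *: rho x)
    (3 * t / 2 + resolv_defect c / (2 * t)).
Proof.
move=> t0 Q u uQ u1; pose F := fmx Q u.
pose Bd x := adj (V x) *m unlikely_mx x *m U.
have -> : emb #|J|%:R^-1 *: (\sum_l rho (c l)) - \sum_x emb (w x) *: rho x =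
    emb #|J|%:R^-1 *: (\sum_l Bd (c l)) - \sum_x emb (w x) *: Bd x + likely_dev c *m U.
  rewrite /likely_dev mulmxBl -scalemxAl !mulmx_suml.
  rewrite (eq_bigr _ (fun l _ => rho_split (c l))) big_split scalerDr.
  rewrite [X in _ - X](eq_bigr (fun x => emb (w x) *: Bd x +
       emb (w x) *: (adj (V x) *m likely_mx x) *m U)); last first.
    by move=> x _; rewrite rho_split scalerDr -!scalemxAl.
  by rewrite big_split opprD /= addrACA.
rewrite mulmxDl mxtraceD reD mulmxBl raddfB /= reB.
have L0 : #|J|%:R != 0 :> R by rewrite pnatr_eq0 -lt0n.
have B1 : re (\tr (emb #|J|%:R^-1 *: (\sum_l Bd (c l)) *m fmx Q u)) <=
    (t + (#|J|%:R^-1 * \sum_l unlikely_mass (c l)) / t) / 2.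
  rewrite -scalemxAl mxtraceZ reZ mulmx_suml raddf_sum re_sum /=.
  apply: (@le_trans _ _ (#|J|%:R^-1 * \sum_l (t + unlikely_mass (c l) / t) / 2)).
    rewrite ler_wpM2l ?invr_ge0 //; apply: ler_sum => l _; exact: unlikely_trnorm.
  rewrite -mulr_suml big_split /= sumr_const -mulr_suml -[t *+ _]mulr_natl.
  by rewrite le_eqVlt; apply/orP; left; apply/eqP; field; rewrite L0 gt_eqF.
have B2 : - re (\tr ((\sum_x emb (w x) *: Bd x) *m fmx Q u)) <=
    (t + (\sum_x w x * unlikely_mass x) / t) / 2.
  rewrite mulmx_suml raddf_sum re_sum /= -sumrN.
  have -> : (t + (\sum_x w x * unlikely_mass x) / t) / 2 =
      \sum_x w x * ((t + unlikely_mass x / t) / 2).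
    under [RHS]eq_bigr => x _ do rewrite mulrA mulrDr mulrA.
    by rewrite -mulr_suml big_split -!mulr_suml w1 mul1r.
  apply: ler_sum => x _; rewrite -scalemxAl mxtraceZ reZ -mulrN; apply: ler_wpM2l => //.
  have := trnorm_leN (unlikely_trnorm x t0) uQ u1.
  by rewrite mulNmx raddfN /= reN.
have B3 : re (\tr (likely_dev c *m U *m fmx Q u)) <=
    ((\sum_k \sum_j normsq (likely_dev c k j) / b j) / t + t) / 2.
  rewrite -mulmxA; have gZ k j : b j = 0 -> likely_dev c k j = 0.
    move=> bj; rewrite !mxE !summxE big1 => [|l _]; last first.
      by rewrite mxE big1 // => i _; rewrite likely_mx0 // mulr0.
    rewrite mulr0 big1 ?subr0 // => x _; rewrite !mxE big1 ?mulr0 // => i _.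
    by rewrite likely_mx0 // mulr0.
  apply: le_trans (tr_young _ t0 (fun _ j => b0 j) gZ) _.
  rewrite ler_pM2r ?invr_gt0 // lerD2l ler_piMr ?(ltW t0) // exchange_big /= -b1.
  apply: ler_sum => j _; rewrite -mulr_sumr ler_piMr //.
  have u1' : (1%:M : 'M[C]_n) \is unitarymx.
    by apply/unitarymxP; rewrite trmx1 map_mx1 mulmx1.
  by have := contraction_row j uU uQ u1' u1; rewrite mulmx1.
rewrite /resolv_defect.
set q1 := _ * \sum_l _ in B1 *; set q2 := \sum_x w x * _ in B2 *; set q3 := \sum_k \sum_j _ in B3 *.
have -> : 3 * t / 2 + (q1 + q2 + q3) / (2 * t) =
  (t + q1 / t) / 2 + (t + q2 / t) / 2 + (q3 / t + t) / 2 by field; rewrite gt_eqF.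
by apply: lerD => //; apply: lerD.
Qed.

(** The sampled unlikely mass has the same expectation as the averaged one, hence the factor 2. Real
    and imaginary parts of the likely entries are sample means, with variance at most the second
    moment over [#|J|]; weighted by 1 / b_j these moments sum to at most G. *)
Lemma expect_resolv_defect :
  \sum_(c : {ffun J -> T}) (\prod_l w (c l)) * resolv_defect c <=
  2 * (\sum_x w x * unlikely_mass x) + G / #|J|%:R.
Proof.
have L0 : #|J|%:R != 0 :> R by rewrite pnatr_eq0 -lt0n.
under eq_bigr do rewrite 2!mulrDr.
rewrite !big_split /=; apply: lerD.
  rewrite mulr_natl mulr2n; apply: lerD; last first.
    by rewrite -mulr_suml (@expect_one _ J T (fun=> w)) // mul1r.
  under eq_bigr do rewrite mulrCA.
  rewrite -mulr_sumr (@expect_sum _ J T (fun=> w) (fun=> w1) (fun=> unlikely_mass)) sumr_const.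
  rewrite -[(\sum_x w x * unlikely_mass x) *+ _]mulr_natl.
  by rewrite mulrA mulVf ?mul1r.
apply: (@le_trans _ _ (#|J|%:R^-1 * \sum_x w x *
    \sum_k \sum_j normsq ((adj (V x) *m likely_mx x) k j) / b j)); last first.
  rewrite mulrC ler_wpM2r ?invr_ge0 // -[X in _ <= X]mul1r -w1 mulr_suml.
  by apply: ler_sum => x _; rewrite ler_wpM2l // likely_weight.
under eq_bigr do rewrite mulr_sumr.
rewrite [X in X <= _]exchange_big /= [X in _ <= _ * X](eq_bigr (fun x => \sum_k w x *
  \sum_j normsq ((adj (V x) *m likely_mx x) k j) / b j)); last by move=> x _; rewrite mulr_sumr.
rewrite [X in _ <= _ * X]exchange_big mulr_sumr /=; apply: ler_sum => k _.
under eq_bigr do rewrite mulr_sumr.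
rewrite [X in X <= _]exchange_big /= [X in _ <= _ * X](eq_bigr (fun x => \sum_j w x *
  (normsq ((adj (V x) *m likely_mx x) k j) / b j))); last by move=> x _; rewrite mulr_sumr.
rewrite [X in _ <= _ * X]exchange_big mulr_sumr /=; apply: ler_sum => j _.
under eq_bigr do rewrite mulrA.
under [X in _ <= _ * X]eq_bigr do rewrite mulrA.
rewrite -!mulr_suml mulrA ler_wpM2r ?invr_ge0 //.
pose f x := (adj (V x) *m likely_mx x) k j.
have E c : normsq (likely_dev c k j) =
    (#|J|%:R^-1 * (\sum_l re (f (c l))) - \sum_x w x * re (f x)) ^+ 2 +
    (#|J|%:R^-1 * (\sum_l im (f (c l))) - \sum_x w x * im (f x)) ^+ 2.
  rewrite /normsq /likely_dev !mxE !summxE reB imB reZ imZ !re_sum !im_sum.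
  congr ((_ - _) ^+ 2 + (_ - _) ^+ 2); apply: eq_bigr => x _; rewrite mxE ?reZ ?imZ //.
under eq_bigr do rewrite E mulrDr.
rewrite big_split /=; apply: le_trans (lerD (empirical_mean_variance w1 J0 _) (empirical_mean_variance w1 J0 _)) _.
rewrite -mulrDr -big_split /=; under eq_bigr do rewrite -mulrDr.
by [].
Qed.

End Resolvability.

(** * Tensor powers *)

Section PairedSums.
Variables (R : realType) (I A B : finType).

Lemma sum_ffun_pair (F : {ffun I -> A} -> {ffun I -> B} -> R) :
  \sum_f \sum_g F f g =
  \sum_(t : {ffun I -> A * B}) F [ffun i => (t i).1] [ffun i => (t i).2].
Proof.
rewrite pair_big /= (reindex (fun t : {ffun I -> A * B} =>
  ([ffun i => (t i).1], [ffun i => (t i).2]))) //=.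
exists (fun p : {ffun I -> A} * {ffun I -> B} => [ffun i => (p.1 i, p.2 i)]) => [t _|[f g] _].
  by apply/ffunP => i; rewrite !ffunE; case: (t i).
by congr pair; apply/ffunP => i; rewrite !ffunE.
Qed.

End PairedSums.

Fixpoint gtensI (K : pzRingType) d n : ('I_n -> 'M[K]_d) -> 'M[K]_(dpow d n) :=
  if n is n'.+1 return ('I_n -> 'M[K]_d) -> 'M[K]_(dpow d n)
  then fun f => f ord0 *t gtensI (fun i : 'I_n' => f (lift ord0 i))
  else fun _ => 1%:M.

(** Through one bijection between indices and words, entries of iterated tensor products become
    products, and finite product laws replace recursion on n. *)
Lemma gtensI_index (K : pzRingType) d n :
  exists phi : 'I_(dpow d n) -> {ffun 'I_n -> 'I_d}, bijective phi /\
    forall (f : 'I_n -> 'M[K]_d) i j, gtensI f i j = \prod_l f l (phi i l) (phi j l).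
Proof.
elim: n => [|n [phi [phi_bij phiE]]].
  have e0 : {ffun 'I_0 -> 'I_d} by exact: (ffun0 (card_ord 0)).
  exists (fun _ => e0); split.
    exists (fun _ => ord0) => [k|g]; first by apply/val_inj; rewrite /= ; case: k => [[]].
    by apply/ffunP => -[].
  by move=> f i j; rewrite big_ord0 !mxE !ord1 eqxx.
pose psi (k : 'I_(dpow d n.+1)) : {ffun 'I_n.+1 -> 'I_d} :=
  [ffun l => if unlift ord0 l is Some l' then phi (@mxtens_unindex d (dpow d n) k).2 l'
             else (@mxtens_unindex d (dpow d n) k).1].
have psi0 k : psi k ord0 = (@mxtens_unindex d (dpow d n) k).1 by rewrite ffunE unlift_none.
have psiS k l : psi k (lift ord0 l) = phi (@mxtens_unindex d (dpow d n) k).2 l.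
  by rewrite ffunE liftK.
case: phi_bij => phi' phiK phi'K.
exists psi; split.
  exists (fun g : {ffun 'I_n.+1 -> 'I_d} =>
      @mxtens_index d (dpow d n) (g ord0, phi' [ffun l => g (lift ord0 l)])) => [k|g].
    rewrite psi0; have -> : [ffun l => psi k (lift ord0 l)] = phi (@mxtens_unindex d (dpow d n) k).2.
      by apply/ffunP => l; rewrite ffunE psiS.
    by rewrite phiK -surjective_pairing mxtens_unindexK.
  apply/ffunP => l; case: (unliftP ord0 l) => [l' ->|->].
    by rewrite psiS mxtens_indexK phi'K ffunE.
  by rewrite psi0 mxtens_indexK.
move=> f i j; rewrite big_ord_recl /= mxE psi0 psi0 phiE; congr (_ * _).
by apply: eq_bigr => l _; rewrite !psiS.
Qed.

Section TensorStates.
Variables (R : realType) (C : complexModel R) (d n : nat).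
Local Notation emb := (@emb R C).
Local Notation re := (@re R C).
Local Notation D := (dpow d n).
Variable phi : 'I_D -> {ffun 'I_n -> 'I_d}.
Hypothesis phi_bij : bijective phi.
Hypothesis phiE : forall (f : 'I_n -> 'M[C]_d) i j,
  gtensI f i j = \prod_l f l (phi i l) (phi j l).
Local Notation tens := (@gtensI C d n).
Implicit Types (f g : 'I_n -> 'M[C]_d).

Lemma sum_phi (V : nmodType) (F : {ffun 'I_n -> 'I_d} -> V) :
  \sum_k F (phi k) = \sum_t F t.
Proof. by rewrite [RHS](reindex phi) //; exact: onW_bij. Qed.

Lemma eq_tens f g : (forall l, f l = g l) -> tens f = tens g.
Proof.
move=> e; apply/matrixP => i j; rewrite !phiE; apply: eq_bigr => l _.
by rewrite e.
Qed.

Lemma tensM f g : tens f *m tens g = tens (fun l => f l *m g l).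
Proof.
apply/matrixP => i j; rewrite mxE phiE.
under [LHS]eq_bigr do rewrite !phiE -big_split /=.
rewrite (sum_phi (fun t => \prod_l (f l (phi i l) (t l) * g l (t l) (phi j l)))).
rewrite -(bigA_distr_bigA (fun l x => f l (phi i l) x * g l x (phi j l))).
by apply: eq_bigr => l _; rewrite mxE.
Qed.

Lemma tens_adj f : adj (tens f) = tens (fun l => adj (f l)).
Proof.
apply/matrixP => i j; rewrite adjE !phiE rmorph_prod; apply: eq_bigr => l _.
by rewrite adjE.
Qed.

Lemma tens_rdiag (a : 'I_n -> 'I_d -> R) :
  tens (fun l => rdiag C (a l)) = rdiag C (fun k => \prod_l a l (phi k l)).
Proof.
apply/matrixP => i j; rewrite phiE !mxE; have [->|ij] := eqVneq i j.
  by rewrite mulr1n rmorph_prod; apply: eq_bigr => l _; rewrite !mxE eqxx mulr1n.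
have [l ne] : exists l, phi i l != phi j l.
  apply/existsP; apply: contra_neqT ij; rewrite negb_exists => /forallP h.
  by apply: (bij_inj phi_bij); apply/ffunP => l; have := h l; rewrite negbK => /eqP.
by rewrite (bigD1 l) //= !mxE (negPf ne) mulr0n mul0r.
Qed.

Lemma tens_unitary f : (forall l, f l \is unitarymx) -> tens f \is unitarymx.
Proof.
move=> uf; apply/unitarymxP; rewrite -/(adj (tens f)) tens_adj tensM.
have -> : 1%:M = rdiag C (fun _ : 'I_D => 1).
  by apply/matrixP => i j; rewrite !mxE rmorph1.
have -> : rdiag C (fun _ : 'I_D => 1) = rdiag C (fun k => \prod_(l < n) 1).
  by apply: eq_rdiag => k; rewrite big1.
rewrite -(tens_rdiag (fun _ _ => 1)); apply: eq_tens => l; rewrite unitary_adj //.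
by apply/matrixP => i j; rewrite !mxE rmorph1.
Qed.

Lemma tens_fmx (V : 'I_n -> 'M[C]_d) (a : 'I_n -> 'I_d -> R) :
  tens (fun l => fmx (V l) (a l)) = fmx (tens V) (fun k => \prod_l a l (phi k l)).
Proof. by rewrite /fmx tens_adj -tens_rdiag !tensM. Qed.

Lemma overlap_tens (V U : 'I_n -> 'M[C]_d) i j :
  overlap (tens V) (tens U) i j = \prod_l overlap (V l) (U l) (phi i l) (phi j l).
Proof.
rewrite /overlap tens_adj tensM phiE.
by apply: (big_morph _ (@normsqM R C)); rewrite -(rmorph1 emb) normsq_emb expr1n.
Qed.

Lemma tens_state f : (forall l, cstate (f l)) -> cstate (tens f).
Proof.
move=> sf.
have /choice[Va h] : forall l, exists Va : 'M[C]_d * ('I_d -> R),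
    [/\ Va.1 \is unitarymx, f l = fmx Va.1 Va.2, (forall i, 0 <= Va.2 i) & \sum_i Va.2 i = 1].
  by move=> l; have /cstateP[V [a ?]] := sf l; exists (V, a).
apply/cstateP; exists (tens (fun l => (Va l).1)), (fun k => \prod_l (Va l).2 (phi k l)); split.
- by apply: tens_unitary => l; case: (h l).
- by rewrite -(tens_fmx (fun l => (Va l).1) (fun l => (Va l).2)); apply: eq_tens => l; case: (h l).
- by move=> k; rewrite prodr_ge0 // => l _; case: (h l).
- rewrite (sum_phi (fun t => \prod_l (Va l).2 (t l))).
  by rewrite -(bigA_distr_bigA (fun l x => (Va l).2 x)) big1 // => l _; case: (h l).
Qed.

Lemma tens_expect (X : finType) (w : 'I_n -> X -> R) (r : X -> 'M[C]_d) :
  \sum_(x : {ffun 'I_n -> X}) emb (\prod_l w l (x l)) *: tens (fun l => r (x l)) =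
  tens (fun l => \sum_x emb (w l x) *: r x).
Proof.
apply/matrixP => i j; rewrite summxE phiE.
under [LHS]eq_bigr do rewrite mxE phiE rmorph_prod -big_split /=.
rewrite -(bigA_distr_bigA (fun l x => emb (w l x) * r x (phi i l) (phi j l))).
by apply: eq_bigr => l _; rewrite summxE; apply: eq_bigr => x _; rewrite mxE.
Qed.

Lemma ln_prod_abs (b : 'I_n -> R) c : 0 <= c -> (forall l, 0 <= b l) ->
  (forall l, `|ln (b l)| <= c) -> `|ln (\prod_l b l)| <= n%:R * c.
Proof.
move=> c0 b0 bc; case: (boolP [forall l, b l != 0]) => [/forallP h|]; last first.
  rewrite negb_forall => /existsP[l]; rewrite negbK => /eqP bl.
  by rewrite (bigD1 l) //= bl mul0r ln0 // normr0 mulr_ge0.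
have -> : ln (\prod_l b l) = \sum_l ln (b l).
  rewrite (eq_bigr (fun l => expR (ln (b l)))) => [|l _]; last first.
    by rewrite lnK // posrE lt_neqAle eq_sym h b0.
  by rewrite -expR_sum expRK.
apply: le_trans (ler_norm_sum _ _ _) _; rewrite mulr_natl -[X in _ *+ X]card_ord -sumr_const.
exact: ler_sum.
Qed.

Lemma ln_prod (I : finType) (b : I -> R) : (forall l, 0 < b l) ->
  ln (\prod_l b l) = \sum_l ln (b l).
Proof.
move=> b0; rewrite (eq_bigr (fun l => expR (ln (b l)))) => [|l _]; last by rewrite lnK ?posrE.
by rewrite -expR_sum expRK.
Qed.

(** Overlaps of tensor bases multiply, so the pair law is a product law, and the log-likelihood
    ratio is a sum on its support. *)
Lemma qrelent_tens (V U : 'I_n -> 'M[C]_d) (a b : 'I_n -> 'I_d -> R) :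
  (forall l, V l \is unitarymx) -> (forall l, U l \is unitarymx) ->
  (forall l i, 0 <= a l i) -> (forall l, \sum_i a l i = 1) -> (forall l i, 0 <= b l i) ->
  (forall l i j, b l j = 0 -> a l i * overlap (V l) (U l) i j = 0) ->
  cqrelent (tens (fun l => fmx (V l) (a l))) (tens (fun l => fmx (U l) (b l))) =
  \sum_l cqrelent (fmx (V l) (a l)) (fmx (U l) (b l)).
Proof.
move=> uV uU a0 a1 b0 h; rewrite !tens_fmx qrelent_fmx ?tens_unitary //.
under [RHS]eq_bigr do rewrite qrelent_fmx //.
pose c l (p : 'I_d * 'I_d) := a l p.1 * overlap (V l) (U l) p.1 p.2.
pose z l (p : 'I_d * 'I_d) := ln (a l p.1) - ln (b l p.2).
have c1 l : \sum_p c l p = 1.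
  rewrite -(pair_bigA _ (fun i j => a l i * overlap (V l) (U l) i j)) /= -(a1 l).
  by apply: eq_bigr => i _; rewrite -mulr_sumr overlap_sum_row ?mulr1.
have -> : \sum_l \sum_i \sum_j a l i * (ln (a l i) - ln (b l j)) * overlap (V l) (U l) i j =
    \sum_l \sum_p c l p * z l p.
  apply: eq_bigr => l _; rewrite pair_bigA; apply: eq_bigr => p _ /=.
  by rewrite /c /z mulrAC.
rewrite -(expect_sum c1 z).

pose F (s t : {ffun 'I_n -> 'I_d}) :=
  (\prod_l a l (s l)) * (ln (\prod_l a l (s l)) - ln (\prod_l b l (t l))) *
  \prod_l overlap (V l) (U l) (s l) (t l).
transitivity (\sum_s \sum_t F s t).
  rewrite -sum_phi; apply: eq_bigr => i _; rewrite -sum_phi.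
  by apply: eq_bigr => j _; rewrite overlap_tens.
rewrite sum_ffun_pair; apply: eq_bigr => t _; rewrite /F mulrAC -big_split /=.
have -> : \prod_i (a i ([ffun i0 => (t i0).1] i) *
    overlap (V i) (U i) ([ffun i0 => (t i0).1] i) ([ffun i0 => (t i0).2] i)) = \prod_l c l (t l).
  by apply: eq_bigr => l _; rewrite /c !ffunE.
(* Off the support the logarithm of a product need not split, but the weight is 0 there. *)
have [->|nz] := eqVneq (\prod_l c l (t l)) 0; first by rewrite !mul0r.
have {}nz l : c l (t l) != 0 by apply: contra_neqN nz => /eqP e; rewrite (bigD1 l) //= e mul0r.
congr (_ * _); rewrite /z sumrB; congr (_ - _).
  rewrite ln_prod => [|l]; first by apply: eq_bigr => l _; rewrite ffunE.
  rewrite ffunE lt_neqAle a0 andbT eq_sym; apply: contra_neqN (nz l) => /eqP e.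
  by rewrite /c e mul0r.
rewrite ln_prod => [|l]; first by apply: eq_bigr => l _; rewrite ffunE.
rewrite ffunE lt_neqAle b0 andbT eq_sym; apply: contra_neqN (nz l) => /eqP e.
by rewrite /c h.
Qed.

End TensorStates.

(** * Random coding *)

Section RandomCoding.
Variables (R : realType) (X : finType) (x0 : X) (p1 : X -> R) (n : nat) (al : 'I_n -> R).
Hypotheses (p10 : forall x, 0 <= p1 x) (p11 : \sum_x p1 x = 1).
Hypothesis al01 : forall l, 0 <= al l <= 1.
Local Notation A := (\sum_l al l).

Definition letter_law l x : R := (1 - al l) * (x == x0)%:R + al l * p1 x.
Definition word_law (x : {ffun 'I_n -> X}) : R := \prod_l letter_law l (x l).

Lemma sum_pred1 (f : X -> R) : \sum_x (x == x0)%:R * f x = f x0.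
Proof.
rewrite (bigD1 x0) //= eqxx mul1r big1 ?addr0 // => x /negPf ->.
by rewrite mul0r.
Qed.

Lemma sum_letter_law l (f : X -> R) :
  \sum_x letter_law l x * f x = (1 - al l) * f x0 + al l * \sum_x p1 x * f x.
Proof.
under eq_bigr do rewrite mulrDl -!mulrA.
by rewrite big_split /= -!mulr_sumr sum_pred1.
Qed.

Lemma letter_law_ge0 l x : 0 <= letter_law l x.
Proof. by have /andP[? ?] := al01 l; rewrite addr_ge0 // mulr_ge0 // subr_ge0. Qed.

Lemma letter_law_sum l : \sum_x letter_law l x = 1.
Proof.
have := sum_letter_law l (fun=> 1); under eq_bigr do rewrite mulr1.
by move=> ->; under eq_bigr do rewrite mulr1; rewrite p11; ring.
Qed.

Lemma word_law_ge0 x : 0 <= word_law x.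
Proof. by rewrite prodr_ge0 // => l _; exact: letter_law_ge0. Qed.

Lemma word_law_sum : \sum_x word_law x = 1.
Proof. by rewrite expect_one //; exact: letter_law_sum. Qed.

Section Tail.
Variables (S : finType) (q : X -> S -> R) (z : X -> S -> R).
Hypotheses (q0 : forall x s, 0 <= q x s) (q1 : forall x, \sum_s q x s = 1).
Hypothesis z0 : forall s, q x0 s != 0 -> z x0 s = 0.
Variable E : {ffun 'I_n -> X} -> {ffun 'I_n -> S} -> bool.
Variable d : R.
Hypothesis d01 : 0 <= d <= 1.
Local Notation mean := (\sum_x p1 x * \sum_s q x s * z x s).
Hypothesis tailE : forall (x : {ffun _ -> X}) (s : {ffun _ -> S}), (forall l, q (x l) (s l) != 0) -> E x s ->
  A * (mean + d) <= \sum_l z (x l) (s l).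

Definition pair_tail_const :=
  tail_const (fun t : X * S => p1 t.1 * q t.1 t.2) (fun t => z t.1 t.2).

(** Letter and output at position l jointly follow a mixture with weight [al l], so [chernoff_tail]
    applies to the pairs. Bob's missed detections and Willie's unlikely eigenvector pairs are both
    instances. *)
Lemma word_tail :
  \sum_x word_law x * (\sum_(s : {ffun 'I_n -> S}) (\prod_l q (x l) (s l)) * (E x s)%:R) <=
  expR (- (A * d ^+ 2 / (4 * (pair_tail_const + 1)))).
Proof.
pose c0 (t : X * S) := (t.1 == x0)%:R * q t.1 t.2.
pose c1 (t : X * S) := p1 t.1 * q t.1 t.2.
pose zz (t : X * S) := z t.1 t.2.
have c00 t : 0 <= c0 t by rewrite mulr_ge0.
have c10 t : 0 <= c1 t by rewrite mulr_ge0.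
have c01 : \sum_t c0 t = 1.
  rewrite -(pair_bigA _ (fun x s => (x == x0)%:R * q x s)) /=.
  by under eq_bigr do rewrite -mulr_sumr; rewrite sum_pred1.
have c11 : \sum_t c1 t = 1.
  rewrite -(pair_bigA _ (fun x s => p1 x * q x s)) /= -p11.
  by apply: eq_bigr => x _; rewrite -mulr_sumr q1 mulr1.
have zz0 t : c0 t != 0 -> zz t = 0.
  by rewrite /c0 /zz; case: (eqVneq t.1 x0) => [e|_]; rewrite ?mul0r ?eqxx // mul1r e => /z0.
have meanE : \sum_t c1 t * zz t = mean.
  rewrite -(pair_bigA _ (fun x s => p1 x * q x s * z x s)) /=.
  by apply: eq_bigr => x _; rewrite mulr_sumr; apply: eq_bigr => s _; rewrite mulrA.
apply: le_trans (chernoff_tail c00 c10 c01 c11 al01 zz0 d01).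
under eq_bigr do rewrite mulr_sumr.
rewrite sum_ffun_pair; apply: ler_sum => t _; rewrite mulrA /word_law -big_split /=.
have -> : \prod_i (letter_law i ([ffun i0 => (t i0).1] i) *
    q ([ffun i0 => (t i0).1] i) ([ffun i0 => (t i0).2] i)) =
    \prod_i ((1 - al i) * c0 (t i) + al i * c1 (t i)).
  by apply: eq_bigr => l _; rewrite !ffunE /letter_law /c0 /c1; ring.
set w := \prod_i _; have w0 : 0 <= w.
  rewrite prodr_ge0 // => l _; have /andP[? ?] := al01 l.
  by rewrite addr_ge0 // mulr_ge0 // subr_ge0.
have [w_0|wn0] := eqVneq w 0; first by rewrite !w_0 !mul0r.
apply: ler_wpM2l => //; rewrite meanE ler_nat; case: (boolP (E _ _)) => // e.
rewrite lt0b; apply: le_trans (tailE _ e) _ => [l|]; last first.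
  by apply: ler_sum => l _; rewrite !ffunE.
rewrite !ffunE; apply: contra_neqN wn0 => /eqP ql.
by rewrite /w (bigD1 l) //= /c0 /c1 ql !mulr0 addr0 mul0r.
Qed.

End Tail.

(** * Bob's threshold decoder *)

Section Bob.
Variables (Y : finType) (P : X -> Y -> R) (d : R).
Hypotheses (P0 : forall x y, 0 <= P x y) (P1 : forall x, \sum_y P x y = 1).
Hypothesis Pdom : forall x y, P x0 y = 0 -> P x y = 0.
Hypothesis d01 : 0 <= d <= 1.
Local Notation I_B := (\sum_x p1 x * crelent (P x) (P x0)).
Local Notation PP x y := (\prod_l P (x l) (y l)).
Local Notation PP0 y := (\prod_l P x0 (y l)).
Local Notation G := (expR (A * (I_B - d))).

(** Likelihood-ratio test against the all-innocent output law: on the support, only non-innocent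
    positions contribute to the ratio. *)
Definition accept (x : {ffun 'I_n -> X}) (y : {ffun 'I_n -> Y}) := G * PP0 y < PP x y.
Definition bob_tail_const :=
  pair_tail_const P (fun x y => - ln (P x y / P x0 y)).
Definition bob_chi := \sum_y (\sum_x p1 x * P x y) ^+ 2 / P x0 y.

(** A lower tail of the log-likelihood ratio, hence [word_tail] with the ratio negated. *)
Lemma miss_le :
  \sum_(x : {ffun 'I_n -> X}) word_law x * (\sum_(y : {ffun 'I_n -> Y}) PP x y * (~~ accept x y)%:R) <=
  expR (- (A * d ^+ 2 / (4 * (bob_tail_const + 1)))).
Proof.
apply: word_tail => //.
  move=> y Py; rewrite divff // ln1 oppr0 //.
move=> x y nz; rewrite /accept -leNgt => h.
have Ppos l : 0 < P (x l) (y l) by rewrite lt_neqAle eq_sym nz P0.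
have P0pos l : 0 < P x0 (y l).
  by rewrite lt_neqAle eq_sym P0 andbT; apply: contra_neqN (nz l) => /eqP/Pdom ->.
have meanE : \sum_x1 p1 x1 * (\sum_s P x1 s * - ln (P x1 s / P x0 s)) = - I_B.
  rewrite -sumrN; apply: eq_bigr => x1 _; rewrite /crelent -mulrN -sumrN.
  by congr (_ * _); apply: eq_bigr => s _; rewrite mulrN.
rewrite meanE sumrN -[A * _]opprK lerN2 -mulrN opprD opprK.
under eq_bigr do rewrite ln_div ?posrE //.
rewrite sumrB -!ln_prod // -ler_expR expRB !lnK ?posrE ?prodr_gt0 //.
by rewrite ler_pdivrMr ?prodr_gt0.
Qed.

(** The outputs follow the averaged law Pb while the test compares with P_0. Acceptance gives PP0 <
    PP x / G, so the probability is at most the sum of Pb^2 / P_0 over G. That sum factorises, each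
    factor being 1 + O(al^2), since the terms linear in al cancel. *)
Lemma false_alarm_le :
  \sum_(y : {ffun 'I_n -> Y}) (\sum_(x : {ffun 'I_n -> X}) word_law x * PP x y) * (\sum_(x : {ffun 'I_n -> X}) word_law x * (accept x y)%:R) <=
  expR (- (A * (I_B - d))) * expR (bob_chi * \sum_l al l ^+ 2).
Proof.
pose Pb l v := \sum_x letter_law l x * P x v.
have PbE y : \sum_(x : {ffun 'I_n -> X}) word_law x * PP x y = \prod_l Pb l (y l).
  rewrite bigA_distr_bigA; apply: eq_bigr => x _.
  by rewrite /word_law -big_split.
have Pb0 l v : 0 <= Pb l v by rewrite sumr_ge0 // => x _; rewrite mulr_ge0 ?letter_law_ge0.
have PbE' l v : Pb l v = (1 - al l) * P x0 v + al l * \sum_x p1 x * P x v.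
  exact: sum_letter_law.
apply: (@le_trans _ _ (\sum_(y : {ffun 'I_n -> Y}) G^-1 * \prod_l (Pb l (y l) ^+ 2 / P x0 (y l)))).
  apply: ler_sum => y _; rewrite PbE.
  have [e|/negP] := boolP [exists l, P x0 (y l) == 0].
    case/existsP: e => l /eqP e; have -> : \prod_l Pb l (y l) = 0.
      rewrite (bigD1 l) //= PbE' e mulr0 big1 ?mulr0 ?addr0 ?mul0r // => x _.
      by rewrite Pdom // mulr0.
    rewrite mul0r mulr_ge0 ?invr_ge0 ?expR_ge0 // prodr_ge0 // => k _.
    by rewrite divr_ge0 ?sqr_ge0.
  move=> ne; have P0pos l : 0 < P x0 (y l).
    by rewrite lt_neqAle eq_sym P0 andbT; apply/negP => e; apply: ne; apply/existsP; exists l.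
  have PP0pos : 0 < PP0 y by rewrite prodr_gt0.
  have -> : G^-1 * \prod_l (Pb l (y l) ^+ 2 / P x0 (y l)) =
      \prod_l Pb l (y l) * (\prod_l Pb l (y l) / (G * PP0 y)).
    rewrite prodf_div prodrXl; field; rewrite !gt_eqF ?expR_gt0 //.
  rewrite ler_wpM2l ?prodr_ge0 // ler_pdivlMr ?mulr_gt0 ?expR_gt0 // mulr_suml -PbE.
  apply: ler_sum => x _; rewrite -mulrA; apply: ler_wpM2l; first exact: word_law_ge0.
  rewrite /accept; case: ltP => h; first by rewrite mul1r ltW.
  by rewrite mul0r prodr_ge0.
rewrite -mulr_sumr expRN; apply: ler_wpM2l; first by rewrite invr_ge0 expR_ge0.
rewrite -(bigA_distr_bigA (fun l v => Pb l v ^+ 2 / P x0 v)) mulr_sumr expR_sum.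
apply: ler_prod => l _; apply/andP; split.
  by rewrite sumr_ge0 // => v _; rewrite divr_ge0 ?sqr_ge0.
apply: le_trans (expR_ge1Dx _).
have [a0 a1] := andP (al01 l).
set P' := fun v => \sum_x p1 x * P x v.
have P'1 : \sum_v P' v = 1.
  by rewrite exchange_big /= -p11; apply: eq_bigr => x _; rewrite -mulr_sumr P1 mulr1.
have -> : \sum_v Pb l v ^+ 2 / P x0 v = \sum_v ((1 - al l) ^+ 2 * P x0 v +
   2 * al l * (1 - al l) * P' v + al l ^+ 2 * (P' v ^+ 2 / P x0 v)).
  apply: eq_bigr => v _; rewrite PbE' -/(P' v); have [e|e] := eqVneq (P x0 v) 0.
    have -> : P' v = 0 by rewrite /P' big1 // => x _; rewrite Pdom // mulr0.
    by rewrite e invr0 !mulr0 !addr0.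
  by field.
rewrite !big_split /= -!mulr_sumr P1 P'1 -/bob_chi.
by have := sqr_ge0 (al l); nra.
Qed.

Section Code.
Variables (M K : nat).
Hypotheses (M0 : (0 < M)%N) (K0 : (0 < K)%N).
Local Notation J := ('I_M * 'I_K)%type.
Implicit Types c : {ffun J -> {ffun 'I_n -> X}}.

(** Any accepted message may be picked: an error means that the true codeword was rejected or
    another one accepted. Message 0 is the default when none is accepted. *)
Definition threshold_dec c y k : 'I_M :=
  odflt (Ordinal M0) [pick m | accept (c (m, k)) y].

Definition bob_error c : R := (M * K)%:R^-1 *
  \sum_(m < M) \sum_(k < K) \sum_(y : {ffun 'I_n -> Y}) PP (c (m, k)) y * (threshold_dec c y k != m)%:R.

Lemma threshold_dec_error c y k m : (threshold_dec c y k != m)%:R <=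
  (~~ accept (c (m, k)) y)%:R + \sum_(m' | m' != m) (accept (c (m', k)) y)%:R :> R.
Proof.
rewrite /threshold_dec; case: pickP => [m' /= h|h] /=; last first.
  by rewrite h /=; apply: (@le_trans _ _ 1); [rewrite lern1 leq_b1|rewrite lerDl sumr_ge0].
case: (eqVneq m' m) => [_|ne] /=; first by rewrite addr_ge0 ?sumr_ge0.
rewrite (bigD1 m') //= h addrCA lerDl addr_ge0 // sumr_ge0 //.
Qed.

Lemma bob_error_ge0 c : 0 <= bob_error c.
Proof.
rewrite mulr_ge0 ?invr_ge0 // !sumr_ge0 // => m _; rewrite sumr_ge0 // => k _.
by rewrite sumr_ge0 // => y _; rewrite mulr_ge0 // prodr_ge0.
Qed.

(** Union bound over the other M - 1 messages. Codewords of distinct messages under the same key are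
    independent, which factors each false-alarm probability. *)
Lemma expect_bob_error :
  \sum_(c : {ffun J -> {ffun 'I_n -> X}}) (\prod_j word_law (c j)) * bob_error c <=
  expR (- (A * d ^+ 2 / (4 * (bob_tail_const + 1)))) +
  M.-1%:R * (expR (- (A * (I_B - d))) * expR (bob_chi * \sum_l al l ^+ 2)).
Proof.
set miss := expR _; set fa := _ * expR _.
have w1 := word_law_sum.
pose Ex (F : {ffun J -> {ffun 'I_n -> X}} -> R) :=
  \sum_(c : {ffun J -> {ffun 'I_n -> X}}) (\prod_j word_law (c j)) * F c.
have W0 (c : {ffun J -> {ffun 'I_n -> X}}) : 0 <= \prod_j word_law (c j).
  by rewrite prodr_ge0 // => j _; exact: word_law_ge0.
have Ex1 m k : Ex (fun c => \sum_(y : {ffun 'I_n -> Y}) PP (c (m, k)) y * (~~ accept (c (m, k)) y)%:R) <= miss.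
  rewrite /Ex (@expect_coord _ J _ (fun=> word_law) (fun=> w1) (m, k)
    (fun x => \sum_(y : {ffun 'I_n -> Y}) PP x y * (~~ accept x y)%:R)).
  exact: miss_le.
have Ex2 m m' k : m' != m ->
    Ex (fun c => \sum_(y : {ffun 'I_n -> Y}) PP (c (m, k)) y * (accept (c (m', k)) y)%:R) <= fa.
  move=> ne; apply: le_trans false_alarm_le.
  rewrite /Ex; under eq_bigr do rewrite mulr_sumr.
  rewrite exchange_big /=; apply: ler_sum => y _.
  rewrite (@expect_coord2 _ J _ (fun=> word_law) (fun=> w1) (m, k) (m', k)
    (fun x => PP x y) (fun x => (accept x y)%:R)) //.
  by apply: contra ne => /eqP[->].
have Ex3 m k : Ex (fun c => \sum_(y : {ffun 'I_n -> Y}) PP (c (m, k)) y * (threshold_dec c y k != m)%:R) <=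
    miss + M.-1%:R * fa.
  apply: (@le_trans _ _ (Ex (fun c => \sum_(y : {ffun 'I_n -> Y}) PP (c (m, k)) y * (~~ accept (c (m, k)) y)%:R) +
      \sum_(m' | m' != m) Ex (fun c => \sum_(y : {ffun 'I_n -> Y}) PP (c (m, k)) y * (accept (c (m', k)) y)%:R))).
    rewrite /Ex [X in _ <= _ + X]exchange_big -big_split /=; apply: ler_sum => c _.
    rewrite -mulr_sumr -mulrDr; apply: ler_wpM2l => //.
    rewrite [X in _ <= _ + X]exchange_big -big_split /=; apply: ler_sum => y _.
    rewrite -mulr_sumr -mulrDr; apply: ler_wpM2l; first by rewrite prodr_ge0.
    exact: threshold_dec_error.
  apply: lerD; first exact: Ex1.
  apply: (@le_trans _ _ (\sum_(m' | m' != m) fa)).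
    by apply: ler_sum => m' ne; exact: Ex2.
  by rewrite sumr_const cardC1 card_ord mulr_natl.
have MK : (M * K)%:R != 0 :> R by rewrite pnatr_eq0 muln_eq0 negb_or -!lt0n M0.
have -> : \sum_(c : {ffun J -> {ffun 'I_n -> X}}) (\prod_j word_law (c j)) * bob_error c =
    (M * K)%:R^-1 * \sum_m \sum_k
      Ex (fun c => \sum_(y : {ffun 'I_n -> Y}) PP (c (m, k)) y * (threshold_dec c y k != m)%:R).
  rewrite /Ex; under [in RHS]eq_bigr do rewrite exchange_big /=.
  rewrite [in RHS]exchange_big mulr_sumr /=; apply: eq_bigr => c _.
  rewrite /bob_error mulrCA; congr (_ * _); rewrite mulr_sumr.
  by apply: eq_bigr => m _; rewrite mulr_sumr.
apply: (@le_trans _ _ ((M * K)%:R^-1 * \sum_(m < M) \sum_(k < K) (miss + M.-1%:R * fa))).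
  rewrite ler_wpM2l ?invr_ge0 //; apply: ler_sum => m _; apply: ler_sum => k _.
  exact: Ex3.
by rewrite !sumr_const !card_ord -mulrnA mulnC -[X in _ * X]mulr_natl mulrA mulVf ?mul1r // mulnC.
Qed.

End Code.
End Bob.
End RandomCoding.

(** * Codes of finite length *)

Section Continuity.
Variables (R : realType) (C : complexModel R) (n : nat).
Local Notation re := (@re R C).

Lemma trnorm_le_opp (A B : 'M[C]_n) (eta : R) : trnorm_le (A - B) eta -> trnorm_le (B - A) eta.
Proof. by move=> /trnorm_leN; rewrite opprB. Qed.

Lemma re_mxtrace_mulBl (A B D : 'M[C]_n) :
  re (\tr ((A - B) *m D)) = re (\tr (A *m D)) - re (\tr (B *m D)).
Proof. by rewrite mulmxBl raddfB reB. Qed.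

(** The entropies are compared by [ent_le] in both directions; the remaining term is linear in the
    state, with an observable of norm at most be. *)
Lemma qrelent_continuity (A B : 'M[C]_n) (U : 'M[C]_n) (b : 'I_n -> R) (e be eta : R) :
  cstate A -> cstate B -> U \is unitarymx -> 0 < e <= 1 -> 0 < be ->
  (forall j, `|ln (b j)| <= be) -> trnorm_le (A - B) eta ->
  `|cqrelent A (fmx U b) - cqrelent B (fmx U b)| <= e * n%:R + (2 - ln e + be) * eta.
Proof.
move=> sA sB uU e01 be0 hbe tn; have tn' := trnorm_le_opp tn.
have /cstateP[V [a [uV AE a0 a1]]] := sA.
have /cstateP[V' [a' [uV' BE a0' a1']]] := sB.
have lin : cqrelent A (fmx U b) - cqrelent B (fmx U b) =
    ent a - ent a' - re (\tr ((A - B) *m fmx U (@ln R \o b))).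
  rewrite re_mxtrace_mulBl AE BE !qrelent_ent // mxfun_fmx //; ring.
have h1 := trnorm_le_scale be0 tn uU hbe.
have h2 := trnorm_le_scale be0 tn' uU hbe.
have h2' : re (\tr ((B - A) *m fmx U (@ln R \o b))) = - re (\tr ((A - B) *m fmx U (@ln R \o b))).
  by rewrite -opprB mulNmx raddfN /= reN.
have E1 : ent a <= ent a' + e * n%:R + (2 - ln e) * eta.
  apply: (ent_le uV uV') => //; last by rewrite -AE -BE.
  by move=> i; rewrite a0 (cstate_le1 a0).
have E2 : ent a' <= ent a + e * n%:R + (2 - ln e) * eta.
  apply: (ent_le uV' uV) => //; last by rewrite -AE -BE.
  by move=> i; rewrite a0' (cstate_le1 a0').
rewrite h2' in h2; rewrite lin ler_norml; apply/andP; split; lra.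
Qed.

End Continuity.

Lemma dpowE d n : dpow d n = (d ^ n)%N.
Proof. by elim: n => //= n ->; rewrite expnS. Qed.

Lemma wsum_div2 (R : fieldType) (I : finType) (w f g : I -> R) x y :
  \sum_i w i * (f i / x + g i / y) = (\sum_i w i * f i) / x + (\sum_i w i * g i) / y.
Proof.
by rewrite !mulr_suml -big_split; apply: eq_bigr => i _; rewrite mulrDr !mulrA.
Qed.

Section CovertCode.
Variables (R : realType) (C : complexModel R) (d : nat).
Local Notation emb := (@emb R C).
Local Notation re := (@re R C).
Variables (X : finType) (x0 : X) (rho : X -> 'M[C]_d) (V : X -> 'M[C]_d) (a : X -> 'I_d -> R).
Hypotheses (uV : forall x, V x \is unitarymx) (rhoE : forall x, rho x = fmx (V x) (a x)).
Hypotheses (a0 : forall x i, 0 <= a x i) (a1 : forall x, \sum_i a x i = 1).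
Hypothesis dom : forall x, exists D, rho x = rho x0 *m D.
Variable p1 : X -> R.
Hypotheses (p10 : forall x, 0 <= p1 x) (p11 : \sum_x p1 x = 1).
Local Notation U := (V x0).
Local Notation b := (a x0).
Definition rho1 := \sum_x emb (p1 x) *: rho x.

Definition pair_law x (t : 'I_d * 'I_d) := a x t.1 * overlap (V x) U t.1 t.2.
Definition pair_llr x (t : 'I_d * 'I_d) := ln (a x t.1) - ln (b t.2).
Definition willie_tail_const := pair_tail_const p1 pair_law pair_llr.
Local Notation I_W := (\sum_x p1 x * cqrelent (rho x) (rho x0)).

Lemma rho_state x : cstate (rho x).
Proof. by apply/cstateP; exists (V x), (a x). Qed.

Lemma rho1_state : cstate rho1.
Proof. by apply: cstate_convex => // x; exact: rho_state. Qed.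

Lemma rho1_dominated : exists D, rho1 = rho x0 *m D.
Proof.
have /choice[D DE] := dom.
exists (\sum_x emb (p1 x) *: D x); rewrite /rho1 mulmx_sumr; apply: eq_bigr => x _.
by rewrite -scalemxAr -DE.
Qed.

Lemma rho_overlap x i j : b j = 0 -> a x i * overlap (V x) U i j = 0.
Proof.
move=> bj; have [D DE] := dom x.
by apply: (@dominated_overlap _ _ _ (V x) U (a x) b D i j) => //; rewrite -!rhoE.
Qed.

Lemma pair_law_ge0 x t : 0 <= pair_law x t.
Proof. by rewrite mulr_ge0 ?overlap_ge0. Qed.

Lemma pair_law_sum x : \sum_t pair_law x t = 1.
Proof.
rewrite -(pair_bigA _ (fun i j => a x i * overlap (V x) U i j)) /= -(a1 x).
by apply: eq_bigr => i _; rewrite -mulr_sumr overlap_sum_row ?mulr1.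
Qed.

Lemma pair_llr_mean x : \sum_t pair_law x t * pair_llr x t = cqrelent (rho x) (rho x0).
Proof.
rewrite !rhoE qrelent_fmx // pair_bigA; apply: eq_bigr => t _ /=.
by rewrite /pair_law /pair_llr mulrAC.
Qed.

Lemma pair_law_pos x t : pair_law x t != 0 -> 0 < a x t.1 /\ 0 < b t.2.
Proof.
move=> h; split; rewrite lt_neqAle a0 andbT eq_sym; apply: contra_neqN h => /eqP e.
  by rewrite /pair_law e mul0r.
by rewrite /pair_law rho_overlap.
Qed.

Lemma pair_llr0 t : pair_law x0 t != 0 -> pair_llr x0 t = 0.
Proof.
rewrite /pair_law /pair_llr overlap_id //; case: (eqVneq t.1 t.2) => [->|_]; first by rewrite subrr.
by rewrite mulr0 eqxx.
Qed.

Section BlockLength.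
Variables (n : nat) (al : 'I_n -> R) (dl : R).
Hypotheses (al01 : forall l, 0 <= al l <= 1) (dl01 : 0 <= dl <= 1).
Local Notation A := (\sum_l al l).
Local Notation D := (dpow d n).
Local Notation G := (expR (A * (I_W + dl))).
Variable phi : 'I_D -> {ffun 'I_n -> 'I_d}.
Hypothesis phi_bij : bijective phi.
Hypothesis phiE : forall (f : 'I_n -> 'M[C]_d) i j,
  gtensI f i j = \prod_l f l (phi i l) (phi j l).
Local Notation word := {ffun 'I_n -> X}.
Local Notation wordV x := (gtensI (fun l => V (x l))).
Local Notation worda x := (fun k => \prod_l a (x l) (phi k l)).
Local Notation rhow x := (gtensI (fun l => rho (x l))).
Local Notation blockU := (gtensI (fun _ : 'I_n => U)).
Local Notation blockb := (fun k => \prod_l b (phi k l)).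
Local Notation rho0n := (gtensI (fun _ : 'I_n => rho x0)).
Local Notation word_law := (word_law x0 p1 al).

Lemma rhowE (x : word) : rhow x = fmx (wordV x) (worda x).
Proof.
rewrite -(tens_fmx phi_bij phiE (fun l => V (x l)) (fun l => a (x l))).
by apply: (eq_tens phiE) => l; rewrite rhoE.
Qed.

Lemma rho0nE : rho0n = fmx blockU blockb.
Proof.
rewrite -(tens_fmx phi_bij phiE (fun _ => U) (fun _ => b)).
by apply: (eq_tens phiE) => l; rewrite rhoE.
Qed.

Lemma wordV_unitary (x : word) : wordV x \is unitarymx.
Proof. exact: (tens_unitary phi_bij phiE). Qed.

Lemma blockU_unitary : blockU \is unitarymx.
Proof. exact: (tens_unitary phi_bij phiE). Qed.

Lemma worda_ge0 (x : word) k : 0 <= \prod_l a (x l) (phi k l).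
Proof. by rewrite prodr_ge0. Qed.

Lemma worda_sum (x : word) : \sum_k \prod_l a (x l) (phi k l) = 1.
Proof.
rewrite (sum_phi phi_bij (fun t : {ffun 'I_n -> 'I_d} => \prod_l a (x l) (t l))).
by rewrite -(bigA_distr_bigA (fun l i => a (x l) i)) big1.
Qed.

Lemma blockb_ge0 k : 0 <= \prod_l b (phi k l).
Proof. by rewrite prodr_ge0. Qed.

Lemma blockb_sum : \sum_k \prod_l b (phi k l) = 1.
Proof.
rewrite (sum_phi phi_bij (fun t : {ffun 'I_n -> 'I_d} => \prod_l b (t l))).
by rewrite -(bigA_distr_bigA (fun l i => b i)) big1.
Qed.

Local Notation um := (unlikely_mass (fun x : word => wordV x) (fun x : word => worda x) blockU blockb G).

Lemma expect_unlikely_mass :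
  \sum_x word_law x * um x <= expR (- (A * dl ^+ 2 / (4 * (willie_tail_const + 1)))).
Proof.
pose E (x : word) (s : {ffun 'I_n -> 'I_d * 'I_d}) :=
  ~~ (\prod_l a (x l) (s l).1 <= G * \prod_l b (s l).2).
have -> : \sum_x word_law x * um x = \sum_(x : word) word_law x *
    (\sum_(s : {ffun 'I_n -> 'I_d * 'I_d}) (\prod_l pair_law (x l) (s l)) * (E x s)%:R).
  apply: eq_bigr => x _; congr (_ * _).
  pose F (s t : {ffun 'I_n -> 'I_d}) := (~~ (\prod_l a (x l) (s l) <= G * \prod_l b (t l)))%:R *
    ((\prod_l a (x l) (s l)) * \prod_l overlap (V (x l)) U (s l) (t l)) : R.
  transitivity (\sum_s \sum_t F s t).
    rewrite /unlikely_mass -(sum_phi phi_bij); apply: eq_bigr => i _.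
    rewrite -(sum_phi phi_bij); apply: eq_bigr => j _.
    by rewrite /F -(overlap_tens phi_bij phiE (fun l => V (x l)) (fun=> U)).
  rewrite sum_ffun_pair; apply: eq_bigr => t _; rewrite /F mulrC; congr (_ * _).
    by rewrite -big_split; apply: eq_bigr => l _ /=; rewrite !ffunE.
  rewrite /E; congr ((~~ (_ <= _ * _))%:R).
    by apply: eq_bigr => l _; rewrite ffunE.
  by apply: eq_bigr => l _; rewrite ffunE.
apply: word_tail => //; [exact: pair_law_ge0|exact: pair_law_sum|exact: pair_llr0|].
move=> x s nz; rewrite /E -ltNge => h.
rewrite [in X in X <= _](eq_bigr _ (fun x _ => congr1 (GRing.mul (p1 x)) (pair_llr_mean x))).
have ap l : 0 < a (x l) (s l).1 by case: (pair_law_pos (nz l)).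
have bp l : 0 < b (s l).2 by case: (pair_law_pos (nz l)).
rewrite /pair_llr sumrB -!ln_prod // -ler_expR expRB !lnK ?posrE ?prodr_gt0 //.
by rewrite ler_pdivlMr ?prodr_gt0 // ltW.
Qed.

Lemma mixture_letter l : \sum_x emb (letter_law x0 p1 al l x) *: rho x =
  mixture (rho x0) rho1 (al l).
Proof.
rewrite mixtureE /rho1 scaler_sumr.
transitivity (\sum_x (emb ((1 - al l) * (x == x0)%:R) *: rho x + emb (al l) *: (emb (p1 x) *: rho x))).
  by apply: eq_bigr => x _; rewrite /letter_law rmorphD scalerDl scalerA -rmorphM.
rewrite big_split /=; congr (_ + _); rewrite (bigD1 x0) //= eqxx mulr1.
by rewrite big1 ?addr0 // => x /negPf ->; rewrite mulr0 rmorph0 scale0r.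
Qed.

Local Notation mix l := (mixture (rho x0) rho1 (al l)).

Lemma mix_state l : cstate (mix l).
Proof.
have [D DE] := rho1_dominated.
by apply: mixture_state => //; [exact: rho_state|exact: rho1_state].
Qed.

Lemma mean_word : \sum_x emb (word_law x) *: rhow x = gtensI (fun l => mix l).
Proof.
rewrite (tens_expect phiE (fun l x => letter_law x0 p1 al l x) rho).
by apply: (eq_tens phiE) => l; rewrite mixture_letter.
Qed.

Lemma qrelent_mean : cqrelent (gtensI (fun l => mix l)) rho0n =
  \sum_l cqrelent (mix l) (rho x0).
Proof.
have /choice[Va h] : forall l, exists Va : 'M[C]_d * ('I_d -> R),
    [/\ Va.1 \is unitarymx, mix l = fmx Va.1 Va.2, (forall i, 0 <= Va.2 i) & \sum_i Va.2 i = 1].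
  by move=> l; have /cstateP[W [w ?]] := mix_state l; exists (W, w).
have -> : gtensI (fun l => mix l) = gtensI (fun l => fmx (Va l).1 (Va l).2).
  by apply: (eq_tens phiE) => l; case: (h l).
have -> : rho0n = gtensI (fun _ => fmx U b).
  by apply: (eq_tens phiE) => l; rewrite rhoE.
rewrite (qrelent_tens phi_bij phiE (U := fun=> U) (b := fun=> b)) //; try by move=> l; case: (h l).
  by apply: eq_bigr => l _; case: (h l) => _ <- _ _; rewrite rhoE.
move=> l i j bj; have [D1 D1E] := rho1_dominated.
have [D2 D2E] := mixture_dominated D1E (al l).
have [uW mE _ _] := h l.
by apply: (@dominated_overlap _ _ _ (Va l).1 U (Va l).2 b D2) => //; rewrite -mE -rhoE.
Qed.

Definition log_bound : R := 1 + \sum_j `|ln (b j)|.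

(** The summand 1 keeps the bound positive at n = 0 too, as rescaling the observable requires. *)
Lemma log_blockb k : `|ln (\prod_l b (phi k l))| <= n%:R * log_bound + 1.
Proof.
apply: (@le_trans _ _ (n%:R * log_bound)); last by rewrite lerDl.
apply: ln_prod_abs => //; first by rewrite addr_ge0 ?sumr_ge0.
move=> l; rewrite /log_bound (bigD1 (phi k l)) //= addrCA lerDl addr_ge0 // sumr_ge0 //.
Qed.

Variables (Y : finType) (P : X -> Y -> R).
Hypotheses (P0 : forall x y, 0 <= P x y) (P1 : forall x, \sum_y P x y = 1).
Hypothesis Pdom : forall x y, P x0 y = 0 -> P x y = 0.
Local Notation I_B := (\sum_x p1 x * crelent (P x) (P x0)).
Variables (M K : nat) (t : R).
Hypotheses (M0 : (0 < M)%N) (K0 : (0 < K)%N) (t01 : 0 < t <= 1) (d0 : (0 < d)%N).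

Definition bob_bound : R :=
  expR (- (A * dl ^+ 2 / (4 * (bob_tail_const x0 p1 P + 1)))) +
  M.-1%:R * (expR (- (A * (I_B - dl))) * expR (bob_chi x0 p1 P * \sum_l al l ^+ 2)).

Definition willie_defect : R :=
  2 * expR (- (A * dl ^+ 2 / (4 * (willie_tail_const + 1)))) + G / (M * K)%:R.

Definition willie_bound : R :=
  t + (2 - ln t + n%:R * ln d%:R + (n%:R * log_bound + 1)) * (3 * t / 2 + willie_defect / t).

Lemma dpow_exp : (dpow d n)%:R = expR (n%:R * ln d%:R) :> R.
Proof.
by rewrite mulrC expRM_natr lnK ?posrE ?ltr0n // -natrX dpowE.
Qed.

Lemma covert_code : exists c : {ffun 'I_M * 'I_K -> {ffun 'I_n -> X}},
  bob_error x0 p1 al P dl M0 c <= 2 * bob_bound /\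
  `|cqrelent (emb (M * K)%:R^-1 *: \sum_(m < M) \sum_(k < K) rhow (c (m, k))) rho0n -
    \sum_l cqrelent (mix l) (rho x0)| <= willie_bound.
Proof.
have bb0 : 0 < bob_bound by rewrite ltr_wpDr ?mulr_ge0 ?expR_ge0 ?expR_gt0.
have wd0 : 0 < willie_defect.
  by rewrite ltr_wpDr ?mulr_gt0 ?expR_gt0 // divr_ge0 ?expR_ge0.
have w0 := word_law_ge0 x0 p10 al01; have w1 := word_law_sum x0 al p11.
have uWV := wordV_unitary; have ubU := blockU_unitary.
have J0 : (0 < #|{: 'I_M * 'I_K}|)%N by rewrite card_prod !card_ord muln_gt0 M0.
pose defect := resolv_defect word_law (fun x : word => wordV x) (fun x : word => worda x)
  blockU blockb G (J := ('I_M * 'I_K)%type).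
have defect_ge0 c : 0 <= defect c.
  by apply: resolv_defect_ge0 => //; [exact: worda_ge0|exact: blockb_ge0].
have Ed : \sum_(c : {ffun 'I_M * 'I_K -> word}) (\prod_l word_law (c l)) * defect c <= willie_defect.
  have G0 : 0 <= G by exact: expR_ge0.
  apply: le_trans (expect_resolv_defect w0 w1 uWV ubU worda_ge0 worda_sum blockb_ge0 G0 J0) _.
  rewrite card_prod !card_ord lerD2r ler_pM2l //; exact: expect_unlikely_mass.
have Eb := expect_bob_error p10 p11 al01 P0 P1 Pdom dl01 M0 K0.
(* Each ratio to its bound has mean at most 1, so some codebook has sum at most 2, and both ratios
   are then at most 2. *)
have [c hc] : exists c : {ffun 'I_M * 'I_K -> word},
    bob_error x0 p1 al P dl M0 c / bob_bound + defect c / willie_defect <= 2.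
  apply: (@expect_exists _ _ _ _ w0 w1) => //.
  rewrite wsum_div2 -[2]/(1 + 1); apply: lerD; rewrite ler_pdivrMr // mul1r //.
exists c; split.
  have : bob_error x0 p1 al P dl M0 c / bob_bound <= 2.
    apply: le_trans hc; rewrite lerDl divr_ge0 //; exact: ltW.
  by rewrite ler_pdivrMr.
have hd : defect c <= 2 * willie_defect.
  have : defect c / willie_defect <= 2.
    apply: le_trans hc; rewrite lerDr divr_ge0 ?bob_error_ge0 //; exact: ltW.
  by rewrite ler_pdivrMr.
have /andP[t0 t1] := t01.
have tn := resolvability G w0 w1 uWV ubU worda_ge0 worda_sum blockb_ge0 blockb_sum J0 c t0.
have rE : emb #|{: 'I_M * 'I_K}|%:R^-1 *: (\sum_j fmx (wordV (c j)) (worda (c j))) =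
    emb (M * K)%:R^-1 *: \sum_(m < M) \sum_(k < K) rhow (c (m, k)).
  rewrite card_prod !card_ord; congr (_ *: _); rewrite pair_bigA.
  by apply: eq_bigr => -[m k] _; rewrite rhowE.
have sE : \sum_x emb (word_law x) *: fmx (wordV x) (worda x) = gtensI (fun l => mix l).
  by rewrite -mean_word; apply: eq_bigr => x _; rewrite rhowE.
rewrite rE sE in tn.
have rho_st : cstate (emb (M * K)%:R^-1 *: \sum_(m < M) \sum_(k < K) rhow (c (m, k))).
  rewrite -rE scaler_sumr; apply: (@cstate_convex _ _ _ _ (fun=> #|{: 'I_M * 'I_K}|%:R^-1)) => [_||j].
  - by rewrite invr_ge0.
  - by rewrite sumr_const -[_^-1 *+ _]mulr_natl mulfV // pnatr_eq0 -lt0n.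
  rewrite -rhowE; apply: (tens_state phi_bij phiE) => l; exact: rho_state.
have mix_st : cstate (gtensI (fun l => mix l)).
  by apply: (tens_state phi_bij phiE) => l; exact: mix_state.
have Dpos : 0 < (dpow d n)%:R :> R by rewrite dpow_exp expR_gt0.
have D1 : 1 <= (dpow d n)%:R :> R by rewrite ler1n -(ltr_nat R).
(* The shift t / d^n makes the total shift cost over d^n eigenvalues equal to t, while its logarithm
   only adds n ln d. *)
have e01 : 0 < t / (dpow d n)%:R <= 1.
  by rewrite divr_gt0 //= ler_pdivrMr // mul1r (le_trans t1).
have be0 : 0 < n%:R * log_bound + 1.
  by rewrite ltr_wpDl // mulr_ge0 // addr_ge0 // sumr_ge0.
have := qrelent_continuity rho_st mix_st ubU e01 be0 log_blockb tn.
rewrite -rho0nE qrelent_mean => h; apply: (le_trans h).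
rewrite divfK ?gt_eqF // /willie_bound lerD2l ln_div ?posrE //.
have lnD : ln (dpow d n)%:R = n%:R * ln d%:R :> R by rewrite dpow_exp expRK.
rewrite lnD.
have -> : 2 - (ln t - n%:R * ln d%:R) = 2 - ln t + n%:R * ln d%:R :> R by ring.
apply: ler_wpM2l.
  have lt : ln t <= 0 by apply: ln_le0.
  have ld : 0 <= n%:R * ln d%:R :> R by rewrite mulr_ge0 // ln_ge0 // ler1n.
  lra.
rewrite lerD2l ler_pdivrMr ?mulr_gt0 //.
have -> : willie_defect / t * (2 * t) = 2 * willie_defect by field; rewrite gt_eqF.
exact: hd.
Qed.

End BlockLength.
End CovertCode.

(** * The concrete complex numbers as a model *)

Section Concrete.
Variable R : realType.
Local Notation C := R[i].

Lemma real_complex_conj (a : R) : Num.conj (a%:C%C : C) = a%:C%C.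
Proof. by rewrite conj_Creal // complex_real. Qed.

Lemma conjCE (z : C) : Num.conj z = (complex.Re z -i* complex.Im z)%C.
Proof.
case: z => x y; rewrite {1}[Complex _ _]complexE complexiE rmorphD rmorphM /= conjCi.
rewrite !real_complex_conj -complexiE; apply/eqP; rewrite eq_complex /=.
by apply/andP; split; apply/eqP; ring.
Qed.

Fact model_reD (z w : C) : complex.Re (z + w) = complex.Re z + complex.Re w.
Proof. by case: z w => [? ?] []. Qed.
Fact model_imD (z w : C) : complex.Im (z + w) = complex.Im z + complex.Im w.
Proof. by case: z w => [? ?] []. Qed.
Fact model_reM (z w : C) :
  complex.Re (z * w) = complex.Re z * complex.Re w - complex.Im z * complex.Im w.
Proof. by case: z w => [? ?] []. Qed.
Fact model_imM (z w : C) :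
  complex.Im (z * w) = complex.Re z * complex.Im w + complex.Im z * complex.Re w.
Proof. by case: z w => [? ?] []. Qed.
Fact model_mul_conj (z : C) :
  z * Num.conj z = (complex.Re z ^+ 2 + complex.Im z ^+ 2)%:C%C.
Proof.
rewrite conjCE; case: z => a b; apply/eqP; rewrite eq_complex /=.
by apply/andP; split; apply/eqP; ring.
Qed.
Fact model_emb_re (z : C) : z \is Num.real -> (complex.Re z)%:C%C = z.
Proof. by move/complex_realP => [k ->]. Qed.

Definition complexC : complexModel R :=
  @ComplexModel R (complex_complex__canonical__Num_ClosedField R) (real_complex R)
    (@complex.Re R) (@complex.Im R) model_reD model_imD model_reM model_imM
    (fun=> erefl) (fun=> erefl) real_complex_conj model_mul_conj model_emb_re (@ler0c R).

Lemma qrelentE n (A B : 'M[C]_n) : qrelent A B = @cqrelent R complexC n A B.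
Proof. by []. Qed.

Lemma is_stateE n (A : 'M[C]_n) : is_state A = @cstate R complexC n A.
Proof. by []. Qed.

Lemma tensIE d n (f : 'I_n -> 'M[C]_d) : tensI f = @gtensI complexC d n f.
Proof. by elim: n f => //= n IH f; rewrite IH. Qed.

Lemma supp_subP n (A B : 'M[C]_n) : supp_sub A B -> exists D, A = B *m D.
Proof.
move=> /submxP[D e]; exists D^T.
by rewrite -[LHS]trmxK e trmx_mul trmxK.
Qed.

End Concrete.

(** * Codes with constants independent of the block length *)

Section FiniteBlocklength.
Variables (R : realType) (N d : nat) (Y : finType).
Variables (P : 'I_N.+1 -> Y -> R) (rho : 'I_N.+1 -> 'M[R[i]]_d) (pt : 'I_N -> R).
Hypotheses (P_distr : forall x, is_distr (P x)) (P_dom : forall x y, P ord0 y = 0 -> P x y = 0).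
Hypotheses (rho_st : forall x, is_state (rho x)) (rho_dom : forall x, supp_sub (rho x) (rho ord0)).
Hypothesis pt_distr : is_distr pt.
Local Notation rt := (\sum_(i < N) ((pt i)%:C)%C *: rho (lift ord0 i)).
Hypothesis not_mixture : rho ord0 <> rt.
Local Notation I_B := (\sum_(i < N) pt i * crelent (P (lift ord0 i)) (P ord0)).
Local Notation I_W := (\sum_(i < N) pt i * qrelent (rho (lift ord0 i)) (rho ord0)).
Local Notation X2 := (chi2 rt (rho ord0)).

Definition letter_pt (x : 'I_N.+1) : R := oapp pt 0 (unlift ord0 x).

Lemma letter_pt_ge0 x : 0 <= letter_pt x.
Proof. by rewrite /letter_pt; case: unliftP => //= i _; case: pt_distr. Qed.

Lemma sum_letter_pt (f : 'I_N.+1 -> R) :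
  \sum_x letter_pt x * f x = \sum_(i < N) pt i * f (lift ord0 i).
Proof.
rewrite big_ord_recl /letter_pt unlift_none mul0r add0r.
by apply: eq_bigr => i _; rewrite liftK.
Qed.

Lemma letter_pt_sum : \sum_x letter_pt x = 1.
Proof.
have := sum_letter_pt (fun=> 1); under eq_bigr do rewrite mulr1.
by move=> ->; under eq_bigr do rewrite mulr1; case: pt_distr.
Qed.

Local Notation CR := (complexC R).

Lemma rho1E : rt = @rho1 R CR d _ rho letter_pt.
Proof.
rewrite /rho1 big_ord_recl /letter_pt unlift_none /= rmorph0 scale0r add0r.
by apply: eq_bigr => i _; rewrite liftK.
Qed.

Lemma rho_domC x : exists D, rho x = rho ord0 *m D.
Proof. exact: supp_subP. Qed.

Lemma rt_state : @cstate R CR d rt.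
Proof.
have [pt0 pt1] := pt_distr.
by apply: (@cstate_convex R CR d _ pt (fun i => rho (lift ord0 i))) => // i; exact: rho_st.
Qed.

Lemma rt_dom : exists D, (rt : 'M[CR]_d) = (rho ord0 : 'M[CR]_d) *m D.
Proof.
have /choice[D DE] := rho_domC.
exists (\sum_(i < N) ((pt i)%:C)%C *: D (lift ord0 i)); rewrite mulmx_sumr.
by apply: eq_bigr => i _; rewrite -scalemxAr -DE.
Qed.

Definition mixture_qrelent s : R := cqrelent (@mixture R CR d (rho ord0) rt s) (rho ord0).

Lemma mixture_qrelent0 : mixture_qrelent 0 = 0.
Proof. by rewrite /mixture_qrelent mixture0 qrelent_self //; exact: rho_st. Qed.

Lemma herm_sqr_gt0 (A : 'M[CR]_d) : adj A = A -> A != 0 -> 0 < re (\tr (A *m A)).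
Proof.
move=> hA A0.
have -> : re (\tr (A *m A)) = \sum_i \sum_j normsq (A i j).
  rewrite /mxtrace re_sum; apply: eq_bigr => i _.
  by rewrite -{2}hA -normsq_row_sum.
rewrite lt_neqAle eq_sym sumr_ge0 ?andbT => [|i _]; last first.
  by rewrite sumr_ge0 // => j _; exact: normsq_ge0.
apply: contra_neqN A0 => /eqP/psumr_eq0P h; apply/matrixP => i j; rewrite mxE.
have := h (fun i _ => sumr_ge0 _ (fun j _ => normsq_ge0 (A i j))) i isT.
move/psumr_eq0P => /(_ (fun j _ => normsq_ge0 (A i j)) j isT) /eqP.
by rewrite normsq_eq0 => /eqP.
Qed.

(** The lower constant is a quarter of the squared Hilbert-Schmidt norm of rt - rho_0, positive
    because the states differ; the upper bound is the sharp one along the segment. *)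
Lemma mixture_qrelent_bounds : exists c : R, 0 < c /\ forall s, 0 < s < 1 ->
  c * s ^+ 2 <= mixture_qrelent s <= s ^+ 2 * (X2 / (1 - s)) / 2.
Proof.
have st0 : @cstate R CR d (rho ord0) by exact: rho_st.
have [D DE] := rt_dom.
pose Dl : 'M[CR]_d := rt - rho ord0.
exists (re (\tr (Dl *m Dl)) / 4); split.
  rewrite divr_gt0 // herm_sqr_gt0 //.
    exact: (Delta_herm st0 rt_state).
  by rewrite subr_eq0; apply/eqP => e; apply: not_mixture.
move=> s s01; apply/andP; split; last exact: (qrelent_mixture_le st0 rt_state DE s01).
have [D2 D2E] := mixture_dominated DE s.
have sM : cstate (@mixture R CR d (rho ord0) rt s).
  by apply: mixture_state => //; [exact: rt_state|lra].
apply: le_trans (qrelent_ge_sqr sM st0 D2E).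
have -> : @mixture R CR d (rho ord0) rt s - (rho ord0 : 'M[CR]_d) = emb CR s *: Dl.
  by rewrite /mixture addrAC subrr add0r.
rewrite -scalemxAl -scalemxAr !mxtraceZ !reZ.
by rewrite le_eqVlt; apply/orP; left; apply/eqP; ring.
Qed.

(** At s = 1/2 the bounds place a positive number below chi^2 / 4. *)
Lemma chi2_gt0 : 0 < chi2 rt (rho ord0).
Proof.
have [c [c0 bounds]] := mixture_qrelent_bounds.
move: (chi2 _ _) bounds => X bounds.
have h01 : 0 < (1 / 2 : R) < 1 by lra.
have /andP[h1 h2] := bounds (1 / 2) h01.
have e1 : 1 - 1 / 2 = 2^-1 :> R by field.
have := le_trans h1 h2; rewrite e1 invrK expr2; lra.
Qed.

Lemma errB_ge0 n (S : scheme N Y n) : 0 <= errB P S.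
Proof.
rewrite /errB mulr_ge0 ?invr_ge0 //; do 3![apply: sumr_ge0 => ? _].
by rewrite mulr_ge0 // prodr_ge0 // => l _; exact: (P_distr _).1.
Qed.

Lemma gibbs : 0 <= I_B.
Proof.
have [pt0 pt1] := pt_distr.
rewrite sumr_ge0 // => i _; rewrite mulr_ge0 //.
have [q0 q1] := P_distr (lift ord0 i); have [r0 r1] := P_distr ord0.
have -> : 0 = \sum_y (P (lift ord0 i) y - P ord0 y) by rewrite sumrB q1 r1 subrr.
apply: ler_sum => y _; have [e|nz] := eqVneq (P (lift ord0 i) y) 0.
  by rewrite e mul0r sub0r oppr_le0.
have qp : 0 < P (lift ord0 i) y by rewrite lt_neqAle eq_sym nz q0.
have rp : 0 < P ord0 y.
  by rewrite lt_neqAle eq_sym r0 andbT; apply: contra_neqN nz => /eqP/P_dom ->.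
by rewrite ln_div ?posrE //; apply: mul_ln_ge => // /eqP; rewrite gt_eqF.
Qed.

(** Interface to the asymptotics: the four constants are chosen before n, M, K and the weights, so
    that only real analysis remains. *)
Lemma finite_blocklength : exists kB kW chB L : R,
  [/\ 0 < kB, 0 < kW, 0 <= chB & 0 <= L] /\
  forall (n M K : nat) (al : 'I_n -> R) (dl t : R), let A := \sum_l al l in
  (forall l, 0 <= al l <= 1) -> 0 <= dl <= 1 -> 0 < t <= 1 -> (0 < M)%N -> (0 < K)%N ->
  exists S : scheme N Y n, [/\ sM S = M, sK S = K,
    errB P S <= 2 * (expR (- (A * dl ^+ 2 * kB)) +
      M.-1%:R * (expR (- (A * (I_B - dl))) * expR (chB * \sum_l al l ^+ 2))) &
    `|qrelent (rhobar rho S) (rho0n rho n) - \sum_l mixture_qrelent (al l)| <=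
      t + (2 - ln t + (n%:R * L + 1)) * (3 * t / 2 +
        (2 * expR (- (A * dl ^+ 2 * kW)) + expR (A * (I_W + dl)) / (M * K)%:R) / t)].
Proof.
have /choice[Va h] : forall x, exists Va : 'M[CR]_d * ('I_d -> R),
    [/\ Va.1 \is unitarymx, rho x = fmx Va.1 Va.2, (forall i, 0 <= Va.2 i) & \sum_i Va.2 i = 1].
  move=> x; have := rho_st x; rewrite is_stateE => /cstateP[W [w ?]]; by exists (W, w).
pose V x := (Va x).1; pose a x := (Va x).2.
have uV x : V x \is unitarymx by case: (h x).
have rhoE x : rho x = fmx (V x) (a x) by case: (h x).
have a0 x i : 0 <= a x i by rewrite /a; case: (h x).
have a1 x : \sum_i a x i = 1 by case: (h x).
(* In dimension 0 the eigenvalues could not sum to 1. *)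
have d0 : (0 < d)%N.
  rewrite lt0n; apply/eqP => d_eq0; have := a1 ord0.
  by rewrite big1 => [/eqP|i _]; [rewrite eq_sym oner_eq0|have := ltn_ord i; rewrite [in X in (_ < X)%N]d_eq0].
have p0 := letter_pt_ge0; have p1 := letter_pt_sum.
have P0 x y : 0 <= P x y by case: (P_distr x).
have P1 x : \sum_y P x y = 1 by case: (P_distr x).
have LB0 : 0 <= log_bound ord0 a by rewrite addr_ge0 // sumr_ge0.
have tB0 : 0 <= bob_tail_const ord0 letter_pt P.
  by apply: tail_const_ge0 => t; rewrite mulr_ge0.
have tW0 : 0 <= willie_tail_const ord0 V a letter_pt.
  by apply: tail_const_ge0 => t; rewrite mulr_ge0 // mulr_ge0 ?overlap_ge0.
exists (4 * (bob_tail_const ord0 letter_pt P + 1))^-1,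
  (4 * (willie_tail_const ord0 V a letter_pt + 1))^-1,
  (bob_chi ord0 letter_pt P), (ln d%:R + log_bound ord0 a); split.
  split; rewrite ?invr_gt0; [lra|lra| |].
    by rewrite sumr_ge0 // => y _; rewrite divr_ge0 ?sqr_ge0.
  by rewrite addr_ge0 // ln_ge0 // ler1n.
move=> n M K al dl t A al01 dl01 t01 M0 K0.
have [phi [phi_bij phiE]] := gtensI_index CR d n.
have [c [cB cW]] := covert_code uV rhoE a0 a1 rho_domC p0 p1 al01 dl01 phi_bij phiE
  P0 P1 P_dom M0 K0 t01 d0.
exists (@Scheme N Y n M K M0 K0 (fun m k => c (m, k))
  (fun y k => threshold_dec ord0 letter_pt al P dl M0 c y k)); split=> //.
  by move: cB; rewrite /bob_bound sum_letter_pt.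
have E1 : rhobar rho (@Scheme N Y n M K M0 K0 (fun m k => c (m, k))
  (fun y k => threshold_dec ord0 letter_pt al P dl M0 c y k)) =
  emb CR (M * K)%:R^-1 *: \sum_(m < M) \sum_(k < K) gtensI (fun l => rho (c (m, k) l)).
  rewrite /rhobar /= fmorphV rmorph_nat; congr (_ *: _).
  by apply: eq_bigr => m _; apply: eq_bigr => k _; rewrite tensIE.
rewrite E1 /rho0n tensIE qrelentE.
move: cW; rewrite -rho1E /willie_bound /willie_defect sum_letter_pt => cW.
apply: (le_trans cW); rewrite le_eqVlt; apply/orP; left; apply/eqP.
congr (t + _ * _); ring.
Qed.

End FiniteBlocklength.

Local Open Scope classical_set_scope.

(** * Asymptotics *)

Section RealEstimates.
Variable R : realType.
Implicit Types (c e u v x : R).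

Lemma expRN_le_exp x k : 0 < x -> expR (- x) <= k.+1`!%:R / x ^+ k.+1.
Proof.
move=> x0; rewrite expRN -[X in X / _]invrK -invfM lef_pV2 ?posrE ?expR_gt0 //; last first.
  by rewrite mulr_gt0 ?invr_gt0 ?exprn_gt0 ?ltr0n ?fact_gt0.
rewrite mulrC; apply: le_trans (expR_ge1Dxn k (ltW x0)).
by rewrite lerDr.
Qed.

(** The integer is at most e^v + 1 <= 2 e^v <= e^(v + 1). A separate v serves rates u that may be
    negative, when the integer is 1. *)
Lemma ln_truncn_expR u v : u <= v -> 0 <= v ->
  u <= ln (Num.truncn (expR u)).+1%:R <= v + 1.
Proof.
move=> uv v0; set m := Num.truncn _.
have /andP[m1 m2] : m%:R <= expR u < m.+1%:R by apply: truncn_itv; exact: expR_ge0.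
have mp : 0 < m.+1%:R :> R by rewrite ltr0n.
apply/andP; split; first by rewrite -[X in X <= _]expRK ler_ln ?posrE ?expR_gt0 // ltW.
rewrite -[X in _ <= X]expRK ler_ln ?posrE ?expR_gt0 // expRD -natr1.
have h1 : expR u <= expR v by rewrite ler_expR.
have h2 : 1 <= expR v by rewrite -(@expR0 R) ler_expR.
have h3 : 2 <= expR 1 :> R by have := expR_ge1Dx (1 : R); lra.
have h4 := expR_gt0 v; have : expR v * 2 <= expR v * expR 1 by rewrite ler_pM2l.
lra.
Qed.

Lemma sum_prefix (n m : nat) x : (m <= n)%N ->
  \sum_(l < n) (if (l < m)%N then x else 0) = m%:R * x.
Proof.
move=> mn; rewrite -big_mkcond /= -(big_ord_widen n (fun=> x) mn) sumr_const card_ord.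
by rewrite mulr_natl.
Qed.

(** The power 40 leaves e^20 after division by t = e^20, which still beats the factor e^(-12) lost
    in [defect_bound]. *)
Lemma exp_gauss_decay c : 0 < c -> exists2 Q, 0 <= Q &
  forall e x, 0 < e -> c / e ^+ 2 <= x -> expR (- x) <= Q * e ^+ 40.
Proof.
move=> c0; exists (20`!%:R / c ^+ 20); first by rewrite divr_ge0 ?exprn_ge0 ?ler0n ?ltW.
move=> e x e0 h; apply: (@le_trans _ _ (expR (- (c / e ^+ 2)))); first by rewrite ler_expR lerN2.
apply: le_trans (expRN_le_exp 19 (divr_gt0 c0 (exprn_gt0 2 e0))) _.
rewrite expr_div_n -exprM le_eqVlt; apply/orP; left; apply/eqP.
by rewrite invf_div [RHS]mulrAC mulrA.
Qed.

Lemma ln_inv_le e : 0 < e -> - ln e <= e^-1.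
Proof.
move=> e0; have := @ln_le_subr1 R e^-1; rewrite invr_gt0 lnV ?posrE // => /(_ e0); lra.
Qed.

Lemma exprn_le_small e k : 0 < e <= 1 -> e ^+ k <= 1 /\ e ^+ k.+1 <= e.
Proof.
move=> /andP[e0 e1]; have h m : e ^+ m <= 1 by apply: exprn_ile1 => //; exact: ltW.
by split=> //; rewrite exprS ler_piMr // ltW.
Qed.

(** With n' = nu n and A = n' s, n n' gs = A^2 X / 2 would ask for nu = 2 gs / (s^2 X). The extra
    factor 1 - s guarantees nu <= 1 and disappears in the limit. *)
Lemma active_fraction X c s gs : 0 < X -> 0 < c -> 0 < s <= 1 / 2 ->
  c * s ^+ 2 <= gs <= s ^+ 2 * (X / (1 - s)) / 2 ->
  let nu := (1 - s) * (2 * gs / (s ^+ 2 * X)) in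
  c / X <= nu <= 1 /\ gs = nu * (s ^+ 2 * X) / (2 * (1 - s)).
Proof.
move=> X0 c0 /andP[s0 s2] /andP[gl gu] nu.
have s2X : 0 < s ^+ 2 * X by rewrite mulr_gt0 ?exprn_gt0.
have s1 : 0 < 1 - s by lra.
split; last by rewrite /nu; field; rewrite !gt_eqF.
rewrite /nu mulrA ler_pdivlMr // ler_pdivrMr // mul1r.
have -> : c / X * (s ^+ 2 * X) = c * s ^+ 2 by field; rewrite gt_eqF.
have h1 : (1 - s) * gs <= s ^+ 2 * X / 2.
  have -> : s ^+ 2 * X / 2 = (1 - s) * (s ^+ 2 * (X / (1 - s)) / 2) by field; rewrite gt_eqF.
  by rewrite ler_pM2l.
have h2 : 1 / 2 * (c * s ^+ 2) <= (1 - s) * gs.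
  have h0 : 1 / 2 <= 1 - s by lra.
  have hc : 0 <= c * s ^+ 2 by rewrite mulr_ge0 ?exprn_ge0 // ltW.
  by apply: (le_trans (ler_wpM2r hc h0)); rewrite ler_pM2l.
apply/andP; split; lra.
Qed.

(** Rounding loses less than one position, that is e^12 of the block; e <= c then leaves at least
    half of the lower bound 2c. *)
Lemma active_positions e c nu (n : nat) : 0 < e <= 1 -> e ^+ 12 * n%:R = 1 -> e <= c ->
  2 * c <= nu <= 1 -> let n' := Num.truncn (nu * n%:R) in
  [/\ (n' <= n)%N, c <= e ^+ 12 * n'%:R & nu - e ^+ 12 <= e ^+ 12 * n'%:R <= nu].
Proof.
move=> e01 nE ec /andP[cnu nu1] n'; have /andP[e0 e1] := e01.
have e12 : 0 < e ^+ 12 by exact: exprn_gt0.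
have nu0 : 0 <= nu by lra.
have /andP[n'l n'u] : n'%:R <= nu * n%:R < n'.+1%:R by apply: truncn_itv; rewrite mulr_ge0.
have n'n : (n' <= n)%N by rewrite -(ler_nat R); apply: (le_trans n'l); rewrite ler_piMl.
have h1 : e ^+ 12 * n'%:R <= nu.
  by have := ler_wpM2l (ltW e12) n'l; rewrite mulrCA nE mulr1.
have h2 : nu - e ^+ 12 <= e ^+ 12 * n'%:R.
  rewrite -natr1 in n'u; have := ler_wpM2l (ltW e12) (ltW n'u).
  by rewrite mulrCA nE mulr1 mulrDr mulr1 lerBlDr.
have [_ h3] := exprn_le_small 11 e01.
split=> //; last by rewrite h1 h2.
lra.
Qed.

Lemma ratio_bound e c s nu nu' : 0 < e <= 1 -> 0 < c <= nu' -> 0 < s <= 1 / 2 -> s <= e ->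
  nu - e ^+ 12 <= nu' <= nu -> 0 <= nu / nu' / (1 - s) - 1 <= (3 / c + 2) * e.
Proof.
move=> e01 /andP[c0 cnu] /andP[s0 s2] se /andP[nul nuu]; have /andP[e0 e1] := e01.
have nu'0 : 0 < nu' by lra.
have s1 : 0 < 1 - s by lra.
have [_ e12] := exprn_le_small 11 e01.
have r1 : 1 <= nu / nu' by rewrite ler_pdivlMr // mul1r.
have ec : 0 < e / c by rewrite divr_gt0.
have h1 : nu / nu' <= 1 + e / c.
  rewrite ler_pdivrMr // mulrDl mul1r.
  have : e <= e / c * nu' by rewrite mulrAC ler_pdivlMr // ler_pM2l.
  lra.
apply/andP; split; first by rewrite subr_ge0 ler_pdivlMr //; lra.
rewrite lerBlDr ler_pdivrMr //; apply: (le_trans h1).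
have -> : (3 / c + 2) * e = 3 * (e / c) + 2 * e by ring.
have h4 : (e / c) * s <= e / c * (1 / 2) by rewrite ler_wpM2l // ltW.
have h5 : e * s <= e * (1 / 2) by rewrite ler_pM2l.
nra.
Qed.

(** With t = e^20 and n = e^(-12), the first factor is O(e^(-12)) because - ln t <= 20 / e, and the
    second is O(e^20). *)
Lemma defect_bound e L QW Q1 E1 E2 : 0 < e <= 1 -> 0 <= L -> 0 <= QW -> 0 <= Q1 ->
  0 <= E1 <= QW * e ^+ 40 -> 0 <= E2 <= Q1 * e ^+ 40 ->
  e ^+ 20 + (2 - ln (e ^+ 20) + ((e ^+ 12)^-1 * L + 1)) *
    (3 * e ^+ 20 / 2 + (2 * E1 + E2) / e ^+ 20) <=
  (1 + (23 + L) * (3 / 2 + 2 * QW + Q1)) * e ^+ 8.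
Proof.
move=> e01 L0 QW0 Q10 /andP[E10 E1l] /andP[E20 E2l]; have /andP[e0 e1] := e01.
have eX k : 0 < e ^+ k by exact: exprn_gt0.
have [e12 _] := exprn_le_small 12 e01; have [_ e12'] := exprn_le_small 11 e01.
have inv12 : 1 <= (e ^+ 12)^-1 by rewrite invf_ge1.
have inv1 : e^-1 <= (e ^+ 12)^-1 by rewrite lef_pV2 ?posrE.
have lnt : - ln (e ^+ 20) <= 20 * (e ^+ 12)^-1.
  have -> : - ln (e ^+ 20) = 20 * - ln e by rewrite lnXn // mulrN mulr_natl.
  by rewrite ler_pM2l //; apply: le_trans inv1; exact: ln_inv_le.
have F : 2 - ln (e ^+ 20) + ((e ^+ 12)^-1 * L + 1) <= (23 + L) * (e ^+ 12)^-1 by lra.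
have G : 3 * e ^+ 20 / 2 + (2 * E1 + E2) / e ^+ 20 <= (3 / 2 + 2 * QW + Q1) * e ^+ 20.
  have : (2 * E1 + E2) / e ^+ 20 <= (2 * QW + Q1) * e ^+ 20.
    have e40 : e ^+ 20 * e ^+ 20 = e ^+ 40 by rewrite -exprD.
    rewrite ler_pdivrMr // -[_ * e ^+ 20 * e ^+ 20]mulrA e40; lra.
  lra.
have G0 : 0 <= 3 * e ^+ 20 / 2 + (2 * E1 + E2) / e ^+ 20.
  apply: addr_ge0; first by rewrite divr_ge0 // mulr_ge0 // ltW.
  by apply: divr_ge0; [lra|exact: ltW].
have e20 : e ^+ 20 = e ^+ 12 * e ^+ 8 by rewrite -exprD.
rewrite [X in _ <= X]mulrDl mul1r; apply: lerD; first by rewrite e20 ler_piMl // ltW.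
apply: (le_trans (ler_wpM2r G0 F)).
apply: (@le_trans _ _ ((23 + L) * (e ^+ 12)^-1 * ((3 / 2 + 2 * QW + Q1) * e ^+ 20))).
  by apply: ler_wpM2l => //; apply: mulr_ge0; [lra|rewrite invr_ge0 ltW].
rewrite e20 le_eqVlt; apply/orP; left; apply/eqP; field; exact: lt0r_neq0.
Qed.

(** The summand 1 comes from rounding M or K to integers, and is absorbed by 1 / A = O(e). *)
Lemma rate_bound A c e r v y : 0 < A -> A^-1 <= c^-1 * e -> 0 < c -> 0 < e ->
  A * (r - v * e) <= y <= A * (r + v * e) + 1 -> 0 <= v -> `|y / A - r| <= (v + c^-1) * e.
Proof.
move=> A0 Ac c0 e0 /andP[h1 h2] v0.
have h1' : r - v * e <= y / A by rewrite ler_pdivlMr // mulrC.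
have h2' : y / A <= r + v * e + A^-1 by rewrite ler_pdivrMr // mulrDl mulVf ?gt_eqF // mulrC.
have p0 : 0 <= c^-1 * e by rewrite mulr_ge0 // ?invr_ge0 ltW.
have p1 : 0 <= v * e by rewrite mulr_ge0 // ltW.
by rewrite ler_norml mulrDl; apply/andP; split; lra.
Qed.

Lemma le_sum4 c1 c2 c3 c4 : 0 <= c1 -> 0 <= c2 -> 0 <= c3 -> 0 <= c4 ->
  [/\ c1 <= c1 + c2 + c3 + c4, c2 <= c1 + c2 + c3 + c4, c3 <= c1 + c2 + c3 + c4 &
      c4 <= c1 + c2 + c3 + c4].
Proof. by move=> *; split; lra. Qed.

Lemma div_half_le (X s : R) : 0 <= X -> s <= 1 / 2 -> X / (2 * (1 - s)) <= X.
Proof.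
move=> X0 s2; rewrite ler_pdivrMr; last by lra.
by rewrite ler_peMr //; lra.
Qed.

Lemma defect_scaling (x y c z u : R) : c != 0 ->
  x / c ^+ 2 * y * (u ^+ 2 * z) = x * ((u / c) ^+ 2 * (y * z)).
Proof. by move=> ?; field. Qed.

(** Here y = e^4, so that n = y^(-3) and A = nu' / y. The first error comes from rounding nu to nu'
    and from the factor 1 - s, the second from imperfect simulation. *)
Lemma rate_identity (X s nu nu' y dd : R) : nu' != 0 -> y != 0 -> 1 - s != 0 ->
  (y * y * y)^-1 * (dd + nu' / (y * y * y) * (nu * (y * y * y * y * X) / (2 * (1 - s)))) /
    (nu' ^+ 2 / (y * y)) - X / 2 =
  X / 2 * (nu / nu' / (1 - s) - 1) + dd / (nu' ^+ 2 * y).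
Proof. by move=> ? ? ?; field; do ?[apply/andP; split]. Qed.

End RealEstimates.

Section Limits.
Variable R : realType.

Lemma inv_root12 : exists e : nat -> R,
  (forall n, (0 < n)%N -> 0 < e n /\ e n ^+ 12 * n%:R = 1) /\ e @ \oo --> 0.
Proof.
exists (fun n => expR (- (ln n%:R / 12))); split=> [n n0|].
  have nR : 0 < n%:R :> R by rewrite ltr0n.
  split; first exact: expR_gt0.
  rewrite -expRM_natl mulrN mulrC -{1}[n%:R]lnK ?posrE // -expRD.
  have -> : ln n%:R - 12 * (ln n%:R / 12) = 0 :> R by field.
  exact: expR0.
apply/cvgrPdist_le => eps eps0; near=> n.
have n0 : 0 < n%:R :> R by rewrite ltr0n; near: n; exact: nbhs_infty_gt.
rewrite sub0r normrN ger0_norm ?expR_ge0 // -[leRHS]lnK ?posrE // ler_expR.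
rewrite lerNl ler_pdivlMr // -ler_expR lnK ?posrE //.
by near: n; exact: nbhs_infty_ger.
Unshelve. all: by end_near. Qed.

Lemma cvg_of_rate (C : R) (u e : nat -> R) (l : R) : e @ \oo --> 0 ->
  (\forall n \near \oo, `|u n - l| <= C * e n) -> u @ \oo --> l.
Proof.
move=> e0 h; have Ce0 : (fun n => C * e n) @ \oo --> 0.
  by rewrite -(mulr0 C); apply: cvgM => //; exact: cvg_cst.
apply/cvgrPdist_le => eps eps0; near=> n.
apply: (@le_trans _ _ (C * e n)); first by rewrite distrC; near: n.
apply: le_trans (ler_norm _) _; rewrite -normrN -sub0r; near: n.
by move/cvgrPdist_le : Ce0 => /(_ eps eps0).
Unshelve. all: by end_near. Qed.

End Limits.

(** * Choice of parameters and passage to the limit *)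

Section Asymptotics.
Variables (R : realType) (Sch : nat -> Type).
Variables (nM nK : forall n, Sch n -> nat) (err D : forall n, Sch n -> R).
Variables (g : R -> R) (X cg kB kW chB L IB IW : R).
Hypotheses (cg0 : 0 < cg) (kB0 : 0 < kB) (kW0 : 0 < kW) (chB0 : 0 <= chB) (L0 : 0 <= L).
Hypotheses (IB0 : 0 <= IB) (X0 : 0 < X) (g00 : g 0 = 0) (err0 : forall n (S : Sch n), 0 <= err S).
Hypothesis gb : forall s, 0 < s < 1 -> cg * s ^+ 2 <= g s <= s ^+ 2 * (X / (1 - s)) / 2.
Hypothesis fin : forall (n M K : nat) (al : 'I_n -> R) (dl t : R), let A := \sum_l al l in
  (forall l, 0 <= al l <= 1) -> 0 <= dl <= 1 -> 0 < t <= 1 -> (0 < M)%N -> (0 < K)%N ->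
  exists S : Sch n, [/\ nM S = M, nK S = K,
    err S <= 2 * (expR (- (A * dl ^+ 2 * kB)) +
      M.-1%:R * (expR (- (A * (IB - dl))) * expR (chB * \sum_l al l ^+ 2))) &
    `|D S - \sum_l g (al l)| <=
      t + (2 - ln t + (n%:R * L + 1)) * (3 * t / 2 +
        (2 * expR (- (A * dl ^+ 2 * kW)) + expR (A * (IW + dl)) / (M * K)%:R) / t)].
Local Notation J := (Num.max 0 (IW - IB)).

(* [A] is the expected number of non-innocent symbols in a codeword. *)
Definition near_optimal C e n (S : Sch n) (A q : R) : Prop :=
  [/\ 0 < A, n%:R * D S = A ^+ 2 * q, `|q - X / 2| <= C * e & `|D S| <= C * e] /\
  [/\ `|err S| <= C * e, `|ln (nM S)%:R / A - IB| <= C * e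
    & `|ln (nK S)%:R / A - J| <= C * e].

(* Codewords use only the first [n'] positions, each with weight [s] on the
   non-innocent symbols; [n' / n] is close to [2 * g s / (s ^+ 2 * X)], so that
   [n * n' * g s] is close to [(n' * s) ^+ 2 * X / 2]. *)
Lemma near_optimal_exists : exists C e0 : R, [/\ 0 <= C, 0 < e0 & forall (n : nat) (e : R),
  0 < e <= e0 -> e ^+ 12 * n%:R = 1 -> exists S A q, @near_optimal C e n S A q].
Proof.
have J0 : 0 <= J by rewrite le_max lexx.
have JI : IW - IB <= J by rewrite le_max lexx orbT.
pose c1 := cg / X; have c10 : 0 < c1 by rewrite divr_gt0.
pose c2 := c1 / 2; have c20 : 0 < c2 by rewrite divr_gt0.
have c12 : 2 * c2 = c1 by rewrite /c2 mulrC divfK // pnatr_eq0.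
have [QB QB0 decB] := exp_gauss_decay (mulr_gt0 c20 kB0).
have [QW QW0 decW] := exp_gauss_decay (mulr_gt0 c20 kW0).
have [Q1 Q10 dec1] := exp_gauss_decay c20.
have c2i : 0 <= c2^-1 by rewrite invr_ge0 ltW.
pose CK := 1 + (23 + L) * (3 / 2 + 2 * QW + Q1).
have CK0 : 0 <= CK.
  rewrite /CK addr_ge0 // mulr_ge0 ?addr_ge0 //; last by rewrite mulr_ge0.
  by rewrite divr_ge0.
pose Cq := X / 2 * (3 / c2 + 2) + CK / c2 ^+ 2.
pose CD := X + CK.
pose CE := 2 * (QB + Q1 * expR chB).
pose CM := 4 + c2^-1.
have Cq0 : 0 <= Cq.
  apply: addr_ge0; apply: mulr_ge0 => //.
  - by rewrite divr_ge0 // ltW.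
  - by rewrite addr_ge0 // mulr_ge0.
  - by rewrite invr_ge0 exprn_ge0 // ltW.
have CD0 : 0 <= CD by rewrite addr_ge0 // ltW.
have CE0 : 0 <= CE by rewrite mulr_ge0 // addr_ge0 // mulr_ge0 // expR_ge0.
have CM0 : 0 <= CM by rewrite addr_ge0.
have [CqC CDC CEC CMC] := le_sum4 Cq0 CD0 CE0 CM0.
(* e <= 1/2 gives s <= 1/2, and e <= c2 keeps the active fraction at least c2 after rounding. *)
exists (Cq + CD + CE + CM), (Num.min (1 / 2) c2); split.
- exact: le_trans Cq0 CqC.
- by rewrite lt_min c20 andbT divr_gt0.
move: (Cq + CD + CE + CM) CqC CDC CEC CMC => CC CqC CDC CEC CMC.
move=> n e /andP[e0]; rewrite le_min => /andP[e2 ec2] nE.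
have e1 : e <= 1 by apply: (le_trans e2); rewrite ler_pdivrMr // mul1r ler1n.
have e01 : 0 < e <= 1 by rewrite e0.
have eX k : 0 < e ^+ k by exact: exprn_gt0.
have eXle k : e ^+ k <= 1 by case: (exprn_le_small k e01).
have eX1 k : e ^+ k.+1 <= e by case: (exprn_le_small k e01).
have nE' : n%:R = (e ^+ 12)^-1 :> R by rewrite -[LHS](mulKf (lt0r_neq0 (eX 12))) nE mulr1.
(* With n = e^(-12) this weight makes A of order e^(-4), which diverges, while n' s^2, and with it
   both D and the false-alarm correction, is O(e^4). *)
pose s := e ^+ 8; have s0 : 0 < s by exact: eX.
have s2 : s <= 1 / 2 by exact: le_trans (eX1 7) e2.
have s02 : 0 < s <= 1 / 2 by rewrite s0.
have s1 : s < 1 by apply: (le_lt_trans s2); rewrite ltr_pdivrMr // mul1r ltr1n.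
have s1' : 0 < 1 - s by rewrite subr_gt0.
have s01 : 0 < s < 1 by rewrite s0.
have gsb := gb s01; set gs := g s in gsb.
have := active_fraction X0 cg0 s02 gsb.
set nu := (1 - s) * _ => -[/andP[nuc nu1] gsE].
have nu12 : 2 * c2 <= nu <= 1 by rewrite c12 nuc.
have g0 : 0 < gs.
  by case/andP: gsb => + _; apply: lt_le_trans; rewrite mulr_gt0 ?exprn_gt0.
have := active_positions e01 nE ec2 nu12.
set n' := Num.truncn _; set nu' := e ^+ 12 * n'%:R => -[n'n nu'c nu'lu].
have nu'0 : 0 < nu' by exact: lt_le_trans nu'c.
have nu'1 : nu' <= 1 by case/andP: nu'lu => _ /le_trans; apply.
pose al (l : 'I_n) := if (l < n')%N then s else 0.
pose A := \sum_l al l.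
have AE : A = nu' / e ^+ 4.
  rewrite /A sum_prefix // /nu' /s; field; exact: lt0r_neq0.
have A0 : 0 < A by rewrite AE divr_gt0.
have Al : c2 / e ^+ 4 <= A by rewrite AE ler_pM2r ?invr_gt0.
have al01 l : 0 <= al l <= 1 by rewrite /al; case: ifP => _; rewrite ?lexx ?ler01 // (ltW s0) ltW.
have al2 : \sum_l al l ^+ 2 <= 1.
  have -> : \sum_l al l ^+ 2 = \sum_(l < n) (if (l < n')%N then s ^+ 2 else 0).
    by apply: eq_bigr => l _; rewrite /al; case: ifP => _ //; rewrite expr0n.
  rewrite sum_prefix //.
  have -> : n'%:R * s ^+ 2 = nu' * e ^+ 4 by rewrite /nu' /s; ring.
  by apply: mulr_ile1 => //; exact: ltW.
have gal : \sum_l g (al l) = n'%:R * gs.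
  rewrite -(sum_prefix gs n'n); apply: eq_bigr => l _.
  by rewrite /al; case: ifP.
have dl01 : 0 <= e <= 1 by rewrite (ltW e0).
have t01 : 0 < e ^+ 20 <= 1 by rewrite eX eXle.
(* The threshold sits at IB - e, so the rate IB - 2e leaves a factor exp(- A e) for false alarms.
   Adding J + 4e for the key brings the total rate to at least IW + 2e, beyond the IW + e needed for
   simulation. *)
pose M := (Num.truncn (expR (A * (IB - 2 * e)))).+1.
pose K := (Num.truncn (expR (A * (J + 4 * e)))).+1.
have [S [SM SK SB SW]] := @fin n M K al e (e ^+ 20) al01 dl01 t01 (ltn0Sn _) (ltn0Sn _).
rewrite -/A in SB SW; rewrite gal nE' in SW.
have Ae2 : c2 / e ^+ 2 <= A * e ^+ 2.
  have : c2 / e ^+ 4 * e ^+ 2 <= A * e ^+ 2 by rewrite ler_pM2r.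
  by apply: le_trans; have -> : c2 / e ^+ 4 * e ^+ 2 = c2 / e ^+ 2 by field; exact: lt0r_neq0.
have Ae : c2 / e ^+ 2 <= A * e.
  by apply: (le_trans Ae2); rewrite ler_pM2l // (eX1 1).
have decE : expR (- (A * e)) <= Q1 * e ^+ 40 by exact: dec1.
have bobE : expR (- (A * e ^+ 2 * kB)) <= QB * e ^+ 40.
  by apply: decB => //; rewrite mulrAC ler_pM2r.
have willieE : expR (- (A * e ^+ 2 * kW)) <= QW * e ^+ 40.
  by apply: decW => //; rewrite mulrAC ler_pM2r.
have truncS u : expR u <= (Num.truncn (expR u)).+1%:R.
  by have /andP[_ /ltW] := truncn_itv (expR_ge0 u).
have secretE : expR (A * (IW + e)) / (M * K)%:R <= Q1 * e ^+ 40.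
  apply: le_trans decE; rewrite ler_pdivrMr ?ltr0n ?muln_gt0 // natrM.
  apply: (@le_trans _ _ (expR (- (A * e)) * (expR (A * (IB - 2 * e)) * expR (A * (J + 4 * e))))).
    rewrite -!expRD ler_expR -mulrN -!mulrDr ler_pM2l //.
    have -> : - e + (IB - 2 * e + (J + 4 * e)) = (IB + J) + e by ring.
    by rewrite lerD2r -lerBlDl.
  rewrite ler_pM2l ?expR_gt0 //; apply: ler_pM; rewrite ?expR_ge0 //; exact: truncS.
have kappa : `|D S - n'%:R * gs| <= CK * e ^+ 8.
  apply: (le_trans SW); apply: defect_bound => //.
    by rewrite expR_ge0.
  by rewrite secretE andbT divr_ge0 ?expR_ge0.
have eX40 : e ^+ 40 <= e by exact: (eX1 39).
have errE : err S <= CE * e.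
  have -> : CE * e = 2 * (QB * e + Q1 * expR chB * e) by rewrite /CE; ring.
  apply: (le_trans SB); rewrite ler_pM2l //; apply: lerD.
    by apply: (le_trans bobE); rewrite ler_wpM2l.
  apply: (@le_trans _ _ (expR (A * (IB - 2 * e)) * (expR (- (A * (IB - e))) * expR chB))).
    apply: ler_pM; rewrite ?mulr_ge0 ?expR_ge0 //.
      (* The union bound counts M - 1 messages, which is exactly the truncated exponential. *)
      by rewrite /=; have /andP[] := truncn_itv (expR_ge0 (A * (IB - 2 * e))).
    rewrite ler_pM2l ?expR_gt0 // ler_expR ler_piMr //.
  rewrite mulrA -expRD.
  have -> : A * (IB - 2 * e) + - (A * (IB - e)) = - (A * e) by ring.
  rewrite mulrAC ler_wpM2r ?expR_ge0 //; apply: (le_trans decE).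
  by rewrite ler_wpM2l.
pose q := n%:R * D S / A ^+ 2.
have weaken x C1 C2 : x <= C1 * e -> C1 <= C2 -> x <= C2 * e.
  by move=> h1 h2; apply: (le_trans h1); rewrite ler_wpM2r // ltW.
have s_e : s <= e by exact: (eX1 7).
have invA : A^-1 <= c2^-1 * e.
  have h : A^-1 <= (c2 / e ^+ 4)^-1 by rewrite lef_pV2 ?posrE // divr_gt0.
  apply: (le_trans h); rewrite invf_div mulrC ler_pM2l ?invr_gt0 //; exact: (eX1 3).
have n'E : n'%:R = nu' / e ^+ 12 :> R by rewrite /nu' mulrC mulKf // lt0r_neq0.
have qE : `|q - X / 2| <= Cq * e.
  pose dd := D S - n'%:R * gs.
  have -> : q - X / 2 = X / 2 * (nu / nu' / (1 - s) - 1) + dd / (nu' ^+ 2 * e ^+ 4).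
    rewrite /q; have -> : D S = dd + n'%:R * gs by rewrite /dd subrK.
    rewrite gsE n'E nE' AE.
    have -> : s ^+ 2 = e ^+ 12 * e ^+ 4 by rewrite /s -exprM -exprD.
    have -> : (nu' / e ^+ 4) ^+ 2 = nu' ^+ 2 / (e ^+ 4 * e ^+ 4) by rewrite expr_div_n expr2.
    have -> : e ^+ 12 = e ^+ 4 * e ^+ 4 * e ^+ 4 by rewrite -!exprD.
    apply: rate_identity; exact: lt0r_neq0.
  have c2nu' : 0 < c2 <= nu' by rewrite c20.
  have /andP[r1 r2] := ratio_bound e01 c2nu' s02 s_e nu'lu.
  have d1 : `|dd / (nu' ^+ 2 * e ^+ 4)| <= CK / c2 ^+ 2 * e.
    have p0 : 0 < nu' ^+ 2 * e ^+ 4 by rewrite mulr_gt0 // exprn_gt0.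
    rewrite normrM normfV (gtr0_norm p0) ler_pdivrMr //.
    apply: (le_trans kappa).
    have -> : CK / c2 ^+ 2 * e * (nu' ^+ 2 * e ^+ 4) = CK * ((nu' / c2) ^+ 2 * e ^+ 5).
      by rewrite [e ^+ 5]exprS; apply: defect_scaling; exact: lt0r_neq0.
    have k1 : 1 <= (nu' / c2) ^+ 2 by rewrite exprn_ege1 // ler_pdivlMr // mul1r.
    rewrite ler_wpM2l //; apply: (@le_trans _ _ (e ^+ 5)); last by rewrite ler_peMl // ltW.
    by have -> : e ^+ 8 = e ^+ 5 * e ^+ 3; [rewrite -exprD|rewrite ler_piMr // ltW].
  have -> : Cq * e = X / 2 * ((3 / c2 + 2) * e) + CK / c2 ^+ 2 * e by rewrite /Cq mulrDl mulrA.
  apply: (le_trans (ler_normD _ _)); apply: lerD => //.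
  have X20 : 0 < X / 2 by rewrite divr_gt0.
  by rewrite normrM (gtr0_norm X20) ger0_norm // ler_pM2l.
have DE : `|D S| <= CD * e.
  have -> : D S = (D S - n'%:R * gs) + n'%:R * gs by rewrite subrK.
  apply: (le_trans (ler_normD _ _)); rewrite /CD addrC mulrDl; apply: lerD; last first.
    apply: (le_trans kappa); rewrite ler_wpM2l //; exact: (eX1 7).
  rewrite ger0_norm; last by rewrite mulr_ge0 // ltW.
  have -> : n'%:R * gs = nu' * nu * (X / (2 * (1 - s))) * e ^+ 4.
    rewrite n'E gsE.
    have -> : s ^+ 2 = e ^+ 12 * e ^+ 4 by rewrite /s -exprM -exprD.
    by field; do ?[apply/andP; split]; exact: lt0r_neq0.
  have Xs : X / (2 * (1 - s)) <= X by apply: div_half_le => //; exact: ltW.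
  have Xs0 : 0 <= X / (2 * (1 - s)) by rewrite divr_ge0 ?mulr_ge0 ?ltW.
  have nu0 : 0 <= nu by apply: le_trans nuc; exact: ltW.
  have nn : nu' * nu <= 1 by rewrite mulr_ile1 // ltW.
  have lX : nu' * nu * (X / (2 * (1 - s))) <= X by apply: le_trans Xs; rewrite ler_piMl.
  apply: (@le_trans _ _ (X * e ^+ 4)); first by rewrite ler_pM2r.
  by rewrite ler_pM2l // (eX1 3).
exists S, A, q; split; split => //.
- by rewrite /q [RHS]mulrC divfK // expf_eq0 /= gt_eqF.
- exact: weaken qE CqC.
- exact: weaken DE CDC.
- rewrite ger0_norm //; exact: weaken errE CEC.
- rewrite SM; apply: weaken CMC; apply: (rate_bound A0 invA) => //.
  have v0 : 0 <= A * (IB + 4 * e) by rewrite mulr_ge0 ?(ltW A0) // addr_ge0 // mulr_ge0 // ltW.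
  have uv : A * (IB - 2 * e) <= A * (IB + 4 * e).
    rewrite ler_pM2l // lerD2l (@le_trans _ _ 0) //; first by rewrite oppr_le0 mulr_ge0 // ltW.
    by rewrite mulr_ge0 // ltW.
  have /andP[h1 ->] := ln_truncn_expR uv v0; rewrite andbT; apply: le_trans h1.
  by rewrite ler_pM2l // lerD2l lerN2 ler_pM2r // ler_nat.
- rewrite SK; apply: weaken CMC; apply: (rate_bound A0 invA) => //.
  have u0 : 0 <= A * (J + 4 * e) by rewrite mulr_ge0 ?(ltW A0) // addr_ge0 // mulr_ge0 // ltW.
  have /andP[h1 ->] := ln_truncn_expR (lexx (A * (J + 4 * e))) u0; rewrite andbT.
  apply: le_trans h1; rewrite ler_pM2l // lerD2l (@le_trans _ _ 0) //.
    by rewrite oppr_le0 mulr_ge0 // ltW.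
  by rewrite mulr_ge0 // ltW.
Qed.

(** Since sqrt(n D) = A sqrt q with q tending to X / 2, rates relative to A become the required ones
    on division by den. *)
Lemma near_optimal_cvg (S0 : forall n, Sch n) : let den := Num.sqrt (X / 2) in
  exists S : forall n, Sch n,
    [/\ (fun n => D (S n)) @ \oo --> 0, (fun n => err (S n)) @ \oo --> 0,
      (fun n => ln (nM (S n))%:R / Num.sqrt (n%:R * D (S n))) @ \oo --> IB / den
    & (fun n => ln (nK (S n))%:R / Num.sqrt (n%:R * D (S n))) @ \oo --> J / den].
Proof.
move=> den; have [C [e0 [C0 e00 h]]] := near_optimal_exists.
have [e [eP e_cvg]] := inv_root12 R.
have ex n : exists SAq : Sch n * (R * R), (0 < n)%N -> e n <= e0 ->
    near_optimal C (e n) SAq.1 SAq.2.1 SAq.2.2.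
  have [/andP[n0 ne]|no] := boolP ((0 < n)%N && (e n <= e0)); last first.
    (* At n = 0 or for e n > e0, which happens for finitely many n, an arbitrary code is used. *)
    by exists (S0 n, (0, 0)) => n0 ne; rewrite n0 ne in no.
  have [en0 enE] := eP n n0.
  have [S [A [q SAq]]] := h n (e n) (introT andP (conj en0 ne)) enE.
  by exists (S, (A, q)).
pose SAq n := projT1 (cid (ex n)); pose S n := (SAq n).1.
pose A n := (SAq n).2.1; pose q n := (SAq n).2.2.
have optimal : \forall n \near \oo, near_optimal C (e n) (S n) (A n) (q n).
  have := nbhs_infty_gt 0; move/cvgrPdist_le : (e_cvg) => /(_ e0 e00).
  apply: filterS2 => n ne n0; apply: (projT2 (cid (ex n))) => //.
  by move: ne; rewrite sub0r normrN; apply: le_trans; exact: ler_norm.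
have q_cvg : q @ \oo --> X / 2.
  by apply: (cvg_of_rate (C := C) e_cvg); move: optimal; apply: filterS => n [[_ _ ? _] _].
have den0 : den != 0 by rewrite gt_eqF // sqrtr_gt0 divr_gt0.
have rate (y : nat -> R) l : (\forall n \near \oo, `|y n / A n - l| <= C * e n) ->
    (fun n => y n / Num.sqrt (n%:R * D (S n))) @ \oo --> l / den.
  move=> hy; have yA := cvg_of_rate (C := C) e_cvg hy.
  have sq : (fun n => Num.sqrt (q n)) @ \oo --> den.
    exact: (continuous_cvg _ (@sqrt_continuous R _) q_cvg).
  apply: cvg_trans (cvgM yA (cvgV den0 sq)); apply: near_eq_cvg.
  move: optimal; apply: filterS => n [[A0 nD _ _] _] /=.
  by rewrite nD sqrtrM ?sqr_ge0 // sqrtr_sqr gtr0_norm // invfM mulrA.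
exists S; split.
- by apply: (cvg_of_rate (C := C) e_cvg); move: optimal; apply: filterS => n [[_ _ _ ?] _]; rewrite subr0.
- by apply: (cvg_of_rate (C := C) e_cvg); move: optimal; apply: filterS => n [_ [? _ _]]; rewrite subr0.
- by apply: rate; move: optimal; apply: filterS => n [_ []].
- by apply: rate; move: optimal; apply: filterS => n [_ []].
Qed.

End Asymptotics.

Theorem theorem7 (R : realType) (N d : nat) (Y : finType)
    (P : 'I_N.+1 -> Y -> R) (rho : 'I_N.+1 -> 'M[R[i]]_d) (pt : 'I_N -> R) :
  (forall x, is_distr (P x)) ->
  (forall x y, P ord0 y = 0 -> P x y = 0) ->
  (forall x, is_state (rho x)) ->
  (forall x, supp_sub (rho x) (rho ord0)) ->
  ~ (exists pi : 'I_N -> R, is_distr pi /\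
       rho ord0 = \sum_(i < N) ((pi i)%:C)%C *: rho (lift ord0 i)) ->
  is_distr pt ->
  let rt := \sum_(i < N) ((pt i)%:C)%C *: rho (lift ord0 i) in
  let den := Num.sqrt (chi2 rt (rho ord0) / 2) in
  exists S : forall n, scheme N Y n,
    let Dn := fun n => qrelent (rhobar rho (S n)) (rho0n rho n) in
    [/\ Dn @ \oo --> (0 : R),
        (fun n => errB P (S n)) @ \oo --> (0 : R),
        (fun n => ln (sM (S n))%:R / Num.sqrt (n%:R * Dn n)) @ \oo -->
          (\sum_(i < N) pt i * crelent (P (lift ord0 i)) (P ord0)) / den
      & (fun n => ln (sK (S n))%:R / Num.sqrt (n%:R * Dn n)) @ \oo -->
          Num.max 0 (\sum_(i < N) pt i *
                       (qrelent (rho (lift ord0 i)) (rho ord0)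
                        - crelent (P (lift ord0 i)) (P ord0))) / den].
Proof.
move=> P_distr P_dom rho_st rho_dom not_mixt pt_distr rt den.
have not_mixture : rho ord0 <> rt by move=> e; apply: not_mixt; exists pt.
have [kB [kW [chB [L [[kB0 kW0 chB0 L0] fin]]]]] :=
  finite_blocklength P_distr P_dom rho_st rho_dom pt_distr.
have [c [c0 bounds]] := mixture_qrelent_bounds rho_st rho_dom pt_distr not_mixture.
have X0 := chi2_gt0 rho_st rho_dom pt_distr not_mixture.
have IB0 := gibbs P_distr P_dom pt_distr.
have g00 : mixture_qrelent rho pt 0 = 0 by exact: mixture_qrelent0.
(* Placeholder for short block lengths: one message, one key, Alice silent. *)
pose S0 n := @Scheme N Y n 1 1 isT isT (fun _ _ => [ffun=> ord0]) (fun _ _ => ord0).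
have [S [DS eS MS KS]] := near_optimal_cvg c0 kB0 kW0 chB0 L0 IB0 X0 g00
  (fun n => @errB_ge0 R N Y P P_distr n) bounds fin S0.
exists S; split => //.
under eq_bigr do rewrite mulrBr; rewrite sumrB.
exact: KS.
Qed.
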